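(* Let $K$ be a global function field of characteristic different from $2$ and let $G$ be a $2$-reduced finite group of order $n$ with $n\equiv 0$ or $2\bmod 8$. Then for any $G$-Galois algebra $L$ over $K$: (i) $q_L\simeq\langle 1,\dots,1\rangle$ if the Sylow $2$-subgroups of $G$ are non-cyclic; (ii) $q_L\simeq\langle 2,2d_{L/K},1,\dots,1\rangle$ otherwise.
   Context: A finite group $G$ is called $2$-reduced if $H^2(G,\mathbf Z/2\mathbf Z)$ contains no non-zero nilpotent element of the mod $2$ cohomology ring $H^*(G,\mathbf Z/2\mathbf Z)$. Let $K^s$ be a separable closure of $K$. A $G$-Galois algebra over $K$ is an étale $K$-algebra $L$ of degree $n=|G|$ endowed with an action of $G$ such that the induced action of $G$ on $\mathrm{Hom}_{K\text{-alg}}(L,K^s)$ is simply transitive. Its trace form is the quadratic form $q_L:L\to K$, $q_L(x)=\mathrm{Tr}_{L/K}(x^2)$, of rank $n$, and $d_{L/K}$ is the discriminant of the étale algebra $L/K$ (well defined modulo squares). $\langle a_1,\dots,a_n\rangle$ denotes the diagonal form $\sum a_iX_i^2$ and $\simeq$ denotes isometry of quadratic forms over $K$. *)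

(* Defs.v *)
From HB Require Import structures.
From mathcomp Require Import all_boot all_order all_algebra.
From mathcomp Require Import all_fingroup all_solvable all_field.

Set Implicit Arguments.
Unset Strict Implicit.
Unset Printing Implicit Defensive.

Import GRing.Theory.
Local Open Scope ring_scope.

(* Mod 2 cohomology of a finite group, via the inhomogeneous bar complex with *)
(* trivial coefficients Z/2Z = 'F_2.                                          *)

Section Mod2Cohomology.

Variable G : finGroupType.

Definition cochain (n : nat) : Type := {ffun {ffun 'I_n -> G} -> 'F_2}.

(* face i (x_0, ..., x_n) is (x_1, ..., x_n) for i = 0,                       *)
(* (x_0, ..., x_{i-1} x_i, ..., x_n) for 0 < i <= n, and (x_0, ..., x_{n-1})  *)
(* for i = n + 1.                                                             *)
Definition face (n : nat) (i : 'I_n.+2) (x : {ffun 'I_n.+1 -> G}) :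
    {ffun 'I_n -> G} :=
  [ffun j : 'I_n =>
     if (j.+1 < i)%N then x (widen_ord (leqnSn n) j)
     else if j.+1 == i :> nat
          then (x (widen_ord (leqnSn n) j) * x (lift ord0 j))%g
          else x (lift ord0 j)].

Definition coboundary (n : nat) (f : cochain n) : cochain n.+1 :=
  [ffun x => \sum_(i < n.+2) (-1) ^+ i * f (face i x)].

Definition is_cocycle (n : nat) (f : cochain n) : Prop := coboundary f = 0.

Definition is_coboundary (n : nat) : cochain n -> Prop :=
  match n with
  | 0 => fun f => f = 0
  | m.+1 => fun f => exists h : cochain m, f = coboundary h
  end.

Definition cup (p q : nat) (f : cochain p) (h : cochain q) : cochain (p + q) :=
  [ffun x : {ffun 'I_(p + q) -> G} =>
     f [ffun i => x (lshift q i)] * h [ffun j => x (rshift p j)]].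

Fixpoint cup_exp (d : nat) (f : cochain d) (k : nat) : cochain (k * d) :=
  match k return cochain (k * d) with
  | 0 => [ffun=> 1]
  | k'.+1 => cup f (cup_exp f k')
  end.

(* Stated on representatives: the class of a 2-cocycle f is nilpotent in      *)
(* H^*(G, Z/2Z) iff some cup power of f is a coboundary, and is zero iff f is *)
(* a coboundary.                                                              *)
Definition two_reduced : Prop :=
  forall f : cochain 2, is_cocycle f ->
    (exists k : nat, is_coboundary (cup_exp f k)) -> is_coboundary f.

End Mod2Cohomology.

Definition separable_closure (K Ks : fieldType) (iota : {rmorphism K -> Ks}) :
    Prop :=
  (forall x : Ks,
      exists2 p : {poly K}, separable_poly p & root (map_poly iota p) x) /\
  (forall p : {poly Ks},
      separable_poly p -> (1 < size p)%N -> exists x : Ks, root p x).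

(* L is a finite product of finite separable field extensions of K. *)
Definition etale (K : fieldType) (L : falgType K) : Prop :=
  exists (m : nat) (E : 'I_m -> fieldExtType K)
         (phi : forall i : 'I_m, {lrmorphism L -> E i}),
    [/\ forall i, separable 1 {:E i},
        forall x y : L, (forall i, phi i x = phi i y) -> x = y
      & forall z : (forall i, E i), exists x : L, forall i, phi i x = z i].

Section GaloisAlgebra.

Variables (K Ks : fieldType) (iota : {rmorphism K -> Ks}).
Variables (G : finGroupType) (L : falgType K).

(* K-algebra morphisms L -> Ks, where K acts on Ks through iota. *)
Definition alg_hom : Type := {lrmorphism L -> Ks | iota \; *%R}.

(* g acts on alg_hom by f |-> f \o act g^-1. *)
Definition is_galois_algebra (act : G -> {lrmorphism L -> L}) : Prop :=
  [/\ etale L,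
      \dim {:L} = #|G|,
      (forall x, act 1%g x = x) /\
        (forall g h x, act (g * h)%g x = act g (act h x)),
      inhabited alg_hom
    & forall f f' : alg_hom, exists! g : G, f' =1 f \o act g^-1%g].

End GaloisAlgebra.

Section TraceForm.

Variables (K : fieldType) (L : falgType K).

Definition alg_trace (x : L) : K :=
  \tr (passmx.mxof (vbasis {:L}) (vbasis {:L}) (amull x)).

Definition trace_form (x : L) : K := alg_trace (x ^+ 2).

Definition disc (n : nat) (b : n.-tuple L) : K :=
  \det (\matrix_(i < n, j < n) alg_trace (tnth b i * tnth b j)).

(* d represents d_{L/K}, which is defined up to nonzero squares. *)
Definition is_discriminant (d : K) : Prop :=
  exists2 b : (\dim {:L}).-tuple L, basis_of {:L} b & d = disc b.

End TraceForm.

Definition diag_form (K : fieldType) (a : seq K) (v : 'rV[K]_(size a)) : K :=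
  \sum_(i < size a) a`_i * v 0 i ^+ 2.
Arguments diag_form {K} a v.

Definition isometric (K : fieldType) (V W : lmodType K)
    (q : V -> K) (q' : W -> K) : Prop :=
  exists2 phi : {linear V -> W}, bijective phi & forall v, q' (phi v) = q v.

(* Main.v *)
(* Over a finite extension of K, quadratic forms of rank five are isotropic
   (Chevalley-Warning, Tsen-Lang) and -1 is a sum of two squares, so in the Witt
   ring W one has 4 = 0 and the products of three one-fold Pfister forms vanish.
   Hence two forms of the same rank and discriminant differ in W by a two-fold
   Pfister form, and by Springer's theorem they may be compared over an odd
   degree extension.

   Let E be a field component of L and let k be the fixed field of a Sylow
   2-subgroup Q of Gal(E/K). Over k the form q_L is the sum of |G|/|Q| copies of
   the trace form of E/k, whose class t(Q) in W is computed by transfer along a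
   tower of quadratic extensions:
   - t(Q) = 0 as soon as t(J) = 0 for some nontrivial J in Q;
   - t(J) = 0 if J is nonabelian of order 8 or if |J : Phi(J)| >= 8;
   - t(Q) = <2>(1 + <b>) + 2 with 2<b> = 2 if Q is cyclic of order at least 8;
   - 2 t(Q) = 0 if |Q| >= 4.
   The discriminant then identifies <b> with <d>.

   A noncyclic Sylow 2-subgroup P, of order divisible by 8, of a 2-reduced group
   contains such a J. In the remaining case |P : Phi(P)| = 4 and some character x
   of P lifts to Z/4; let y be a character independent of x. The transfer to G of
   x u y has square zero because x u x = 0, so it vanishes by hypothesis; as it
   restricts to x u y on P, this product is a coboundary on P, which yields three
   independent characters of J = ker x. *)

Require Import Defs.
From HB Require Import structures.
From mathcomp Require Import all_boot all_order all_algebra.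
From mathcomp Require Import all_fingroup all_solvable all_field.
From mathcomp Require Import generic_quotient.
From mathcomp Require Import zify ring.
From mathcomp Require boolp.

Set Implicit Arguments.
Unset Strict Implicit.
Unset Printing Implicit Defensive.

Import GRing.Theory.
Local Open Scope ring_scope.

(** * Isometries of diagonal forms *)

(** Since [L] need not be a field, Q embeds in a Sylow 2-subgroup of G but may be smaller. If it is
    smaller, the number |G|/|Q| of copies is even, and for n = 0 mod 8 the sum of the copies
    vanishes: either 4 divides that number and 4 = 0 in W applies, or |Q| >= 4 and 2 t(Q) = 0
    applies. The hypothesis that G is 2-reduced enters when Q is a full noncyclic Sylow subgroup of
    order divisible by 8. The relation 4 = 0 also explains the congruences modulo 8: the summand n -
    2 and the number of copies count only modulo 4, so the form to be reached is <2>(1 + <d>) + 2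
    for n = 0 and <2>(1 + <d>) for n = 2 mod 8.

    A trace form over a fixed field is recorded as a family of vectors of E with a diagonal Gram
    matrix. Two families belonging to the same form are compared through the matrices of their
    conjugates, which are square; this replaces arguments on spans and dimensions. Skew operators
    supply the orthogonal families in the two cases where a tower of quadratic extensions does not
    suffice: nonabelian groups of order 8 and the top layer of a cyclic group of order 8. *)

Section Isometry.

Variable k : fieldType.

(* Diagonal forms are indexed by arbitrary finite types; C is the matrix of an isometry. *)
Definition isoI (I J : finType) (a : I -> k) (b : J -> k) : Prop :=
  #|I| = #|J| /\
  exists C : I -> J -> k,
    forall i i', \sum_j C i j * C i' j * b j = a i *+ (i == i').

Lemma sum_delta_l (I : finType) (f : I -> k) (i : I) :
  \sum_j f j *+ (j == i) = f i.
Proof.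
rewrite (bigD1 i) //= eqxx big1 ?addr0 // => j /negbTE ->.
by rewrite mulr0n.
Qed.

Lemma sum_delta (I : finType) (f : I -> k) (i : I) :
  \sum_j (i == j)%:R * f j = f i.
Proof.
rewrite (bigD1 i) //= eqxx mul1r big1 ?addr0 // => j /negbTE.
by rewrite eq_sym => ->; rewrite mul0r.
Qed.

Lemma isoI_bij (I J : finType) (f : I -> J) (a : I -> k) (b : J -> k) :
  bijective f -> (forall i, a i = b (f i)) -> isoI a b.
Proof.
move=> bij_f ab; split; first exact: bij_eq_card bij_f.
exists (fun i j => (f i == j)%:R) => i i'.
under eq_bigr => j _ do rewrite -mulrA.
by rewrite sum_delta (inj_eq (bij_inj bij_f)) eq_sym ab; case: eqP; rewrite ?mul1r ?mul0r.
Qed.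

Lemma isoI_refl (I : finType) (a : I -> k) : isoI a a.
Proof. by apply: (@isoI_bij I I id) => //; exists id. Qed.

Lemma isoI_trans (I J L : finType) (b : J -> k) (a : I -> k) (c : L -> k) :
  isoI a b -> isoI b c -> isoI a c.
Proof.
move=> [cIJ [C HC]] [cJL [D HD]]; split; first by rewrite cIJ.
exists (fun i l => \sum_j C i j * D j l) => i i'.
transitivity (\sum_j \sum_j' C i j * C i' j' * (b j *+ (j == j'))).
  under eq_bigr => l _ do rewrite mulr_suml mulr_suml.
  rewrite exchange_big /=; apply: eq_bigr => j _.
  under eq_bigr => l _ do rewrite mulr_sumr mulr_suml.
  rewrite exchange_big /=; apply: eq_bigr => j' _.
  rewrite -HD mulr_sumr; apply: eq_bigr => l _; ring.
rewrite -HC; apply: eq_bigr => j _.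
rewrite -[RHS](sum_delta_l (fun j' => C i j * C i' j' * b j)).
by apply: eq_bigr => j' _; rewrite [j == _]eq_sym mulrnAr.
Qed.

(** A one-sided inverse of a square matrix is two-sided; the two index types have equal cardinality
    and are transported to ordinals by [enum_val]. *)
Lemma mul_funs1C (I J : finType) (A : I -> J -> k) (B : J -> I -> k) :
  #|I| = #|J| ->
  (forall i i', \sum_j A i j * B j i' = (i == i')%:R) ->
  forall j j', \sum_i B j i * A i j' = (j == j')%:R.
Proof.
move=> cIJ AB.
pose M := \matrix_(i < #|I|, j < #|J|) A (enum_val i) (enum_val j).
pose N := \matrix_(j < #|J|, i < #|I|) B (enum_val j) (enum_val i).
have MN : M *m N = 1%:M.
  apply/matrixP=> i i'; rewrite !mxE -[in RHS](inj_eq enum_val_inj) -AB.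
  rewrite [RHS](reindex (enum_val (A := J))) /=; last exact: onW_bij (@enum_val_bij J).
  by apply: eq_bigr => j _; rewrite !mxE.
have NM : N *m M = 1%:M.
  move: M N MN {AB}; rewrite -cIJ => M N; exact: mulmx1C.
move=> j j'; rewrite -[j]enum_rankK -[j']enum_rankK.
have := congr1 (fun X : 'M_#|J| => X (enum_rank j) (enum_rank j')) NM.
rewrite !mxE (inj_eq enum_rank_inj) (inj_eq enum_val_inj) (inj_eq enum_rank_inj) => <-.
rewrite (reindex (enum_val (A := I))) /=; last exact: onW_bij (@enum_val_bij I).
by apply: eq_bigr => i _; rewrite !mxE.
Qed.

(** The relation C b C^T = a with a invertible exhibits the adjoint [b j * C i j / a i] as a right
    inverse of [C], hence as a two-sided one, and this adjoint is the inverse isometry. *)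
Lemma isoI_sym (I J : finType) (a : I -> k) (b : J -> k) :
  (forall i, a i != 0) -> isoI a b -> isoI b a.
Proof.
move=> a0 [cIJ [C HC]]; split=> //.
have key : forall j j', \sum_i b j * C i j / a i * C i j' = (j == j')%:R.
  apply: (@mul_funs1C _ _ C (fun j i => b j * C i j / a i) cIJ) => i i'.
  rewrite (eq_bigr (fun j => C i j * C i' j * b j / a i')) => [|j _]; last by ring.
  rewrite -mulr_suml HC; case: eqP => [->|_]; last by rewrite mulr0n mul0r.
  by rewrite mulr1n mulfV ?a0.
exists (fun j i => b j * C i j / a i) => j j'.
rewrite (eq_bigr (fun i => (b j * C i j / a i * C i j') * b j')) => [|i _].
  by rewrite -mulr_suml key; case: eqP => [->|_]; rewrite ?mul1r ?mul0r.
by field; exact: a0.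
Qed.

Lemma isoI_scale (I J : finType) (x : k) (a : I -> k) (b : J -> k) :
  isoI a b -> isoI (fun i => x * a i) (fun j => x * b j).
Proof.
move=> [cIJ [C HC]]; split=> //; exists C => i i'.
rewrite -mulrnAr -HC mulr_sumr; apply: eq_bigr => j _; ring.
Qed.

Definition sumf (I J : finType) (a : I -> k) (b : J -> k) (s : I + J) : k :=
  match s with inl i => a i | inr j => b j end.

Lemma isoI_sum (I J I' J' : finType) (a : I -> k) (b : J -> k)
    (a' : I' -> k) (b' : J' -> k) :
  isoI a b -> isoI a' b' -> isoI (sumf a a') (sumf b b').
Proof.
move=> [cIJ [C HC]] [cIJ' [C' HC']]; split; first by rewrite !card_sum cIJ cIJ'.
exists (fun s t => match s, t with inl i, inl j => C i j
                  | inr i, inr j => C' i j | _, _ => 0 end).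
move=> [i|i] [i'|i'] /=; rewrite big_sumType /=.
- by rewrite [X in _ + X]big1 ?addr0 ?HC // => j _; rewrite !mul0r.
- by rewrite !big1 ?addr0 // => j _; rewrite ?mulr0 ?mul0r.
- by rewrite !big1 ?addr0 // => j _; rewrite ?mulr0 ?mul0r.
- by rewrite [X in X + _]big1 ?add0r ?HC' // => j _; rewrite !mul0r.
Qed.

Definition optf (J : finType) (x : k) (b : J -> k) (s : option J) : k :=
  if s is Some j then b j else x.

Section Cancellation.

Variables (J : finType) (b : J -> k).

Let bil (u v : J -> k) := \sum_j u j * v j * b j.

Let bilC u v : bil u v = bil v u.
Proof. by apply: eq_bigr => j _; rewrite [u j * _]mulrC. Qed.

Let lin (u : J -> k) c (v : J -> k) := fun j => u j + c * v j.

Let bil_lin u c v u' c' v' :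
  bil (lin u c v) (lin u' c' v') =
  bil u u' + c * bil v u' + c' * bil u v' + c * c' * bil v v'.
Proof.
rewrite /bil !mulr_sumr -!big_split /=; apply: eq_bigr => j _; rewrite /lin; ring.
Qed.

Let bil_linl u c v w : bil (lin u c v) w = bil u w + c * bil v w.
Proof.
rewrite /bil !mulr_sumr -!big_split /=; apply: eq_bigr => j _; rewrite /lin; ring.
Qed.

(** The norms of u - v and u + v add up to four times that of v, so one of these vectors is
    anisotropic. The reflection in u - v sends u to v; the reflection in u + v sends u to -v and is
    composed with -1. *)
Lemma reflection_exists (u v : J -> k) :
  2%:R != 0 :> k -> bil u u = bil v v -> bil v v != 0 ->
  exists s : (J -> k) -> (J -> k),
    (forall y z, bil (s y) (s z) = bil y z) /\ s u =1 v.
Proof.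
move=> two0 uv v0.
have refl r : bil r r != 0 -> forall y z,
    bil (lin y (- (2%:R * bil y r / bil r r)) r)
        (lin z (- (2%:R * bil z r / bil r r)) r) = bil y z.
  by move=> r0 y z; rewrite bil_lin [bil r z]bilC; field.
pose d := lin u (-1) v; pose e := lin u 1 v.
have dd : bil d d = bil u u + bil v v - 2%:R * bil u v.
  by rewrite bil_lin [bil v u]bilC; ring.
have ee : bil e e = bil u u + bil v v + 2%:R * bil u v.
  by rewrite bil_lin [bil v u]bilC; ring.
have [d0|d0] := eqVneq (bil d d) 0.
  have e4 : bil e e = 2%:R * (2%:R * bil v v).
    by apply/eqP; rewrite -subr_eq0 -oppr_eq0 -d0 dd ee uv; apply/eqP; ring.
  have e0 : bil e e != 0 by rewrite e4 !mulf_neq0.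
  exists (fun y j => - lin y (- (2%:R * bil y e / bil e e)) e j); split.
    move=> y z; rewrite -(refl e e0 y z); apply: eq_bigr => j _; ring.
  move=> j; have -> : 2%:R * bil u e = bil e e.
    by rewrite bilC bil_linl ee uv [bil v u]bilC; ring.
  by rewrite mulfV // /lin /e /lin; ring.
exists (fun y => lin y (- (2%:R * bil y d / bil d d)) d); split.
  exact: refl.
move=> j; have -> : 2%:R * bil u d = bil d d.
  by rewrite bilC bil_linl dd uv [bil v u]bilC; ring.
by rewrite mulfV // /lin /d /lin; ring.
Qed.

End Cancellation.

(** Witt cancellation. An isometry of the target moves the image of the vector of norm [x] onto the
    coordinate vector [None]; the images of the other basis vectors are orthogonal to it, so their
    [None] coordinate vanishes. *)
Lemma isoI_cancel (I J : finType) (x : k) (a : I -> k) (b : J -> k) :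
  2%:R != 0 :> k -> x != 0 -> isoI (optf x a) (optf x b) -> isoI a b.
Proof.
move=> two0 x0 [cIJ [C HC]].
split; first by move: cIJ; rewrite !card_option => -[].
pose v (j : option J) : k := (None == j)%:R.
have qv y : \sum_j y j * v j * optf x b j = y None * x.
  rewrite (bigD1 None) //= big1 ?addr0 /v ?mulr1 // => j.
  by rewrite eq_sym => /negbTE ->; rewrite mulr0 mul0r.
have [s [sP su]] : exists s : (option J -> k) -> (option J -> k),
    (forall y z, \sum_j (s y) j * (s z) j * optf x b j
                 = \sum_j y j * z j * optf x b j) /\ s (C None) =1 v.
  apply: reflection_exists => //; rewrite ?HC qv /v eqxx mul1r //.
exists (fun i j => s (C (Some i)) (Some j)) => i i'.
have s0 h : s (C (Some h)) None = 0.
  have := sP (C (Some h)) (C None); rewrite HC mulr0n.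
  rewrite (eq_bigr (fun j => s (C (Some h)) j * v j * optf x b j)) => [|j _].
    by rewrite qv => /eqP; rewrite mulf_eq0 (negbTE x0) orbF => /eqP.
  by rewrite su.
have := sP (C (Some i)) (C (Some i')); rewrite HC /= => <-.
rewrite [RHS](bigD1 None) //= s0 !mul0r add0r.
rewrite (reindex_omap Some id) /= => [|[]//].
by apply: eq_bigl => j; rewrite eqxx.
Qed.

End Isometry.

(** * The Witt ring *)

Section Witt.

Variable k : fieldType.
Implicit Types (a b c h : seq k).

Definition isoS a b : Prop :=
  isoI (fun i : 'I_(size a) => a`_i) (fun j : 'I_(size b) => b`_j).

Lemma isoI_enum (I : finType) (a : I -> k) :
  isoI a (fun j : 'I_(size [seq a i | i <- enum I]) => [seq a i | i <- enum I]`_j).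
Proof.
have e : #|I| = size [seq a i | i <- enum I] by rewrite size_map -cardE.
apply: (@isoI_bij _ _ _ (fun i => cast_ord e (enum_rank i))).
  apply: inj_card_bij; last by rewrite card_ord -e.
  by move=> i j /cast_ord_inj /enum_rank_inj.
move=> i /=; rewrite (nth_map i) ?nth_enum_rank //.
by rewrite -cardE ltn_ord.
Qed.

Lemma isoS_cat a b c h : isoS a b -> isoS c h -> isoS (a ++ c) (b ++ h).
Proof.
have key (s t : seq k) :
    isoI (fun i : 'I_(size (s ++ t)) => (s ++ t)`_i)
         (sumf (fun i : 'I_(size s) => s`_i) (fun j : 'I_(size t) => t`_j)).
  apply: (@isoI_bij _ _ _ (fun i => split (cast_ord (size_cat s t) i))).
    apply: inj_card_bij; last by rewrite card_sum !card_ord size_cat.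
    by move=> i j /(can_inj (@splitK _ _)) /cast_ord_inj.
  by move=> i; rewrite nth_cat; case: splitP => j /= ->; rewrite ?ltn_ord // ltnNge leq_addr addKn.
have key' (s t : seq k) :
    isoI (sumf (fun i : 'I_(size s) => s`_i) (fun j : 'I_(size t) => t`_j))
         (fun i : 'I_(size (s ++ t)) => (s ++ t)`_i).
  apply: (@isoI_bij _ _ _ (fun i => cast_ord (esym (size_cat s t)) (unsplit i))).
    apply: inj_card_bij; last by rewrite card_sum !card_ord size_cat.
    by move=> i j /cast_ord_inj /(can_inj (@unsplitK _ _)).
  by move=> [i|i] /=; rewrite nth_cat ?ltn_ord // ltnNge leq_addr addKn.
move=> ab ch; apply: isoI_trans (key a c) _; apply: isoI_trans (key' b h).
exact: isoI_sum.
Qed.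

Lemma isoS_perm a b : perm_eq a b -> isoS a b.
Proof.
move=> ab; have sab := perm_size ab.
have /(perm_iotaP 0)[s ps def_a] := ab.
have szs : size s = size b by rewrite (perm_size ps) size_iota.
have lts (i : 'I_(size a)) : (nth 0%N s i < size b)%N.
  have : nth 0%N s i \in iota 0 (size b) by rewrite -(perm_mem ps) mem_nth // szs -sab.
  by rewrite mem_iota.
apply: (@isoI_bij _ _ _ (fun i => Ordinal (lts i))).
  apply: inj_card_bij; last by rewrite !card_ord sab.
  move=> i j /(congr1 val) /= /eqP; rewrite nth_uniq ?szs -?sab // => [/eqP/val_inj //|].
  by rewrite (perm_uniq ps) iota_uniq.
by move=> i; rewrite {1}def_a (nth_map 0%N) ?szs -?sab.
Qed.

(** Zero entries are discarded rather than excluded, so that every sequence has a Witt class and the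
    ring operations carry no side conditions. *)
Definition nz a := [seq x <- a | x != 0].
Definition isoZ a b : Prop := isoS (nz a) (nz b).

Lemma nz_neq0 a (i : 'I_(size (nz a))) : (nz a)`_i != 0.
Proof. by have := mem_nth 0 (ltn_ord i); rewrite mem_filter => /andP[]. Qed.

Lemma isoZ_perm a b : perm_eq a b -> isoZ a b.
Proof. by move=> ab; apply: isoS_perm; apply: perm_filter. Qed.

Lemma isoZ_sym a b : isoZ a b -> isoZ b a.
Proof. by apply: isoI_sym; apply: nz_neq0. Qed.

Lemma isoZ_trans b a c : isoZ a b -> isoZ b c -> isoZ a c.
Proof. exact: isoI_trans. Qed.

Lemma isoZ_cat a b c h : isoZ a b -> isoZ c h -> isoZ (a ++ c) (b ++ h).
Proof. by rewrite /isoZ /nz !filter_cat; apply: isoS_cat. Qed.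

Lemma isoZ_scale x a b : isoZ a b -> isoZ [seq x * y | y <- a] [seq x * y | y <- b].
Proof.
have [->|x0] := eqVneq x 0.
  move=> _; have z c : nz [seq 0 * y | y <- c] = [::].
    by elim: c => //= y c; rewrite mul0r eqxx.
  by rewrite /isoZ !z; apply: isoI_refl.
have nzs c : nz [seq x * y | y <- c] = [seq x * y | y <- nz c].
  by rewrite /nz filter_map; congr map; apply: eq_filter => y /=; rewrite mulf_eq0 (negbTE x0).
have sc c : isoI (fun i : 'I_(size c) => x * c`_i)
    (fun i : 'I_(size [seq x * y | y <- c]) => [seq x * y | y <- c]`_i).
  have e : size c = size [seq x * y | y <- c] by rewrite size_map.
  apply: (@isoI_bij _ _ _ (cast_ord e)).
    by apply: inj_card_bij (@cast_ord_inj _ _ e) _; rewrite !card_ord e.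
  by move=> i /=; rewrite (nth_map 0) ?ltn_ord.
rewrite /isoZ !nzs => ab; apply: isoI_trans _ (sc _).
apply: isoI_trans (isoI_scale x ab); apply: isoI_sym (sc _).
by move=> i; rewrite mulf_neq0 ?nz_neq0.
Qed.

Definition dbl h := h ++ [seq - x | x <- h].

(* [dbl h] is hyperbolic and zero entries are discarded, so this is Witt equivalence. *)
Definition weq a b : Prop := exists h h', isoZ (a ++ dbl h) (b ++ dbl h').

Lemma weq_iso a b : isoZ a b -> weq a b.
Proof. by exists [::], [::]; rewrite /dbl /= !cats0. Qed.

Lemma weq_perm a b : perm_eq a b -> weq a b.
Proof. by move=> ab; apply/weq_iso/isoZ_perm. Qed.

Lemma weq_refl a : weq a a.
Proof. exact: weq_perm. Qed.

Lemma weq_sym a b : weq a b -> weq b a.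
Proof. by move=> [h [h' /isoZ_sym]]; exists h', h. Qed.

Lemma weq_trans b a c : weq a b -> weq b c -> weq a c.
Proof.
move=> [h [h' ab]] [g [g' bc]]; exists (h ++ g), (h' ++ g').
apply: (@isoZ_trans ((a ++ dbl h) ++ dbl g)).
  by apply: isoZ_perm; apply/seq.permP => p; rewrite /dbl map_cat !count_cat; lia.
apply: (@isoZ_trans ((b ++ dbl h') ++ dbl g)).
  by apply: isoZ_cat => //; apply: isoZ_perm.
apply: (@isoZ_trans ((b ++ dbl g) ++ dbl h')).
  by apply: isoZ_perm; apply/seq.permP => p; rewrite !count_cat; lia.
apply: (@isoZ_trans ((c ++ dbl g') ++ dbl h')).
  by apply: isoZ_cat => //; apply: isoZ_perm.
by apply: isoZ_perm; apply/seq.permP => p; rewrite /dbl map_cat !count_cat; lia.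
Qed.

Lemma weq_cat a b c h : weq a b -> weq c h -> weq (a ++ c) (b ++ h).
Proof.
move=> [g [g' ab]] [f [f' ch]]; exists (g ++ f), (g' ++ f').
apply: (@isoZ_trans ((a ++ dbl g) ++ (c ++ dbl f))).
  by apply: isoZ_perm; apply/seq.permP => p; rewrite /dbl map_cat !count_cat; lia.
apply: (@isoZ_trans ((b ++ dbl g') ++ (h ++ dbl f'))); first exact: isoZ_cat.
by apply: isoZ_perm; apply/seq.permP => p; rewrite /dbl map_cat !count_cat; lia.
Qed.

Lemma dbl_scale x h : [seq x * y | y <- dbl h] = dbl [seq x * y | y <- h].
Proof.
rewrite /dbl map_cat -!map_comp; congr (_ ++ _).
by apply: eq_map => y /=; rewrite mulrN.
Qed.

Lemma weq_scale x a b : weq a b -> weq [seq x * y | y <- a] [seq x * y | y <- b].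
Proof.
move=> [h [h' ab]]; exists [seq x * y | y <- h], [seq x * y | y <- h'].
by rewrite -!dbl_scale -!map_cat; apply: isoZ_scale.
Qed.

Definition prods a b := [seq x * y | x <- a, y <- b].

Lemma prods_cons x a b : prods (x :: a) b = [seq x * y | y <- b] ++ prods a b.
Proof. by []. Qed.

Lemma prods_consr y a b :
  perm_eq (prods a (y :: b)) ([seq y * x | x <- a] ++ prods a b).
Proof.
elim: a => //= x a IH; rewrite !prods_cons /= [x * y]mulrC perm_cons.
apply: (@perm_trans _ ([seq x * z | z <- b] ++ [seq y * x | x <- a] ++ prods a b)).
  by rewrite perm_cat2l.
by apply/seq.permP => p; rewrite ?count_cat /= ?count_cat; lia.
Qed.

Lemma prodsC a b : perm_eq (prods a b) (prods b a).
Proof.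
elim: a => [|x a IH]; first by elim: b.
rewrite prods_cons perm_sym; apply: perm_trans (prods_consr _ _ _) _.
by rewrite perm_cat2l perm_sym.
Qed.

Lemma prods_catl a b c : prods (a ++ b) c = prods a c ++ prods b c.
Proof. by elim: a => //= x a IH; rewrite !prods_cons IH catA. Qed.

Lemma prodsA a b c : prods a (prods b c) = prods (prods a b) c.
Proof.
elim: a => // x a IH; rewrite !prods_cons prods_catl IH; congr (_ ++ _).
move: b {IH}; elim=> //= y b; rewrite -/(prods b c) -/(prods (y :: b) c).
move=> IHb; rewrite !prods_cons map_cat IHb; congr (_ ++ _).
by rewrite -map_comp; apply: eq_map => z /=; rewrite mulrA.
Qed.

Lemma weq_prodsr a b c : weq b c -> weq (prods a b) (prods a c).
Proof.
move=> bc; elim: a => [|x a IH]; first exact: weq_refl.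
by rewrite !prods_cons; apply: weq_cat IH; apply: weq_scale.
Qed.

Lemma weq_prods a b c h : weq a b -> weq c h -> weq (prods a c) (prods b h).
Proof.
move=> ab ch; apply: (@weq_trans (prods a h)); first exact: weq_prodsr.
apply: (@weq_trans (prods h a)); first exact/weq_perm/prodsC.
apply: (@weq_trans (prods h b)); first exact: weq_prodsr.
exact/weq_perm/prodsC.
Qed.

(** The generic quotient asks for a boolean relation; Witt equivalence is made boolean
    classically. *)
Definition weqb a b : bool := boolp.asbool (weq a b).

Lemma weqbP a b : reflect (weq a b) (weqb a b).
Proof. exact: boolp.asboolP. Qed.

Lemma weqb_equiv : equiv_class_of weqb.
Proof.
split=> [a|a b|b a c]; first by apply/weqbP/weq_refl.
  by apply/weqbP/weqbP; apply: weq_sym.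
by move=> /weqbP ab /weqbP bc; apply/weqbP; apply: weq_trans ab bc.
Qed.

Canonical weqb_rel := EquivRelPack weqb_equiv.
Definition witt := {eq_quot weqb}%qT.
HB.instance Definition _ := Choice.on witt.

Definition wcls a : witt := (\pi_witt a)%qT.

Lemma wclsP a b : wcls a = wcls b <-> weq a b.
Proof. by split => [/eqmodP/weqbP|ab] //; apply/eqmodP/weqbP. Qed.

Lemma wclsW (P : witt -> Prop) : (forall a, P (wcls a)) -> forall x, P x.
Proof. by move=> Pa; elim/quotW => a; apply: Pa. Qed.

Definition wadd (x y : witt) := wcls (repr x ++ repr y).
Definition wopp (x : witt) := wcls [seq - y | y <- repr x].
Definition wmul (x y : witt) := wcls (prods (repr x) (repr y)).

Lemma repr_wcls a : weq (repr (wcls a)) a.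
Proof. by apply/wclsP; rewrite /wcls reprK. Qed.

Lemma wadd_cls a b : wadd (wcls a) (wcls b) = wcls (a ++ b).
Proof. by apply/wclsP; apply: weq_cat; apply: repr_wcls. Qed.

Lemma weq_opp a b : weq a b -> weq [seq - y | y <- a] [seq - y | y <- b].
Proof.
move=> /(weq_scale (-1)).
by rewrite !(eq_map (fun x => mulN1r x)).
Qed.

Lemma wopp_cls a : wopp (wcls a) = wcls [seq - y | y <- a].
Proof. by apply/wclsP/weq_opp/repr_wcls. Qed.

Lemma wmul_cls a b : wmul (wcls a) (wcls b) = wcls (prods a b).
Proof. by apply/wclsP; apply: weq_prods; apply: repr_wcls. Qed.

Lemma waddA : associative wadd.
Proof.
by elim/wclsW => a; elim/wclsW => b; elim/wclsW => c; rewrite !wadd_cls catA.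
Qed.

Lemma waddC : commutative wadd.
Proof.
elim/wclsW => a; elim/wclsW => b; rewrite !wadd_cls.
by apply/wclsP/weq_perm; rewrite perm_catC.
Qed.

Lemma wadd0 : left_id (wcls [::]) wadd.
Proof. by elim/wclsW => a; rewrite wadd_cls. Qed.

Lemma waddN : left_inverse (wcls [::]) wopp wadd.
Proof.
elim/wclsW => a; rewrite wopp_cls wadd_cls; apply/wclsP.
exists [::], a; rewrite /= cats0; apply: isoZ_perm.
by rewrite /dbl /= perm_catC.
Qed.

HB.instance Definition _ := GRing.isZmodule.Build witt waddA waddC wadd0 waddN.

Lemma wmulA : associative wmul.
Proof.
by elim/wclsW => a; elim/wclsW => b; elim/wclsW => c; rewrite !wmul_cls prodsA.
Qed.

Lemma wmulC : commutative wmul.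
Proof.
elim/wclsW => a; elim/wclsW => b; rewrite !wmul_cls.
exact/wclsP/weq_perm/prodsC.
Qed.

Lemma wmul1 : left_id (wcls [:: 1]) wmul.
Proof.
elim/wclsW => a; rewrite wmul_cls /prods /= cats0.
by rewrite (eq_map (fun x => mul1r x)) map_id.
Qed.

Lemma wmulD : left_distributive wmul wadd.
Proof.
elim/wclsW => a; elim/wclsW => b; elim/wclsW => c.
by rewrite !(wmul_cls, wadd_cls) prods_catl.
Qed.

(** The rank modulo 2 is an invariant of the Witt class; it separates 1 from 0, as the nontrivial
    ring structure on [witt] requires. *)
Lemma weq_size a b : weq a b -> odd (size (nz a)) = odd (size (nz b)).
Proof.
move=> [h [h' [+ _]]]; rewrite !card_ord /nz !filter_cat !size_cat -!/(nz _).
have e c : size (nz [seq - x | x <- c]) = size (nz c).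
  rewrite /nz.
  by rewrite filter_map size_map; congr size; apply: eq_filter => x /=; rewrite oppr_eq0.
rewrite !e => /(congr1 odd); rewrite !oddD !addbb !addbF; exact.
Qed.

Lemma w1_neq0 : wcls [:: 1] != wcls [::].
Proof. by apply/eqP => /wclsP/weq_size /=; rewrite oner_eq0. Qed.

HB.instance Definition _ :=
  GRing.Zmodule_isComNzRing.Build witt wmulA wmulC wmul1 wmulD w1_neq0.

(* The class of <x>, with the junk value w 0 = 0. *)
Definition w (x : k) : witt := wcls [:: x].

Lemma wclsE a : wcls a = \sum_(x <- a) w x.
Proof.
elim: a => [|x a IH]; first by rewrite big_nil.
by rewrite big_cons -IH -[x :: a]cat1s -wadd_cls.
Qed.

Lemma w1 : w 1 = 1. Proof. by []. Qed.

Lemma wM x y : w (x * y) = w x * w y.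
Proof. by rewrite [RHS]wmul_cls. Qed.

Lemma wN x : w (- x) = - w x.
Proof. by rewrite [RHS]wopp_cls. Qed.

Lemma sum_wE (I : finType) (a : I -> k) :
  \sum_i w (a i) = wcls [seq a i | i <- enum I].
Proof. by rewrite wclsE big_map big_enum. Qed.

Lemma nz_enum (I : finType) (a : I -> k) :
  (forall i, a i != 0) -> nz [seq a i | i <- enum I] = [seq a i | i <- enum I].
Proof. by move=> a0; apply/all_filterP/allP => x /mapP[i _ ->]. Qed.

Lemma iso_sum_w (I J : finType) (a : I -> k) (b : J -> k) :
  (forall i, a i != 0) -> (forall j, b j != 0) -> isoI a b ->
  \sum_i w (a i) = \sum_j w (b j).
Proof.
move=> a0 b0 ab; rewrite !sum_wE; apply/wclsP/weq_iso.
rewrite /isoZ !nz_enum //.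
apply: isoI_trans (isoI_enum b); apply: isoI_trans _ ab.
exact/isoI_sym/isoI_enum.
Qed.

Lemma w0 : w 0 = 0.
Proof. by apply/wclsP/weq_iso; rewrite /isoZ /nz /= eqxx; apply: isoI_refl. Qed.

Lemma w_sqr (c x : k) : c != 0 -> w (c ^+ 2 * x) = w x.
Proof.
move=> c0; have [->|x0] := eqVneq x 0; first by rewrite mulr0.
have := @iso_sum_w unit unit (fun=> c ^+ 2 * x) (fun=> x).
rewrite !big_const !card_unit /= !addr0; apply=> // [_|].
  by rewrite mulf_neq0 ?expf_neq0.
split=> //; exists (fun _ _ => c) => -[] [].
by rewrite big_const card_unit /= addr0 mulr1n expr2.
Qed.

(** The isometry between <x, y> and <x + y, (x + y) x y>. The convention [w 0 = 0] makes the
    identity unconditional: if x + y = 0, both sides are zero. *)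
Lemma w_add x y : w x + w y = w (x + y) * (1 + w (x * y)).
Proof.
have [->|x0] := eqVneq x 0; first by rewrite mul0r w0 !add0r addr0 mulr1.
have [->|y0] := eqVneq y 0; first by rewrite mulr0 w0 !addr0 mulr1.
have [xy|xy0] := eqVneq (x + y) 0.
  by rewrite xy w0 mul0r; move/eqP: xy; rewrite addr_eq0 => /eqP ->; rewrite wN addNr.
pose a (i : bool) := if i then x else y; pose a' (i : bool) := if i then x + y else (x + y) * (x * y).
have -> : w x + w y = \sum_i w (a i) by rewrite big_bool.
have -> : w (x + y) * (1 + w (x * y)) = \sum_i w (a' i).
  by rewrite big_bool /a' [w (_ * (x * y))]wM mulrDr mulr1.
apply/esym/iso_sum_w.
- by case; rewrite ?mulf_neq0.
- by case.
split=> //; exists (fun i j => if i then 1 else if j then y else - x).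
by move=> [] []; rewrite big_bool /=; ring.
Qed.

Lemma isoS_opt x a :
  isoI (fun i : 'I_(size (x :: a)) => (x :: a)`_i)
       (optf x (fun j : 'I_(size a) => a`_j)).
Proof.
apply: (@isoI_bij _ _ _ (fun i : 'I_(size a).+1 => unlift ord0 i)).
  apply: inj_card_bij; last by rewrite card_option !card_ord.
  by move=> i j; case: unliftP => [i'|] ->; case: unliftP => [j'|] -> // [->].
by move=> i; case: unliftP => [i'|] ->.
Qed.

Lemma isoS_cancel x a b : 2%:R != 0 :> k -> x != 0 -> all (fun y => y != 0) b ->
  isoS (x :: b) (x :: a) -> isoS b a.
Proof.
move=> two0 x0 b0 xab; apply: (isoI_cancel two0 x0).
apply: isoI_trans (isoS_opt x a); apply: isoI_trans _ xab.
apply: isoI_sym (isoS_opt x b).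
move=> i; have : (x :: b)`_i \in x :: b by rewrite mem_nth ?ltn_ord.
by rewrite in_cons => /orP[/eqP->|/(allP b0)].
Qed.

Lemma isoS_cancel_cat h a b : 2%:R != 0 :> k -> all (fun y => y != 0) (h ++ b) ->
  isoS (h ++ b) (h ++ a) -> isoS b a.
Proof.
move=> two0; elim: h => //= x h IH /andP[x0 hb] /(isoS_cancel two0 x0 hb).
exact: IH.
Qed.

(** The matrix comes from x = ((1 + x)/2)^2 - ((1 - x)/2)^2. *)
Lemma hyperbolic_plane x : 2%:R != 0 :> k -> x != 0 -> isoS [:: x; - x] [:: 1; - 1].
Proof.
move=> two0 x0; split; first by rewrite !card_ord.
exists (fun i j : 'I_2 => if i == j then (1 + x) / 2%:R else (1 - x) / 2%:R).
by move=> [[|[|//]] hi] [[|[|//]] hj]; rewrite !big_ord_recl big_ord0 /=; field.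
Qed.

Lemma nz_id a : all (fun x => x != 0) a -> nz a = a.
Proof. by move=> /all_filterP. Qed.

Lemma dbl_hyperbolic h : 2%:R != 0 :> k ->
  isoZ (dbl h) (dbl (nseq (size (nz h)) 1)).
Proof.
move=> two0; elim: h => [|x h IH]; first exact: isoI_refl.
apply: (@isoZ_trans ([:: x; - x] ++ dbl h)).
  by apply: isoZ_perm; apply/seq.permP => p; rewrite /dbl /= !count_cat /=; lia.
rewrite /=; have [->|x0] := eqVneq x 0.
  by rewrite /isoZ /= oppr0 eqxx.
apply: (@isoZ_trans ([:: 1; - 1] ++ dbl (nseq (size (nz h)) 1))).
  apply: (@isoZ_cat [:: x; - x] [:: 1; - 1]) IH.
  by rewrite /isoZ /nz /= x0 !oppr_eq0 x0 oner_eq0; apply: hyperbolic_plane.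
apply: isoZ_perm; apply/seq.permP => p; rewrite /dbl /= !count_cat /=.
by congr (_ + _)%N; rewrite addnCA.
Qed.

Lemma size_nz_dbl h : size (nz (dbl h)) = (2 * size (nz h))%N.
Proof.
rewrite /nz filter_cat size_cat filter_map size_map mul2n -addnn; congr (_ + size _)%N.
by apply: eq_filter => x /=; rewrite oppr_eq0.
Qed.

Lemma isoZ_size a b : isoZ a b -> size (nz a) = size (nz b).
Proof. by case; rewrite !card_ord. Qed.

(** Both hyperbolic summands become sums of copies of <1, -1>, equal in number because the ranks
    agree, and Witt cancellation removes them. *)
Theorem weq_isoS a b : 2%:R != 0 :> k ->
  all (fun x => x != 0) a -> all (fun x => x != 0) b -> size a = size b ->
  weq a b -> isoS a b.
Proof.
move=> two0 a0 b0 sab [h [h' hh]].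
have e : size (nz h) = size (nz h').
  have nz_cat c d : size (nz (c ++ d)) = (size (nz c) + size (nz d))%N.
    by rewrite /nz filter_cat size_cat.
  have := isoZ_size hh; rewrite (nz_cat a) (nz_cat b) !size_nz_dbl (nz_id a0) (nz_id b0) sab => /addnI/eqP.
  by rewrite eqn_pmul2l => // /eqP.
pose u := dbl (nseq (size (nz h)) (1 : k)).
have u0 : all (fun x => x != 0) u.
  by rewrite all_cat all_map !all_nseq /= oppr_eq0 oner_eq0 !orbT.
have : isoZ (u ++ a) (u ++ b).
  apply: (@isoZ_trans (a ++ dbl h)).
    apply: (@isoZ_trans (a ++ u)); first by apply: isoZ_perm; rewrite perm_catC.
    by apply: isoZ_cat; [apply: isoZ_perm | apply/isoZ_sym/dbl_hyperbolic].
  apply: (isoZ_trans hh); apply: (@isoZ_trans (b ++ u)).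
    by apply: isoZ_cat; [apply: isoZ_perm | rewrite /u e; apply: dbl_hyperbolic].
  by apply: isoZ_perm; rewrite perm_catC.
have ea : nz (u ++ a) = u ++ a by apply: nz_id; rewrite all_cat u0.
have eb : nz (u ++ b) = u ++ b by apply: nz_id; rewrite all_cat u0.
rewrite /isoZ ea eb.
by apply: isoS_cancel_cat => //; rewrite all_cat u0.
Qed.

Theorem sum_w_iso (I J : finType) (a : I -> k) (b : J -> k) : 2%:R != 0 :> k ->
  (forall i, a i != 0) -> (forall j, b j != 0) -> #|I| = #|J| ->
  \sum_i w (a i) = \sum_j w (b j) -> isoI a b.
Proof.
move=> two0 a0 b0 cIJ; rewrite !sum_wE => /wclsP.
have n0 (L : finType) (c : L -> k) : (forall i, c i != 0) ->
    all (fun x => x != 0) [seq c i | i <- enum L].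
  by move=> c0; apply/allP => x /mapP[i _ ->].
move=> /(weq_isoS two0 (n0 _ _ a0) (n0 _ _ b0)) ab.
have e : size [seq a i | i <- enum I] = size [seq b j | j <- enum J].
  by rewrite (size_map a) (size_map b) -!cardE.
apply: (isoI_trans (isoI_enum a)); apply: (isoI_trans (ab e)).
exact: isoI_sym (isoI_enum b).
Qed.

End Witt.

(** * Fields over which quadratic forms of rank at least five are isotropic *)

Section GoodField.

Variable k : fieldType.
Local Notation w := (@w k).

Definition five_isotropic : Prop :=
  forall a : 'I_5 -> k, exists2 z : 'I_5 -> k,
    (exists i, z i != 0) & \sum_i a i * z i ^+ 2 = 0.

(** Isotropy of <1, 1, 1>: if [r] vanishes, -1 is a square, and otherwise it is a sum of two
    squares. *)
Definition minus_one_two_squares : Prop :=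
  exists p q r : k, [|| p != 0, q != 0 | r != 0] /\ p ^+ 2 + q ^+ 2 + r ^+ 2 = 0.

Lemma w_sq (c : k) : c != 0 -> w (c ^+ 2) = 1.
Proof. by move=> c0; rewrite -[c ^+ 2]mulr1 w_sqr ?w1. Qed.

Lemma wMM (x : k) : x != 0 -> w x * w x = 1.
Proof. by move=> x0; rewrite -wM -expr2 w_sq. Qed.

Lemma w_sqr_eq (x y c : k) : c != 0 -> x = c ^+ 2 * y -> w x = w y.
Proof. by move=> c0 ->; rewrite w_sqr. Qed.

(* The one-fold Pfister form <1, -x> is round. *)
Lemma w_norm (x p q : k) : x != 0 -> p ^+ 2 - x * q ^+ 2 != 0 ->
  (1 - w x) * w (p ^+ 2 - x * q ^+ 2) = 1 - w x.
Proof.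
move=> x0 A0; have [p0|p0] := eqVneq p 0.
  have q0 : q != 0.
    by apply: contraNneq A0 => ->; rewrite p0 !expr0n mulr0 subr0.
  have -> : p ^+ 2 - x * q ^+ 2 = q ^+ 2 * - x by rewrite p0; ring.
  rewrite w_sqr // wN; have := wMM x0 => e. ring: e.
have [q0|q0] := eqVneq q 0.
  by rewrite q0 expr0n mulr0 subr0 w_sq ?mulr1.
have := w_add (p ^+ 2) (- (x * q ^+ 2)).
have -> : - (x * q ^+ 2) = q ^+ 2 * - x by ring.
have -> : p ^+ 2 * (q ^+ 2 * - x) = (p * q) ^+ 2 * - x by ring.
rewrite !w_sqr ?mulf_neq0 // w_sq // !wN => e; rewrite [RHS]e.
by rewrite mulrC; congr (w _ * _); ring.
Qed.

Lemma w_norm0 (x p q : k) : x != 0 -> (p != 0) || (q != 0) ->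
  p ^+ 2 - x * q ^+ 2 = 0 -> w x = 1.
Proof.
move=> x0 pq A0; have q0 : q != 0.
  apply: contraTneq pq => q0; move/eqP: A0.
  by rewrite q0 expr0n mulr0 subr0 expf_eq0 /= => ->; rewrite eqxx.
have p0 : p != 0.
  apply: contra_eq_neq A0 => ->.
  by rewrite expr0n sub0r oppr_eq0 mulf_neq0 ?expf_neq0.
rewrite (@w_sqr_eq x 1 (p / q)) ?w1 ?mulf_neq0 ?invr_neq0 //.
by rewrite -[x](@mulfK _ (q ^+ 2)) ?expf_neq0 // -(subr0_eq A0) mulr1 expr_div_n.
Qed.

(* The two-fold Pfister form <1, -x, -y, xy>. *)
Definition pf (x y : k) := (1 - w x) * (1 - w y).

Hypothesis k5 : five_isotropic.

(** The sum of the Pfister form and <-z> has rank five, hence is isotropic. A nontrivial zero gives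
    A - y B = t^2 z with A and B values of <1, -x>, and the roundness of <1, -x> absorbs [w A] and
    [w B]. If t = 0, the Pfister form itself is isotropic and its class is zero. *)
Lemma pf_univ (x y z : k) : x != 0 -> y != 0 -> z != 0 ->
  pf x y * w z = pf x y.
Proof.
(* If [w x = 1], both sides vanish. Otherwise <1, -x> is anisotropic, which is [ext]: A and B vanish
   only at the origin. *)
move=> x0 y0 z0; have [e|D0] := eqVneq (w x) 1; first by rewrite /pf e subrr !mul0r.
have yy := wMM y0.
have ext (p q : k) : p ^+ 2 - x * q ^+ 2 = 0 -> p = 0 /\ q = 0.
  move=> A0; have [//|pq] := boolP ((p == 0) && (q == 0)).
    by move=> /andP[/eqP-> /eqP->].
  by rewrite negb_and in pq; rewrite (w_norm0 x0 pq A0) eqxx in D0.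
have [f [i fi]] := k5 (fun i : 'I_5 =>
  match val i with 0 => 1 | 1 => - x | 2 => - y | 3 => x * y | _ => - z end).
rewrite !big_ord_recl big_ord0 /= addr0.
set p := f _; set q := f _; set r := f _; set s := f _; set t := f _ => eq0.
pose A := p ^+ 2 - x * q ^+ 2; pose B := r ^+ 2 - x * s ^+ 2.
have AB : A - y * B = t ^+ 2 * z.
  by apply/eqP; rewrite -subr_eq0 -eq0 /A /B; apply/eqP; ring.
have Aw : A != 0 -> w x * w A = w A - 1 + w x.
  by move=> A0; rewrite -addrA [-1 + _]addrC -opprB -(w_norm x0 A0) -/A; ring.
have Bw : B != 0 -> w x * w B = w B - 1 + w x.
  by move=> B0; rewrite -addrA [-1 + _]addrC -opprB -(w_norm x0 B0) -/B; ring.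
have all0 : ~ [/\ A = 0, B = 0 & t = 0].
  move=> [/ext[p0 q0] /ext[r0 s0] t0]; case/eqP: fi; rewrite -/(f i).
  have f0 (j : 'I_5) : f j = 0.
    case: j => [[|[|[|[|[|//]]]]] hj].
    - by rewrite -p0; congr f; apply: val_inj.
    - by rewrite -q0; congr f; apply: val_inj.
    - by rewrite -r0; congr f; apply: val_inj.
    - by rewrite -s0; congr f; apply: val_inj.
    - by rewrite -t0; congr f; apply: val_inj.
  exact: f0.
rewrite /pf; have [t0|t0] := eqVneq t 0.
  rewrite t0 expr0n mul0r in AB; have {}AB := subr0_eq AB.
  have [A0|A0] := eqVneq A 0.
    case: all0; split=> //; move/eqP: AB; rewrite A0 eq_sym mulf_eq0.
    by rewrite (negbTE y0) => /eqP.
  have B0 : B != 0 by apply: contraNneq A0 => B0; rewrite AB B0 mulr0.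
  have : (1 - w x) * (1 - w y) = 0.
    have e1 : (1 - w x) * w A = 1 - w x := w_norm x0 A0.
    have e2 : (1 - w x) * w B = 1 - w x := w_norm x0 B0.
    by rewrite AB wM in e1; rewrite mulrBr mulr1 -{2}e2 -mulrA [w B * _]mulrC e1 subrr.
  by move=> ->; rewrite mul0r.
have <- : w (A - y * B) = w z by rewrite AB w_sqr.
have [A0|A0] := eqVneq A 0.
  have [B0|B0] := eqVneq B 0.
    by move/eqP: AB; rewrite A0 B0 mulr0 subr0 eq_sym mulf_eq0 expf_eq0 /= (negbTE t0) (negbTE z0).
  have e2 := Bw B0; rewrite A0 sub0r wN wM.
  ring: yy e2.
have [B0|B0] := eqVneq B 0.
  by rewrite B0 mulr0 subr0; have e1 := Aw A0; ring: e1.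
have := w_add A (- (y * B)); have -> : A * - (y * B) = - (A * B * y) by ring.
have e1 := Aw A0; have e2 := Bw B0; rewrite !wN !wM => e3.
have e4 : (1 - w x) * (w A * w B) = 1 - w x.
  by rewrite mulrA (w_norm x0 A0 : _ * w A = _) (w_norm x0 B0 : _ * w B = _).
have e5 : (1 - w x) * (w A - w y * w B) = (1 - w x) * (1 - w y).
  rewrite mulrBr (w_norm x0 A0 : _ * w A = _) mulrCA (w_norm x0 B0 : _ * w B = _); ring.
have e6 : (1 - w x) * (1 - w A * w B * w y) = (1 - w x) * (1 - w y).
  rewrite mulrBr mulr1 mulrA e4; ring.
rewrite -{1}e6 -mulrA [_ * w (A - _)]mulrC -e3; exact: e5.
Qed.

(** Replacing x, y by x + y and x y (x + y) preserves the class and shortens the zero sum, until two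
    entries cancel and a hyperbolic plane splits off. The plane has determinant -1, whence the sign
    in the product. *)
Lemma combine_zero_sum (n : nat) (l : seq k) :
  (size l <= n)%N -> (0 < size l)%N -> all (fun x => x != 0) l ->
  \sum_(x <- l) x = 0 ->
  exists2 l', [/\ size l = (size l').+2, all (fun x => x != 0) l'
    & \sum_(x <- l) w x = \sum_(x <- l') w x]
  & exists2 c, c != 0 & \prod_(x <- l') x = - (\prod_(x <- l) x) * c ^+ 2.
Proof.
elim: n l => [|n IH] [|x [|y l]] //= sl _.
  by rewrite big_seq1 andbT => /negbTE xx /eqP; rewrite xx.
case/and3P=> x0 y0 l0; rewrite !big_cons => s0.
have [xy|xy] := eqVneq (x + y) 0.
  exists l; first split=> //.
    by move/eqP: xy; rewrite addr_eq0 => /eqP->; rewrite wN addKr.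
  exists (x^-1); first by rewrite invr_neq0.
  move/eqP: xy; rewrite addrC addr_eq0 => /eqP->; field.
  exact: x0.
have [||||l' [sl' l'0 sw] [c c0 pl']] := IH (x + y :: l) => //=.
- by rewrite xy.
- by rewrite big_cons -addrA.
exists (x * y * (x + y) :: l').
  split; rewrite /= ?sl' -?sl' //; first by rewrite !mulf_neq0.
  rewrite !big_cons -sw big_cons addrA w_add [x * y * _]mulrC [w (_ * (x * y))]wM; ring.
exists ((x + y) * c); first by rewrite mulf_neq0.
by rewrite !big_cons pl' !big_cons; ring.
Qed.

(** A zero of the form on the first five entries, used to rescale them by squares, turns those with
    nonzero coordinate into a zero sum; the other entries are set aside in [l2]. *)
Lemma shorten_form (l : seq k) : (4 < size l)%N -> all (fun x => x != 0) l ->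
  exists2 l', [/\ size l = (size l').+2, all (fun x => x != 0) l'
    & \sum_(x <- l) w x = \sum_(x <- l') w x]
  & exists2 c, c != 0 & \prod_(x <- l') x = - (\prod_(x <- l) x) * c ^+ 2.
Proof.
move=> sl l0; have [z [i zi] z0] := k5 (fun i : 'I_5 => l`_i).
pose s := [seq (l`_(val i), z i) | i <- enum 'I_5].
have s5 : size s = 5%N by rewrite size_map size_enum_ord.
have def5 : unzip1 s = take 5 l.
  apply: (@eq_from_nth _ 0); first by rewrite size_map s5 size_takel.
  move=> j; rewrite size_map s5 => j5.
  by rewrite (nth_map (0, 0)) ?s5 // (nth_map i) ?size_enum_ord //= nth_enum_ord // nth_take.
have sz : \sum_(u <- s) u.1 * u.2 ^+ 2 = 0 by rewrite big_map big_enum.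
have sn : has (fun u => u.2 != 0) s.
  by apply/hasP; exists (l`_i, z i) => //; apply: map_f; rewrite mem_enum.
have s1 : all (fun u => u.1 != 0) s.
  rewrite -(all_map fst (fun x => x != 0)) -/(unzip1 s) def5.
  by apply/allP => x /mem_take; apply: (allP l0).
clearbody s; pose l1 := [seq u.1 * u.2 ^+ 2 | u <- s & u.2 != 0].
pose l2 := [seq u.1 | u <- s & u.2 == 0] ++ drop 5 l.
have [||||l' [sl' l'0 sw] [c c0 pl']] := @combine_zero_sum (size l1) l1 => //.
- by rewrite size_map size_filter -has_count.
- apply/allP => _ /mapP[u + ->]; rewrite mem_filter => /andP[u2 /(allP s1) u1].
  by rewrite mulf_neq0 ?expf_neq0.
- rewrite big_map big_filter -[RHS]sz [RHS](bigID (fun u => u.2 != 0)) /=.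
  rewrite [X in _ = _ + X]big1 ?addr0 // => u; rewrite negbK => /eqP->.
  by rewrite expr0n mulr0.
(* Stated for any commutative operation, because the sum of the classes and the product of the
   entries are split in the same way. *)
have spl (R : Type) (idx : R) (op : Monoid.com_law idx) (F : k -> R) :
    \big[op/idx]_(x <- l) F x =
    op (op (\big[op/idx]_(u <- s | u.2 != 0) F u.1)
           (\big[op/idx]_(u <- s | u.2 == 0) F u.1))
       (\big[op/idx]_(x <- drop 5 l) F x).
  rewrite -{1}(cat_take_drop 5 l) big_cat /= -def5 big_map.
  rewrite (bigID (fun u => u.2 != 0)) /=; congr (op (op _ _) _).
  by apply: eq_bigl => u; rewrite negbK.
exists (l' ++ l2).
  split.
  - have -> : size l = (size l1 + size l2)%N.
      have -> : size l1 = count (fun u => u.2 != 0) s by rewrite size_map size_filter.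
      have -> : size l2 = (count (fun u => u.2 == 0%R) s + (size l - 5))%N.
        by rewrite size_cat size_map size_filter size_drop.
      have := count_predC (fun u => u.2 != 0) s; rewrite s5 => e.
      have e' : count (predC (fun u => u.2 != 0)) s = count (fun u => u.2 == 0) s.
        by apply: eq_count => u /=; rewrite negbK.
      by rewrite addnA -e' e subnKC.
    by rewrite sl' size_cat addSn addSn.
  - rewrite !all_cat l'0 /=; apply/andP; split.
      by rewrite all_map; apply/allP => u /=; rewrite mem_filter => /andP[_ /(allP s1)].
    by apply/allP => x /mem_drop; apply: (allP l0).
  - rewrite spl /= big_cat /= -sw /l1 !big_map !big_filter /l2 big_cat /= big_map big_filter addrA.
    congr (_ + _ + _); apply: eq_bigr => u u2.
    by rewrite mulrC w_sqr.
pose e := \prod_(u <- s | u.2 != 0) u.2.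
have e0 : e != 0.
  by rewrite /e; elim/big_rec: _ => [|u y u2 y0]; rewrite ?oner_neq0 ?mulf_neq0.
exists (c * e); first by rewrite mulf_neq0.
rewrite spl /= big_cat /= pl' /l1 !big_map !big_filter /l2 big_cat /= big_map big_filter.
by rewrite big_split /= prodrXl -/e; ring.
Qed.

(** Shortening brings the rank down to at most four. With the given discriminant a form of rank two
    is a hyperbolic plane, and one of rank four is x1 <1, x1 x2, x1 x3, x2 x3>, a multiple of a
    two-fold Pfister form whose scalar is absorbed by [pf_univ]. *)
Lemma even_disc_pf (m : nat) (l : seq k) : size l = (2 * m)%N ->
  all (fun x => x != 0) l ->
  (exists2 c, c != 0 & (-1) ^+ m * \prod_(x <- l) x = c ^+ 2) ->
  exists u v : k, [/\ u != 0, v != 0 & \sum_(x <- l) w x = pf u v].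
Proof.
elim: m l => [|m IH] l sl l0 [c c0 Hc].
  case: l sl {l0 Hc} => // _; exists 1, 1.
  by rewrite !oner_neq0 big_nil /pf w1 subrr mul0r.
have [l5|] := boolP (4 < size l)%N.
  have [l' [sl' l'0 ->] [e e0 He]] := shorten_form l5 l0.
  apply: IH => //; first by move: sl; rewrite sl' mulnS => -[].
  exists (c * e); first by rewrite mulf_neq0.
  by rewrite He exprMn -Hc [(-1) ^+ m.+1]exprS; ring.
case: l sl l0 Hc => [//|x1 [|x2 [|x3 [|x4 [|//]]]]] /= sl; try by move: sl; lia.
  have -> : m = 0%N by move: sl; lia.
  case/and3P=> x10 x20 _; rewrite !big_cons !big_nil => Hc _.
  exists 1, 1; rewrite !oner_neq0 /pf w1 subrr mul0r; split=> //.
  rewrite (@w_sqr_eq x2 (- x1) (c / x1)) ?mulf_neq0 ?invr_neq0 //.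
    by rewrite wN addr0 subrr.
  by rewrite expr_div_n -Hc; field.
have -> : m = 1%N by move: sl; lia.
case/and5P=> x10 x20 x30 x40 _; rewrite !big_cons !big_nil => Hc _.
exists (- (x1 * x2)), (- (x1 * x3)).
rewrite !oppr_eq0 !mulf_neq0 //; split=> //.
rewrite -[RHS](@pf_univ _ _ x1) ?oppr_eq0 ?mulf_neq0 // /pf !wN !wM.
rewrite (@w_sqr_eq x4 (x1 * x2 * x3) (c / (x1 * x2 * x3))) ?mulf_neq0 ?invr_neq0 ?mulf_neq0 //.
  rewrite !wM.
  transitivity (w x1 + (w x1 * w x1) * w x2 + (w x1 * w x1) * w x3
                + (w x1 * w x1) * (w x1 * w x2 * w x3)); last by ring.
  by rewrite wMM //; ring.
by rewrite expr_div_n -Hc; field; rewrite x10 x20 x30.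
Qed.

Hypothesis k2 : minus_one_two_squares.

(** The form <1, 1> represents -1 or is itself hyperbolic; being round, it is unchanged by
    multiplication by <-1>, that is, 2 = -2. *)
Lemma four_eq0 : (4%:R : witt k) = 0.
Proof.
have [p [q [r [n0 e]]]] := k2.
have m1 : (-1 : k) != 0 by rewrite oppr_eq0 oner_neq0.
suff : (1 - w (-1)) * w (-1) = 1 - w (-1).
  rewrite wN w1 opprK => e'; have -> : (4%:R : witt k) = (1 + 1) - (1 + 1) * (- 1) by ring.
  by rewrite e' subrr.
have [r0|r0] := eqVneq r 0.
  rewrite (@w_norm0 (-1) p q) ?subrr ?mul0r //.
    by move: n0; rewrite r0 eqxx orbF.
  by rewrite -e r0; ring.
have A0 : p ^+ 2 - (-1) * q ^+ 2 = r ^+ 2 * (-1).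
  by apply/eqP; rewrite -subr_eq0 -e; apply/eqP; ring.
rewrite -{2}(@w_norm (-1) p q) //; first by rewrite A0 w_sqr.
by rewrite A0 mulf_neq0 ?expf_neq0.
Qed.

End GoodField.

(** * Simultaneous zeros of quadratic forms *)

Section ChevalleyWarning.

Variables (F : finFieldType) (I : finType).
Implicit Types (f g : {ffun I -> F} -> F) (d : nat).

(* [f] is a polynomial function of total degree at most [d]. *)
Definition degle d f : Prop := exists2 s : seq (F * {ffun I -> nat}),
  all (fun u : F * {ffun I -> nat} => \sum_i u.2 i <= d)%N s
  & forall x, f x = \sum_(u <- s) u.1 * \prod_i x i ^+ u.2 i.

Lemma degle_ext d f g : f =1 g -> degle d f -> degle d g.
Proof. by move=> fg [s s1 s2]; exists s => // x; rewrite -fg. Qed.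

Lemma degleC d c : degle d (fun=> c).
Proof.
exists [:: (c, [ffun=> 0%N])].
  by rewrite /= andbT big1 // => i _; rewrite ffunE.
by move=> x; rewrite big_seq1 /= big1 ?mulr1 // => i _; rewrite ffunE.
Qed.

Lemma degleX i : degle 1 (fun x => x i).
Proof.
exists [:: (1, [ffun j => (j == i) : nat])].
  rewrite /= andbT (bigD1 i) //= ffunE eqxx big1 // => j /negbTE ji.
  by rewrite ffunE ji.
move=> x; rewrite big_seq1 /= mul1r (bigD1 i) //= ffunE eqxx expr1 big1 ?mulr1 //.
by move=> j /negbTE ji; rewrite ffunE ji.
Qed.

Lemma degleD d f g : degle d f -> degle d g -> degle d (fun x => f x + g x).
Proof.
move=> [s s1 s2] [t t1 t2]; exists (s ++ t); first by rewrite all_cat s1.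
by move=> x; rewrite s2 t2 big_cat.
Qed.

Lemma degleM d e f g : degle d f -> degle e g -> degle (d + e) (fun x => f x * g x).
Proof.
move=> [s s1 s2] [t t1 t2].
pose mm (u v : F * {ffun I -> nat}) :=
  (u.1 * v.1, [ffun i => (u.2 i + v.2 i)%N] : {ffun I -> nat}).
exists [seq mm u v | u <- s, v <- t].
  apply/allP => _ /allpairsP[[u v] /= [us vt ->]] /=.
  rewrite (eq_bigr (fun i => u.2 i + v.2 i)%N) => [|i _]; last by rewrite /mm ffunE.
  by rewrite big_split leq_add ?(allP s1 u us) ?(allP t1 v vt).
move=> x; rewrite s2 t2 big_allpairs_dep mulr_suml; apply: eq_bigr => u _.
rewrite mulr_sumr; apply: eq_bigr => v _ /=.
rewrite [in RHS](eq_bigr (fun i => x i ^+ u.2 i * x i ^+ v.2 i)) => [|i _]; last by rewrite /mm ffunE exprD.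
rewrite big_split /=; ring.
Qed.

Lemma degle_exp d f n : degle d f -> degle (n * d) (fun x => f x ^+ n).
Proof.
move=> df; elim: n => [|n IH]; first by apply: degle_ext (degleC _ 1) => x; rewrite expr0.
by rewrite mulSn; apply: degle_ext (degleM df IH) => x; rewrite exprS.
Qed.

Lemma degle_sum d (J : finType) (h : J -> {ffun I -> F} -> F) :
  (forall j, degle d (h j)) -> degle d (fun x => \sum_j h j x).
Proof.
move=> dh; elim: (index_enum J) => [|j s IH].
  by apply: degle_ext (degleC _ 0) => x; rewrite big_nil.
by apply: degle_ext (degleD (dh j) IH) => x; rewrite big_cons.
Qed.

Lemma degle_prod d (J : finType) (h : J -> {ffun I -> F} -> F) :
  (forall j, degle d (h j)) -> degle (#|J| * d) (fun x => \prod_j h j x).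
Proof.
move=> dh; rewrite cardE.
apply: (@degle_ext _ (fun x => \prod_(j <- enum J) h j x)) => [x|].
  by rewrite big_enum.
elim: (enum J) => [|j s IH].
  by apply: degle_ext (degleC _ 1) => x; rewrite big_nil.
by rewrite [size _]/= mulSn; apply: degle_ext (degleM (dh j) IH) => x; rewrite big_cons.
Qed.

Lemma card_natr0 : #|F|%:R = 0 :> F.
Proof.
have := @expg_cardG F [set: F]%G (GRing.one F) (in_setT _).
rewrite cardsT FinRing.zmodXgE; exact.
Qed.

(** For m > 0 some nonzero a has a^m different from 1, as X^m - 1 has too few roots, and the
    substitution t -> a t multiplies the sum by a^m. For m = 0 the sum is |F| = 0. *)
Lemma sum_exp0 m : (m < #|F|.-1)%N -> \sum_(t : F) t ^+ m = 0.
Proof.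
case: m => [_|m mq].
  by under eq_bigr => t _ do rewrite expr0; rewrite sumr_const card_natr0.
have [a a0 am] : exists2 a : F, a != 0 & a ^+ m.+1 != 1.
  apply/exists_inP; apply: contraLR mq => /exists_inPn am; rewrite -leqNgt.
  have -> : #|F|.-1 = size (enum [pred a : F | a != 0]).
    by rewrite -cardE cardC1.
  apply: max_unity_roots (enum_uniq _) => //.
  apply/allP => a; rewrite mem_enum => /am.
  by rewrite negbK unity_rootE.
apply/eqP; have : (a ^+ m.+1 - 1) * \sum_(t : F) t ^+ m.+1 == 0.
  rewrite mulrBl mul1r subr_eq0 mulr_sumr; apply/eqP.
  rewrite [RHS](reindex_onto (fun t => a * t) (fun t => a^-1 * t)) /=; last first.
    by move=> t _; rewrite mulVKf.
  apply: eq_big => [t|t _]; last by rewrite exprMn.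
  by rewrite mulKf ?eqxx.
by rewrite mulf_eq0 subr_eq0 (negbTE am).
Qed.

(** In each monomial some exponent is below |F| - 1, and the sum over that variable alone
    vanishes. *)
Lemma sum_degle0 d f : degle d f -> (d < #|I| * #|F|.-1)%N -> \sum_x f x = 0.
Proof.
move=> [s s1 s2] dI.
rewrite (eq_bigr _ (fun x _ => s2 x)) exchange_big big_seq big1 // => u us.
rewrite -mulr_sumr -(bigA_distr_bigA (fun i (t : F) => t ^+ u.2 i)) /=.
have [i ui] : exists i, (u.2 i < #|F|.-1)%N.
  apply/existsP; apply: contraLR (allP s1 u us) => /existsPn h; rewrite -ltnNge.
  apply: leq_trans dI _; rewrite -sum_nat_const; apply: leq_sum => i _.
  by rewrite leqNgt h.
by rewrite (bigD1 i) //= sum_exp0 // mul0r mulr0.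
Qed.

(** With q = |F|, the product of the 1 - f_j^(q - 1) is the indicator function of the common zeros.
    Its degree is at most 2 |J| (q - 1) < |I| (q - 1), so its values add up to 0, whereas they would
    add up to 1 if 0 were the only common zero. *)
Lemma chevalley (J : finType) (Q : J -> I -> I -> F) : (2 * #|J| < #|I|)%N ->
  exists2 x : I -> F, (exists i, x i != 0)
    & forall j, \sum_i \sum_i' Q j i i' * x i * x i' = 0.
Proof.
move=> JI; pose f j (x : {ffun I -> F}) := \sum_i \sum_i' Q j i i' * x i * x i'.
have [/existsP[x /andP[x0 /forallP fx]]|none] :=
    boolP [exists x : {ffun I -> F}, (x != 0) && [forall j, f j x == 0]].
  exists x; last by move=> j; apply/eqP/fx.
  apply/existsP; apply: contraNT x0 => /existsPn h.
  by apply/eqP/ffunP => i; rewrite ffunE; apply/eqP; rewrite -[_ == _]negbK h.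
have q1 : (0 < #|F|.-1)%N.
  by have := finNzRing_gt1 F; case: #|F| => [|[]].
have dP : degle (#|J| * (#|F|.-1 * 2)) (fun x => \prod_j (1 - f j x ^+ #|F|.-1)).
  apply: degle_prod => j; apply: degleD; first exact: degleC.
  have df : degle 2 (f j).
    apply: degle_sum => i; apply: degle_sum => i'.
    exact: degleM (degleM (degleC 0 _) (degleX i)) (degleX i').
  apply: degle_ext (degleM (degleC 0 (-1)) (degle_exp _ df)) => x.
  by rewrite mulN1r.
have : \sum_x \prod_j (1 - f j x ^+ #|F|.-1) = 0.
  by apply: sum_degle0 dP _; rewrite mulnCA mulnC ltn_pmul2r // mulnC.
rewrite (bigD1 (0 : {ffun I -> F})) //= [X in _ + X]big1 => [|x x0].
  rewrite big1 ?addr0 => [/eqP|j _]; first by rewrite oner_eq0.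
  rewrite /f big1 ?expr0n -?lt0n ?q1 ?subr0 //; last first.
    by move=> i _; rewrite big1 // => i' _; rewrite !ffunE mulr0.
  by rewrite eqn0Ngt q1 subr0.
move: none => /existsPn/(_ x); rewrite x0 negb_forall => /existsP[j fj].
rewrite (bigD1 j) //=; suff -> : f j x ^+ #|F|.-1 = 1 by rewrite subrr mul0r.
have e : #|F|.-1.+1 = #|F| by apply: prednK; apply: ltnW (finNzRing_gt1 F).
by apply: (mulfI fj); rewrite mulr1 -exprS e expf_card.
Qed.

End ChevalleyWarning.

(* The property C_2 of Tsen and Lang, for systems of quadratic forms. *)
Definition C2sys (k : fieldType) : Prop :=
  forall (J I : finType) (Q : J -> I -> I -> k), (4 * #|J| < #|I|)%N ->
  exists2 x : I -> k, (exists i, x i != 0)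
    & forall j, \sum_i \sum_i' Q j i i' * x i * x i' = 0.

Lemma fraction_denom (R : idomainType) (x : {fraction R}) :
  exists2 d : R, d != 0 & exists n, FracField.tofrac d * x = FracField.tofrac n.
Proof.
elim/quotW: x => r; exists (\d_r); first exact: denom_ratioP.
exists (\n_r).
rewrite /FracField.tofrac; unlock; rewrite -[LHS]FracField.pi_mul.
apply/eqmodP; rewrite /= FracField.equivfE /FracField.mulf.
have d0 := denom_ratioP r.
by rewrite !numden_Ratio ?mulf_neq0 ?oner_neq0 // mulr1 mul1r mulrC.
Qed.

Lemma common_denom (R : idomainType) (T : finType) (f : T -> {fraction R}) :
  exists2 d : R, d != 0 &
    exists n : T -> R, forall t, FracField.tofrac d * f t = FracField.tofrac (n t).
Proof.
have dP t : exists d : R, (d != 0) && boolp.asbool (exists n, FracField.tofrac d * f t = FracField.tofrac n).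
  by have [d d0 dn] := fraction_denom (f t); exists d; rewrite d0; apply/boolp.asboolP.
pose d t := xchoose (dP t).
have d0 t : d t != 0 by case/andP: (xchooseP (dP t)).
have nP t : exists n, FracField.tofrac (d t) * f t == FracField.tofrac n.
  by case/andP: (xchooseP (dP t)) => _ /boolp.asboolP[n e]; exists n; apply/eqP.
exists (\prod_t d t); first by apply/prodf_neq0.
exists (fun t => (\prod_(u | u != t) d u) * xchoose (nP t)) => t.
rewrite (bigD1 t) //= [d t * _]mulrC !rmorphM /= -mulrA.
by congr (_ * _); exact/eqP/(xchooseP (nP t)).
Qed.

(** Polynomials with [s] unknown coefficients each are substituted for the variables. Once
    denominators are cleared, the system becomes one of quadratic equations over F in |I| s
    unknowns, to which [chevalley] applies. *)
Lemma C2sys_ratfrac (F : finFieldType) : C2sys {fraction {poly F}}.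
Proof.
move=> J I Q JI.
have [D D0 [n Dn]] := common_denom (fun u : J * I * I => Q u.1.1 u.1.2 u.2).
pose R j i i' := n (j, i, i').
have QR j i i' : FracField.tofrac D * Q j i i' = FracField.tofrac (R j i i').
  exact: (Dn (j, i, i')).
(* The coefficients of the forms have size at most [e], so each form yields at most e + 2 s
   equations. The choice of [s] gives 2 |J| (e + 2 s) < (4 |J| + 1) s <= |I| s. *)
pose e := \max_u size (n u); pose s := (2 * #|J| * e).+1.
pose M := (e + 2 * s)%N.
have Re j i i' : (size (R j i i') <= e)%N by apply: leq_bigmax.
pose Q' (u : J * 'I_M) (v v' : I * 'I_s) : F :=
  (R u.1 v.1 v'.1 * 'X^(v.2 + v'.2))`_u.2.
have [|y [[i0 l0] y0] Hy] := @chevalley F (I * 'I_s)%type (J * 'I_M)%type Q'.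
  have arith a b c : (4 * a < b)%N ->
      (2 * (a * (c + 2 * (2 * a * c).+1)) < b * (2 * a * c).+1)%N.
    move=> ab; have : ((4 * a + 1) * (2 * a * c).+1 <= b * (2 * a * c).+1)%N.
      by rewrite leq_mul2r addn1 ab orbT.
    nia.
  by rewrite !card_prod !card_ord /M /s arith.
pose x i : {poly F} := \poly_(l < s) (if insub l is Some l' then y (i, l') else 0).
have xE i : x i = \sum_(l < s) y (i, l) *: 'X^l.
  rewrite /x poly_def; apply: eq_bigr => l _.
  by rewrite insubT ?ltn_ord // => lt; congr (y (i, _) *: _); apply: val_inj.
exists (fun i => FracField.tofrac (x i)).
  exists i0; rewrite tofrac_eq0; apply: contraNneq y0 => xi.
  have := congr1 (fun p : {poly F} => p`_l0) xi.
  rewrite coef0 coef_poly ltn_ord insubT ?ltn_ord // => lt e0.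
  by apply/eqP; rewrite -[RHS]e0; congr (y (_, _)); apply: val_inj.
move=> j; apply: (@mulfI _ (FracField.tofrac D)); first by rewrite tofrac_eq0.
rewrite mulr0 mulr_sumr -[RHS](rmorph0 (@FracField.tofrac {poly F})).
transitivity (FracField.tofrac (\sum_i \sum_i' R j i i' * x i * x i')).
  rewrite rmorph_sum; apply: eq_bigr => i _; rewrite rmorph_sum mulr_sumr.
  by apply: eq_bigr => i' _; rewrite !rmorphM /= -QR !mulrA.
congr FracField.tofrac; apply/polyP => m; rewrite coef0.
transitivity (\sum_(v : I * 'I_s) \sum_(v' : I * 'I_s)
   (R j v.1 v'.1 * 'X^(v.2 + v'.2))`_m * y (v.1, v.2) * y (v'.1, v'.2)).
  rewrite -(pair_bigA _ (fun i (l : 'I_s) => \sum_(v' : I * 'I_s) (R j i v'.1 * 'X^(l + v'.2))`_m * y (i, l) * y (v'.1, v'.2))) /=.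
  rewrite coef_sum; apply: eq_bigr => i _.
  under [RHS]eq_bigr => l _ do
    rewrite -(pair_bigA _ (fun i' (l' : 'I_s) => (R j i i' * 'X^(l + l'))`_m * y (i, l) * y (i', l'))) /=.
  rewrite [RHS]exchange_big coef_sum; apply: eq_bigr => i' _ /=.
  rewrite !xE [R _ _ _ * _]mulr_sumr mulr_suml coef_sum; apply: eq_bigr => l _.
  rewrite mulr_sumr coef_sum; apply: eq_bigr => l' _.
  rewrite -!scalerAr -scalerAl scalerA coefZ exprD mulrA; ring.
have [mM|mM] := ltnP m M.
  rewrite -[RHS](Hy (j, Ordinal mM)); apply: eq_bigr => v _; apply: eq_bigr => v' _.
  by rewrite -!surjective_pairing.
apply: big1 => v _; apply: big1 => v' _; rewrite nth_default ?mul0r //.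
apply: leq_trans (size_polyMleq _ _) _; rewrite size_polyXn.
rewrite addnS /=; apply: leq_trans mM; rewrite /M.
apply: leq_add; first exact: Re.
by rewrite mul2n -addnn leq_add // ltnW.
Qed.

(** Restriction of scalars in a basis multiplies the number of unknowns and the number of forms by
    the same degree. *)
Lemma C2sys_ext (k : fieldType) (M : fieldExtType k) : C2sys k -> C2sys M.
Proof.
move=> Ck J I Q JI; pose e := \dim {:M}; pose b := vbasis {:M}.
have e0 : (0 < e)%N := adim_gt0 _.
pose Q' (u : J * 'I_e) (v v' : I * 'I_e) : k :=
  coord b u.2 (Q u.1 v.1 v'.1 * b`_v.2 * b`_v'.2).
have [|y [[i0 l0] y0] Hy] := Ck (J * 'I_e)%type (I * 'I_e)%type Q'.
  by rewrite !card_prod !card_ord mulnA ltn_pmul2r.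
pose x i := \sum_(l < e) y (i, l) *: b`_l.
exists x.
  exists i0; apply: contraNneq y0 => xi.
  have fb : free b by apply: basis_free (vbasisP _).
  by apply/eqP; apply: (freeP fb (fun l => y (i0, l)) xi).
move=> j; have -> : \sum_i \sum_i' Q j i i' * x i * x i' =
    \sum_(v : I * 'I_e) \sum_(v' : I * 'I_e)
       (y (v.1, v.2) * y (v'.1, v'.2)) *: (Q j v.1 v'.1 * b`_v.2 * b`_v'.2).
  rewrite -(pair_bigA _ (fun i (l : 'I_e) => \sum_(v' : I * 'I_e) (y (i, l) * y (v'.1, v'.2)) *: (Q j i v'.1 * b`_l * b`_v'.2))) /=.
  apply: eq_bigr => i _.
  under [RHS]eq_bigr => l _ do
    rewrite -(pair_bigA _ (fun i' (l' : 'I_e) => (y (i, l) * y (i', l')) *: (Q j i i' * b`_l * b`_l'))) /=.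
  rewrite [RHS]exchange_big; apply: eq_bigr => i' _ /=.
  rewrite /x [Q _ _ _ * _]mulr_sumr mulr_suml; apply: eq_bigr => l _.
  rewrite mulr_sumr; apply: eq_bigr => l' _.
  by rewrite -!scalerAr -scalerAl scalerA [y _ * _]mulrC.
rewrite [LHS](coord_basis (vbasisP {:M}) (memvf _)) big1 // => m _.
suff -> : coord b m (\sum_(v : I * 'I_e) \sum_(v' : I * 'I_e)
       (y (v.1, v.2) * y (v'.1, v'.2)) *: (Q j v.1 v'.1 * b`_v.2 * b`_v'.2)) = 0 by rewrite scale0r.
rewrite linear_sum -[RHS](Hy (j, m)); apply: eq_bigr => v _.
rewrite linear_sum; apply: eq_bigr => v' _.
by rewrite linearZ /= /Q' /= -!surjective_pairing; ring.
Qed.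

Lemma C2sys_five (k : fieldType) : C2sys k -> five_isotropic k.
Proof.
move=> Ck a; have [|x x0 Hx] := Ck unit 'I_5 (fun _ i i' => a i *+ (i == i')).
  by rewrite card_unit card_ord.
exists x => //; rewrite -[RHS](Hx tt); apply: eq_bigr => i _.
rewrite (bigD1 i) //= eqxx big1 ?addr0 => [|i' /negbTE]; first by rewrite mulr1n expr2 mulrA.
by rewrite eq_sym => ->; rewrite mulr0n !mul0r.
Qed.

Lemma minus_one_two_squares_fin (F : finFieldType) : minus_one_two_squares F.
Proof.
have [|x [i xi] Hx] := @chevalley F 'I_3 unit (fun _ i i' => (i == i')%:R).
  by rewrite card_unit card_ord.
have sq : \sum_i x i ^+ 2 = 0.
  rewrite -[RHS](Hx tt); apply: eq_bigr => j _.
  rewrite (bigD1 j) //= eqxx big1 ?addr0 => [|j' /negbTE]; first by rewrite mul1r expr2.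
  by rewrite eq_sym => ->; rewrite !mul0r.
exists (x 0), (x 1), (x 2%:R); split; last first.
  rewrite -[RHS]sq !big_ord_recl big_ord0 addr0 addrA.
  by congr (_ ^+ 2 + _ ^+ 2 + _ ^+ 2); congr x; apply: val_inj.
apply: contraNT xi; rewrite !negb_or !negbK => /and3P[/eqP x0 /eqP x1 /eqP x2].
case: i => [[|[|[|//]]] hi]; apply/eqP.
- by rewrite -x0; congr x; apply: val_inj.
- by rewrite -x1; congr x; apply: val_inj.
- by rewrite -x2; congr x; apply: val_inj.
Qed.

Lemma minus_one_two_squares_rmorph (k k' : fieldType) (f : {rmorphism k -> k'}) :
  minus_one_two_squares k -> minus_one_two_squares k'.
Proof.
move=> [p [q [r [n0 e]]]]; exists (f p), (f q), (f r).
by rewrite !fmorph_eq0 -!rmorphXn -!rmorphD e rmorph0.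
Qed.

(** * Finite 2-groups *)

Section TwoGroups.

Variable gT : finGroupType.
Implicit Types (P H J C : {group gT}).
Local Open Scope nat_scope.
Local Open Scope group_scope.

Lemma noncyclic_maximals (p : nat) P : p.-group P -> ~~ cyclic P ->
  exists J1 J2 : {group gT}, [/\ maximal J1 P, maximal J2 P & J1 != J2].
Proof.
move=> pP ncP.
have Pn1 : P :!=: 1 by apply: contraNneq ncP => ->; apply: cyclic1.
have [e|[J1 mJ1 _]] := maximal_exists (sub1G P); first by rewrite -e eqxx in Pn1.
have [x xP xJ1] : exists2 x, x \in P & x \notin J1.
  by apply/subsetPn; have /maxgroupp/andP[] := mJ1.
have sxP : <[x]> \subset P by rewrite cycle_subG.
have [e|[J2 mJ2 xJ2]] := maximal_exists sxP.
  by case/negP: ncP; rewrite -e cycle_cyclic.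
exists J1, J2; split=> //; apply: contraNneq xJ1 => ->.
by rewrite -cycle_subG.
Qed.

Lemma sqr_in_index2 P J x : J <| P -> #|P : J| = 2 -> x \in P -> x ^+ 2 \in J.
Proof.
move=> nJP iJ xP; have xN : x \in 'N(J) by rewrite (subsetP (normal_norm nJP)).
apply: coset_idr; first exact: groupX.
have := expg_cardG (mem_quotient J xP).
by rewrite card_quotient ?normal_norm // iJ morphX.
Qed.

Lemma der1_index2 P J : J <| P -> #|P : J| = 2 -> P^`(1) \subset J.
Proof.
move=> nJP iJ; apply: der1_min (normal_norm nJP) _; apply: cyclic_abelian.
by apply: prime_cyclic; rewrite card_quotient ?normal_norm // iJ.
Qed.

Lemma maximal_2group P J : 2.-group P -> maximal J P ->
  [/\ J \subset P, J <| P, #|P : J| = 2 & (2 * #|J| = #|P|)%N].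
Proof.
move=> tP mJ; have iJ := p_maximal_index tP mJ.
have sJP := proper_sub (maxgroupp mJ); split=> //.
  exact: p_maximal_normal tP mJ.
by rewrite -iJ mulnC Lagrange.
Qed.

Lemma even_card_2group P : 2.-group P -> (1 < #|P|)%N -> ~~ odd #|P|.
Proof.
move=> tP P1; have /pgroup_pdiv[|_ d2 _] := tP; last by rewrite -dvdn2.
by rewrite -cardG_gt1.
Qed.

(** Such a group is quaternion. The intersection D of two maximal subgroups is central of index 4,
    and every element outside D has a square generating D. With a^2 = u, b^2 = u^i, (a b)^2 = u^j
    and [b, a] = u^l, the exponents i and j are odd and j = 1 + i + l modulo the order of u, so l is
    odd; as [b, a]^2 = 1, u has order 2. *)
Lemma all_maximal_cyclic P : 2.-group P -> (8 <= #|P|)%N -> ~~ cyclic P ->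
  (forall J, maximal J P -> cyclic J) -> #|P| = 8 /\ ~~ abelian P.
Proof.
move=> tP P8 ncP cJ.
have [J1 [J2 [mJ1 mJ2 J12]]] := noncyclic_maximals tP ncP.
have [sJ1 nJ1 iJ1 cJ1] := maximal_2group tP mJ1.
have [sJ2 nJ2 iJ2 cJ2] := maximal_2group tP mJ2.
pose D := (J1 :&: J2)%G.
have sD1 : D \subset J1 by apply: subsetIl.
have sD2 : D \subset J2 by apply: subsetIr.
have nJ21 : ~~ (J2 \subset J1).
  apply: contra J12 => s21; rewrite -val_eqE /= eq_sym eqEcard s21.
  by rewrite -(leq_pmul2l (isT : 0 < 2)%N) cJ1 cJ2 leqnn.
have defP : J1 * J2 = P by apply: mulg_normal_maximal.
have cD : (4 * #|D| = #|P|)%N.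
  have := mul_cardG J1 J2; rewrite defP /= -/D => e.
  apply/eqP; rewrite -(eqn_pmul2l (cardG_gt0 P)) mulnCA -e -{1}cJ1 -{1}cJ2; apply/eqP; ring.
have cPD : P \subset 'C(D).
  rewrite -defP mul_subG // ?(sub_abelian_cent _ sD1) ?(sub_abelian_cent _ sD2) //;
  by apply: cyclic_abelian; apply: cJ.
have key J x : maximal J P -> D \subset J -> x \in J -> x \notin D -> <[x ^+ 2]> = D :> {set gT}.
  move=> mJ sDJ xJ xD; have [_ _ _ cJP] := maximal_2group tP mJ.
  have /cyclicP[g defJ] := cJ J mJ.
  have og : (#[g] = 2 * #|D|)%N.
    rewrite /order -defJ; apply/eqP.
    by rewrite -(eqn_pmul2l (isT : 0 < 2)%N) cJP -cD mulnA.
  have defD : <[g ^+ 2]> = D.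
    apply/eqP; rewrite (eq_subG_cyclic (cJ J mJ)) ?sDJ //.
      by rewrite -[#|_|]/#[g ^+ 2] orderXdiv og ?dvdn_mulr // mulKn.
    by rewrite cycle_subG defJ groupX ?cycle_id.
  move: xJ; rewrite defJ => /cycleP[j def_x]; rewrite def_x -expgM mulnC expgM -defD.
  apply/esym/eqP; rewrite -[_ == _]/(generator _ _) generator_coprime.
  have tD : 2%N.-nat #[g ^+ 2].
    rewrite /order defD; apply: pgroupS (subset_trans sD1 sJ1) tP.
  apply: (@pnat_coprime 2%N) => //; rewrite p'natE // dvdn2 negbK.
  apply: contraNT xD => oj; rewrite def_x -(odd_double_half j) (negbTE oj) add0n -mul2n.
  by rewrite expgM -defD mem_cycle.
have /cyclicP[a defJ1] := cJ _ mJ1; have /cyclicP[b defJ2] := cJ _ mJ2.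
have aJ1 : a \in J1 by rewrite defJ1 cycle_id.
have bJ2 : b \in J2 by rewrite defJ2 cycle_id.
have bJ1 : b \notin J1 by rewrite -cycle_subG -defJ2.
have [aP bP] : a \in P /\ b \in P by rewrite (subsetP sJ1) ?(subsetP sJ2).
have aD : a \notin D.
  rewrite -cycle_subG -defJ1; apply/negP => /subset_leq_card.
  by rewrite leqNgt -(ltn_pmul2l (isT : 0 < 4)%N) cD -cJ1 ltn_pmul2r.
have bD : b \notin D by apply: contra bJ1; apply: (subsetP sD1).
have cD' : a * b \notin D.
  by apply: contra bJ1 => /(subsetP sD1); rewrite groupMl.
have da := key _ _ mJ1 sD1 aJ1 aD; have db := key _ _ mJ2 sD2 bJ2 bD.
have [J3 mJ3 cJ3] : exists2 J3 : {group gT}, maximal J3 P & a * b \in J3.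
  have sab : <[a * b]> \subset P by rewrite cycle_subG groupM.
  have [e|[J3 mJ3]] := maximal_exists sab; last by rewrite cycle_subG; exists J3.
  by case/negP: ncP; rewrite -e cycle_cyclic.
have sD3 : D \subset J3.
  have [_ nJ3 iJ3 _] := maximal_2group tP mJ3.
  by rewrite -da cycle_subG (sqr_in_index2 nJ3).
have dc := key _ _ mJ3 sD3 cJ3 cD'.
pose u := a ^+ 2; pose z := [~ b, a].
have zD : z \in D.
  have zP : z \in P^`(1) by apply: mem_commg.
  by rewrite inE (subsetP (der1_index2 nJ1 iJ1)) ?(subsetP (der1_index2 nJ2 iJ2)).
have cen x y : x \in D -> y \in P -> y * x = x * y.
  by move=> xD yP; have /centP/(_ x xD) := subsetP cPD y yP.
have uD (x : gT) : x \in D -> exists i, x = u ^+ i by rewrite -da => /cycleP.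
have b2D : b ^+ 2 \in D by rewrite -db cycle_id.
have c2D : (a * b) ^+ 2 \in D by rewrite -dc cycle_id.
have [i def_b] := uD _ b2D; have [j def_c] := uD _ c2D; have [l def_z] := uD _ zD.
have ou : #[u] = #|D| by rewrite /order da.
have tu : 2%N.-nat #[u] by rewrite ou; apply: pgroupS (subset_trans sD1 sJ1) tP.
have u2 : (2 %| #[u])%N.
  move: tu; rewrite ou => tD; have := even_card_2group tD; rewrite -dvdn2; apply.
  by rewrite -(ltn_pmul2l (isT : 0 < 4)%N) cD; apply: leq_trans P8.
have oddgen m : <[u ^+ m]> = D -> odd m.
  rewrite -da -/u => /eqP; rewrite eq_sym -[_ == _]/(generator _ _) generator_coprime => co.
  by have := coprime_dvdl u2 co; rewrite coprime2n.
have oi : odd i by apply: oddgen; rewrite -def_b.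
have oj : odd j by apply: oddgen; rewrite -def_c.
have ba : b * a = a * b * z by rewrite /z commgEl mulgA mulgK -conjgC.
have e : u ^+ j = u ^+ (1 + i + l).
  clearbody z; rewrite -def_c expgD expgD expg1 -def_b -def_z /u !expgS !expg0 !mulg1.
  rewrite -!mulgA; congr (a * _); rewrite [b * (a * b)]mulgA ba -!mulgA; congr (a * (b * _)).
  by rewrite (cen z b zD bP).
have z2 : z ^+ 2 = 1.
  have : [~ b ^+ 2, a] = 1 by apply/eqP/commgP; rewrite /commute (cen _ a b2D aP).
  have sq (x : gT) : x ^+ 2 = x * x by rewrite expgS expg1.
  rewrite !sq commMgJ -/z => <-; congr (_ * _).
  by rewrite conjgE -(cen z b zD bP) mulKg.
have ol : odd l.
  have /eqP := e; rewrite eq_expg_mod_order => /eqP /(congr1 (fun n => (n %% 2)%N)).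
  by rewrite !modn_dvdm // !modn2 !oddD oi oj; case: (odd l).
have o4 : ~~ (4 %| #[u])%N.
  apply: contraL ol => u4; rewrite -dvdn2 -(@dvdn_pmul2l 2) // mulnC.
  by apply: dvdn_trans u4 _; rewrite mulnC order_dvdn mulnC expgM -def_z z2.
have o2 : #[u] = 2.
  have [t def_o] := p_natP tu; move: u2 o4; rewrite def_o.
  by case: t {def_o} => [|[|t]] // _; rewrite !expnS mulnA (dvdn_mulr _ (dvdnn 4)).
split; first by rewrite -cD -ou o2.
apply: contraL ol => abP; rewrite -dvdn2 -o2 order_dvdn -def_z /z.
by apply/commgP; apply: (centsP abP).
Qed.

(* [c |-> [~ c, s]] is a morphism on [C] whose image contains [P']. *)
Lemma abelian_index2_cent P C s : C \subset P -> #|P : C| = 2 -> abelian C ->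
  s \in P -> s \notin C -> #|P : P^`(1)| = 4 -> (#|'C_C[s]| <= 2)%N.
Proof.
move=> sCP iC abC sP sC iP'.
have nCP := index2_normal sCP iC.
have sN : s \in 'N(C) by rewrite (subsetP (normal_norm nCP)).
have fM : {in C &, {morph (fun c => [~ c, s]) : x y / x * y}}.
  move=> x y xC yC; rewrite commMgJ; congr (_ * _).
  have xsC : [~ x, s] \in C by rewrite groupM ?groupV ?memJ_norm.
  by rewrite conjgE (centsP abC _ xsC _ yC) mulKg.
pose f := Morphism fM; pose K := (f @* C)%G.
have KE y : y \in K -> exists2 c, c \in C & y = [~ c, s].
  by case/morphimP => c _ cC ->; exists c.
have sKC : K \subset C.
  by apply/subsetP => y /KE[c cC ->]; rewrite groupM ?groupV ?memJ_norm.
have sK (y : gT) : y \in K -> y ^ s \in K.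
  case/KE => c cC ->; rewrite conjRg [s ^ s]conjgE mulKg.
  by apply: (@mem_morphim _ _ _ f) => //; rewrite ?memJ_norm.
have defP : C * <[s]> = P.
  apply: mulg_normal_maximal nCP _ _ _; rewrite ?cycle_subG //.
  by apply: p_index_maximal => //; rewrite iC.
have nK : P \subset 'N(K).
  rewrite -defP mul_subG ?cycle_subG //.
    by apply: sub_abelian_norm.
  by apply/normP/eqP; rewrite eqEcard cardJg leqnn andbT; apply/subsetP => _ /imsetP[y yK ->]; apply: sK.
have abPK : abelian (P / K).
  rewrite -defP quotientMl ?(subset_trans sCP) // abelianM !quotient_abelian ?cycle_abelian //=.
  rewrite centsC quotient_cents2r // gen_subG; apply/subsetP => _ /imset2P[c t cC /cycleP[i ->] ->].
  elim: i => [|i IH]; first by rewrite expg0 commg1 group1.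
  rewrite expgS commgMJ; apply: groupM => //.
  rewrite memJ_norm; last by rewrite (subsetP nK) // groupX.
  by apply: (@mem_morphim _ _ _ f).
have le1 : (#|P^`(1)| <= #|K|)%N by rewrite subset_leq_card // der1_min.
have cK : (#|K| * #|'C_C[s]| = #|C|)%N.
  have -> : 'C_C[s] = 'ker f.
    apply/setP=> c; rewrite inE; apply/andP/idP => [[cC cs]|cf].
      by apply/(kerP _ cC)/eqP/commgP/cent1P.
    have cC := dom_ker cf; split=> //; apply/cent1P/commgP/eqP; exact: (mker cf).
  rewrite card_morphim setIid mulnC Lagrange //; exact: subsetIl.
have cP : (2 * #|C| = #|P|)%N by rewrite -iC mulnC Lagrange.
have cP' : (4 * #|P^`(1)| = #|P|)%N by rewrite -iP' mulnC Lagrange // der_sub.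
rewrite -(leq_pmul2l (cardG_gt0 P^`(1))).
apply: (@leq_trans (#|K| * #|'C_C[s]|)); first by rewrite leq_mul2r le1 orbT.
by rewrite cK -(leq_pmul2l (isT : 0 < 2)%N) cP -cP' (_ : 4 = 2 * 2)%N // -mulnA [(2 * #|_|)%N]mulnC.
Qed.

End TwoGroups.

Section TwoGroupQuotients.

Local Open Scope nat_scope.
Local Open Scope group_scope.

(** Induction through a central involution z of P'. The quotient has a cyclic subgroup C/<z> of
    index two, so C is abelian. If C were not cyclic, it would be generated by z and some c with z
    outside <c>; then <c^2> would be normal in P and nontrivial, so it would contain a nontrivial
    central element of P. That element lies in C_C(s) = <z> for s outside C, which puts z in <c>. *)
Lemma cyclic_index2 (n : nat) (gT : finGroupType) (P : {group gT}) : #|P| <= n -> 2.-group P ->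
  #|P : P^`(1)| = 4 ->
  exists C : {group gT}, [/\ C \subset P, cyclic C & #|P : C| = 2].
Proof.
elim: n gT P => [|n IH] gT P Pn tP iP'; first by rewrite leqNgt cardG_gt0 in Pn.
have cP' : (4 * #|P^`(1)|)%N = #|P| by rewrite -iP' mulnC Lagrange // der_sub.
have card2C (C : {group gT}) : C \subset P -> (2 * #|C|)%N = #|P| -> #|P : C| = 2.
  by move=> sCP e; apply/eqP; rewrite -(eqn_pmul2l (cardG_gt0 C)) Lagrange // -e mulnC.
have [P'1|P'n1] := eqVneq P^`(1)%G 1%G.
  have cP : #|P| = 4 by rewrite -cP' -[P^`(1)]/(gval P^`(1)%G) P'1 cards1.
  have [e|[J mJ _]] := maximal_exists (sub1G P); first by rewrite -e cards1 in cP.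
  have [sJ _ iJ cJ] := maximal_2group tP mJ.
  exists J; split=> //; apply: prime_cyclic.
  suff -> : #|J| = 2 by [].
  by apply/eqP; rewrite -(eqn_pmul2l (isT : 0 < 2)) cJ cP.
have [P8|P9] := leqP #|P| 8.
  have P8' : #|P| = 8.
    have [t def_t] := p_natP (pgroupS (der_sub 1 P) tP : 2.-nat #|P^`(1)|).
    apply/eqP; rewrite eqn_leq P8 -cP' -[8]/(4 * 2)%N leq_pmul2l //.
    by rewrite ltnNge -trivg_card_le1.
  have nab : ~~ abelian P by apply: contra P'n1 => /derG1P e; rewrite -val_eqE /= e.
  have [x xP x2] : exists2 x, x \in P & x ^+ 2 != 1.
    apply/exists_inP; apply: contraR nab => /exists_inPn h.
    have sq y : y \in P -> y^-1 = y.
      move=> /h; rewrite negbK => /eqP y2.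
      by apply: (mulIg y); rewrite mulVg -y2 expgS expg1.
    apply/centsP => y yP z zP; rewrite /commute -[z * y]sq ?groupM // invMg.
    by rewrite !sq.
  exists <[x]>%G; rewrite cycle_subG cycle_cyclic; split=> //.
  apply: card2C; rewrite ?cycle_subG //.
  have : #[x] %| 8 by rewrite -P8' order_dvdG.
  have : ~~ (#[x] %| 2) by rewrite order_dvdn.
  have : #[x] != 8.
    apply: contra nab => /eqP o8; have <- : <[x]> = P.
      by apply/eqP; rewrite eqEcard cycle_subG xP P8' -[#|<[x]>|]/#[x] o8.
    exact: cycle_abelian.
  rewrite P8' -[#|<[x]>|]/#[x]; move: #[x] => o o8 o2 od.
  have : o <= 8 by apply: dvdn_leq.
  by move: o8 o2 od; do 9?[case: o => [|o] //].
have P16 : 16 <= #|P|.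
  have [t def_t] := p_natP (tP : 2.-nat #|P|); move: P9; rewrite def_t.
  case: t {def_t} => [|[|[|[|t]]]] // _; rewrite !expnS !mulnA.
  by rewrite -[X in X <= _]muln1 leq_mul // expn_gt0.
have nP' : P^`(1) <| P := der_normal 1 P.
have Zn1 : P^`(1) :&: 'Z(P) != 1.
  by apply: meet_center_nil (pgroup_nil tP) nP' _; rewrite -val_eqE in P'n1.
have tZ : 2.-group (P^`(1) :&: 'Z(P)).
  by apply: pgroupS tP; rewrite subIset // der_sub.
have [_ d2 _] := pgroup_pdiv tZ Zn1.
have [z zD oz] := Cauchy (isT : prime 2) d2.
have /setIP[zP' zZ] := zD; have /setIP[zP zcP] := zZ.
have sZ1 : <[z]> \subset 'Z(P) by rewrite cycle_subG.
have nZ1 : <[z]> <| P by apply: sub_center_normal.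
have cq : (2 * #|P / <[z]>|)%N = #|P|.
  by rewrite -(Lagrange (normal_sub nZ1)) -[#|<[z]>|]/#[z] oz card_quotient // normal_norm.
have [||| Cb [sCb cCb iCb]] := IH _ (P / <[z]>)%G.
- rewrite -ltnS; apply: leq_trans Pn; rewrite -cq -[X in X < _]mul1n ltn_pmul2r //.
- exact: quotient_pgroup.
- rewrite -quotient_der ?normal_norm // index_quotient_eq ?normal_norm ?der_sub //.
  by rewrite subIset // cycle_subG zP' orbT.
case: (inv_quotientS nZ1 sCb) => C defCb sZC sCP.
rewrite defCb in cCb iCb.
have iC : #|P : C| = 2.
  by rewrite -iCb index_quotient_eq ?normal_norm // subIset // sZC orbT.
have cC : (2 * #|C|)%N = #|P| by rewrite -iC mulnC Lagrange.
have zC : z \in C by rewrite -cycle_subG.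
have abC : abelian C.
  apply: cyclic_factor_abelian cCb; rewrite subsetI sZC.
  by rewrite cycle_subG; apply: (subsetP (centS sCP)).
have nCP := index2_normal sCP iC.
have [s sP sC] : exists2 s, s \in P & s \notin C.
  apply/subsetPn/negP => /subset_leq_card; rewrite -cC -[X in _ <= X]mul1n leq_pmul2r //.
have le2 := abelian_index2_cent sCP iC abC sP sC iP'.
exists C; split=> //; apply: contraT => ncC.
have nzC : C \subset 'N(<[z]>) by apply: subset_trans sCP (normal_norm nZ1).
have /cyclicP[xb defx] := cCb.
have : xb \in C / <[z]> by rewrite defx cycle_id.
case/morphimP => c cN cC' def_xb.
have qc : <[c]> / <[z]> = C / <[z]> by rewrite quotient_cycle // -def_xb defx.
have zc : z \notin <[c]>.
  apply: contra ncC => zc; suff -> : C :=: <[c]> by apply: cycle_cyclic.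
  have sc : <[c]> \subset C by rewrite cycle_subG.
  apply/eqP; rewrite eqEsubset sc andbT -(quotientSGK nzC) ?qc //.
  by rewrite cycle_subG.
have sN : s \in 'N(C) by rewrite (subsetP (normal_norm nCP)).
(* The conjugate of c is a power of c up to a power of z, and squaring removes z. *)
have c2s : (c ^+ 2) ^ s \in <[c ^+ 2]>.
  have csC : c ^ s \in C by rewrite memJ_norm.
  have : c ^ s \in <[z]> * <[c]>.
    rewrite -[_ * _]/(_ * gval _) -quotientK ?cycle_subG // mem_morphpre ?(subsetP nzC) //.
    by rewrite qc mem_quotient.
  case/mulsgP => _ _ /cycleP[i ->] /cycleP[j ->] e.
  rewrite conjXg e expgMn; last by apply: (centsP abC); rewrite groupX.
  rewrite -expgM mulnC expgM -oz expg_order expg1n mul1g -expgM mulnC expgM.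
  exact: mem_cycle.
have defP : C * <[s]> = P.
  apply: mulg_normal_maximal nCP _ _ _; rewrite ?cycle_subG //.
  by apply: p_index_maximal => //; rewrite iC.
have nc2 : <[c ^+ 2]> <| P.
  rewrite /normal cycle_subG groupX ?(subsetP sCP) //= -defP mul_subG //.
    by apply: sub_abelian_norm => //; rewrite cycle_subG groupX.
  by rewrite cycle_subG; apply/normP/eqP; rewrite eqEcard cardJg leqnn andbT -cycleJ cycle_subG.
have c2n1 : <[c ^+ 2]> != 1.
  rewrite cycle_eq1; apply/eqP => c21.
  have : #|C / <[z]>| <= 2.
    rewrite -qc quotient_cycle // -[#|_|]/#[_] dvdn_leq // order_dvdn -morphX //.
    by rewrite c21 morph1.
  rewrite leqNgt; case/negP.
  have := Lagrange sZC; rewrite -[#|<[z]>|]/#[z] oz card_quotient // => e.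
  by rewrite -(ltn_pmul2l (isT : 0 < 2)) e -(ltn_pmul2l (isT : 0 < 2)) cC; apply: leq_trans P16.
have := meet_center_nil (pgroup_nil tP) nc2 c2n1.
case/trivgPn => y /setIP[yc /setIP[yP yZ]] yn1.
have sc2 : <[c ^+ 2]> \subset <[c]> by rewrite cycle_subG mem_cycle.
have sub2 : <[z]> \subset 'C_C[s].
  by rewrite cycle_subG inE zC; apply/cent1P; apply: (centP zcP).
have e2 : <[z]> = 'C_C[s].
  by apply/eqP; rewrite eqEcard sub2 -[#|<[z]>|]/#[z] oz.
have : y \in <[z]>.
  rewrite e2 inE; apply/andP; split.
    by apply: subsetP (subset_trans sc2 _) _ yc; rewrite cycle_subG.
  by apply/cent1P; apply: (centP yZ).
have -> : <[z]> = [set 1; z].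
  apply/esym/eqP; rewrite eqEcard -[#|<[z]>|]/#[z] oz cards2.
  by rewrite subUset !sub1set group1 cycle_id eq_sym -order_eq1 oz.
rewrite !inE (negbTE yn1) /= => /eqP yz.
by case/negP: zc; rewrite -yz (subsetP sc2).
Qed.

(** An element u of order 4 in C and an element s outside C generate H: s normalizes <u> but does
    not centralize it, because C_C(s) has at most two elements, and s^2 lies in C_C(s), hence in
    <u>. *)
Lemma nonabelian_order8_sub (gT : finGroupType) (P C : {group gT}) : 2.-group P -> 8 <= #|P| ->
  #|P : P^`(1)| = 4 -> C \subset P -> cyclic C -> #|P : C| = 2 ->
  exists H : {group gT}, [/\ H \subset P, #|H| = 8 & ~~ abelian H].
Proof.
move=> tP P8 iP' sCP cC iC.
have cP : (2 * #|C|)%N = #|P| by rewrite -iC mulnC Lagrange.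
have C4 : 4 <= #|C| by rewrite -(leq_pmul2l (isT : 0 < 2)) cP.
have tC := pgroupS sCP tP.
have [s sP sC] : exists2 s, s \in P & s \notin C.
  by apply/subsetPn/negP => /subset_leq_card; rewrite -cP -[X in _ <= X]mul1n leq_pmul2r.
have le2 := abelian_index2_cent sCP iC (cyclic_abelian cC) sP sC iP'.
have nCP := index2_normal sCP iC.
have /cyclicP[c defC] := cC.
have dC4 : 4 %| #|C|.
  have [t def_c] := p_natP tC; move: C4; rewrite def_c.
  by case: t {def_c} => [|[|t]] // _; rewrite !expnS mulnA (dvdn_mulr _ (dvdnn 4)).
pose u := c ^+ (#|C| %/ 4).
have ou : #[u] = 4.
  by rewrite orderXdiv /order -defC ?dvdn_div // divnA ?mulKn.
have uC : u \in C by rewrite defC mem_cycle.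
have sUC : <[u]> \subset C by rewrite cycle_subG.
have sN : s \in 'N(<[u]>).
  have : <[u]> \char C by rewrite defC cycle_subgroup_char // -defC.
  by move=> /char_normal_trans/(_ nCP)/normal_norm/subsetP; apply.
have uU : u \in <[u]> := cycle_id u.
have nus : u ^ s != u.
  apply/negP => /eqP/conjg_fixP/commgP us.
  have : <[u]> \subset 'C_C[s] by rewrite cycle_subG inE uC; apply/cent1P.
  by move=> /subset_leq_card /leq_trans /(_ le2); rewrite -[#|<[u]>|]/#[u] ou.
have s2U : s ^+ 2 \in <[u]>.
  have s2C : s ^+ 2 \in 'C_C[s].
    rewrite inE (sqr_in_index2 nCP iC sP); by apply/cent1P/commute_sym/commuteX.
  have : <[s ^+ 2]> \subset <[u]>.
    rewrite -(cardSg_cyclic cC) ?cycle_subG //; last by case/setIP: s2C.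
    have : #[s ^+ 2] <= 2.
      by apply: leq_trans le2; rewrite subset_leq_card // cycle_subG.
    rewrite -[#|<[u]>|]/#[u] ou -[#|<[s ^+ 2]>|]/#[s ^+ 2].
    by have := order_gt0 (s ^+ 2); case: #[_] => [|[|[|]]].
  by rewrite cycle_subG.
pose H := (<[u]> <*> <[s]>)%G.
have nUH : <[u]> <| H.
  by rewrite /normal joing_subl join_subG normG cycle_subG.
have sHP : H \subset P by rewrite join_subG !cycle_subG (subsetP sCP).
have cosN : s \in 'N(<[u]>) by [].
have oH : #|H / <[u]>| = 2.
  rewrite quotientYidl ?cycle_subG // quotient_cycle // -[#|_|]/#[_].
  have : #[coset <[u]> s] %| 2 by rewrite order_dvdn -morphX //; apply/eqP; apply: coset_id.
  have : #[coset <[u]> s] != 1%N.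
    rewrite order_eq1; apply: contra sC => /eqP e; have := coset_idr sN e.
    exact: (subsetP sUC).
  by case: #[_] => [|[|[|n]]] // _ /dvdn_leq; case.
exists H; split=> //.
  have := Lagrange (normal_sub nUH); rewrite -card_quotient ?normal_norm // oH => <-.
  by rewrite -[#|<[u]>|]/#[u] ou.
apply: contra nus => /centsP cH.
apply/eqP/conjg_fixP/commgP; apply: cH.
  by rewrite (subsetP (normal_sub nUH)).
by rewrite mem_gen // inE cycle_id orbT.
Qed.

(** If P is not cyclic, v has order 4. For u outside <v>, u^2 is an even power v^i, since otherwise
    u would have order 8; then u v^(-i/2) is an involution w outside <v>, and P/<w> is generated by
    the image of v. *)
Lemma abelian8_cyclic4_quotient (gT : finGroupType) (P : {group gT}) : abelian P -> #|P| = 8 ->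
  (exists2 v, v \in P & v ^+ 2 != 1) ->
  exists N : {group gT}, [/\ N <| P, cyclic (P / N) & 4 %| #|P / N|].
Proof.
move=> abP P8 [v vP v2].
have [cP|ncP] := boolP (cyclic P).
  exists 1%G; rewrite normal1 quotient_cyclic //; split=> //.
  by rewrite -(card_isog (quotient1_isog P)) P8.
have ord x : x \in P -> #[x] != 8.
  move=> xP; apply: contra ncP => /eqP o8; have <- : <[x]> = P.
    by apply/eqP; rewrite eqEcard cycle_subG xP P8 -[#|<[x]>|]/#[x] o8.
  exact: cycle_cyclic.
have ord8 x : x \in P -> #[x] %| 8 by move=> xP; rewrite -P8 order_dvdG.
have ov : #[v] = 4.
  have : ~~ (#[v] %| 2) by rewrite order_dvdn.
  move: (ord v vP) (ord8 v vP); move: #[v] => o o8 od o2.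
  have : o <= 8 by apply: dvdn_leq.
  by move: o8 o2 od; do 9?[case: o => [|o] //].
have sV : <[v]> \subset P by rewrite cycle_subG.
have iV : #|P : <[v]>| = 2.
  by apply/eqP; rewrite -(eqn_pmul2l (cardG_gt0 <[v]>)) Lagrange // P8 -[#|<[v]>|]/#[v] ov.
have nV := index2_normal sV iV.
have [u uP uV] : exists2 u, u \in P & u \notin <[v]>.
  by apply/subsetPn/negP => /subset_leq_card; rewrite P8 -[#|<[v]>|]/#[v] ov.
have com x y : x \in P -> y \in P -> commute x y by move=> xP yP; apply: (centsP abP).
have /cycleP[i u2] := sqr_in_index2 nV iV uP.
have ei : ~~ odd i.
  apply/negP => oi; have := ord u uP; apply/negP; rewrite negbK.
  have o2 : #[u ^+ 2] = 4.
    have : coprime #[v] i by rewrite ov -[4]/(2 ^ 2)%N coprime_pexpl // coprime2n.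
    by rewrite u2 => co; rewrite orderXgcd (eqP co) divn1.
  have := ord8 u uP; have := order_gt0 u.
  have : #[u ^+ 2] = #[u] %/ gcdn #[u] 2 by rewrite orderXgcd.
  rewrite o2; move: #[u] => o eo o0 od; have : o <= 8 by apply: dvdn_leq.
  by move: eo o0 od; do 9?[case: o => [|o] //].
pose w := u * v ^- i./2.
have wP : w \in P by rewrite groupM ?groupV ?groupX.
have w2 : w ^+ 2 = 1.
  rewrite expgMn; last by apply: com; rewrite ?groupV ?groupX.
  rewrite u2 expgVn -expgM muln2 -[in v ^+ i](odd_double_half i) (negbTE ei).
  by rewrite add0n mulgV.
have wV : w \notin <[v]>.
  by apply: contra uV; rewrite groupMr // groupV mem_cycle.
have nW : <[w]> <| P by rewrite -sub_abelian_normal ?cycle_subG.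
have wn1 : w != 1 by apply: contraNneq wV => ->; apply: group1.
have ow : #[w] = 2.
  have : #[w] %| 2 by rewrite order_dvdn w2.
  by move: wn1; rewrite -order_eq1; case: #[w] => [|[|[|n]]] // _ /dvdn_leq; case.
have cq : #|P / <[w]>| = 4.
  rewrite card_quotient ?normal_norm //; apply/eqP.
  rewrite -(eqn_pmul2l (cardG_gt0 <[w]>)) Lagrange ?cycle_subG // P8.
  by rewrite -[#|<[w]>|]/#[w] ow.
exists <[w]>%G; rewrite nW cq; split=> //.
have vN : v \in 'N(<[w]>) by rewrite (subsetP (normal_norm nW)).
suff -> : P / <[w]> = <[coset <[w]> v]> by apply: cycle_cyclic.
apply/esym/eqP; rewrite eqEcard cycle_subG mem_quotient //= cq -[#|<[_]>|]/#[_].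
have : ~~ (#[coset <[w]> v] %| 2).
  rewrite order_dvdn -morphX //; apply/eqP => /coset_idr.
  rewrite groupX // => /(_ isT); apply/negP.
  suff : v ^+ 2 \notin <[w]> by [].
  have -> : <[w]> = [set 1; w].
    apply/esym/eqP; rewrite eqEcard -[#|<[w]>|]/#[w] ow cards2.
    by rewrite subUset !sub1set group1 cycle_id eq_sym wn1.
  rewrite !inE negb_or v2; apply: contraNneq wV => <-; exact: mem_cycle.
have := order_gt0 (coset <[w]> v).
have : #[coset <[w]> v] %| 4.
  by rewrite -cq order_dvdG // mem_quotient.
by case: #[_] => [|[|[|[|n]]]].
Qed.

(** A subgroup N of index two in Phi(P) containing P' makes P/N abelian of order 8 and not
    elementary, since otherwise Phi(P) would lie in N. *)
Lemma cyclic4_quotient (gT : finGroupType) (P : {group gT}) : 2.-group P -> #|P : 'Phi(P)| = 4 ->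
  8 <= #|P : P^`(1)| ->
  exists N : {group gT}, [/\ N <| P, cyclic (P / N) & 4 %| #|P / N|].
Proof.
move=> tP iPhi iP'.
have sP'Phi : P^`(1) \subset 'Phi(P).
  by rewrite (Phi_joing tP) joing_subl.
have [e|[N mN sN]] := maximal_exists sP'Phi.
  have e' : #|P : P^`(1)| = #|P : 'Phi(P)| by rewrite -[in RHS]e.
  by rewrite e' iPhi in iP'.
have sPhi : 'Phi(P) \subset P := Phi_sub P.
have tPhi := pgroupS sPhi tP.
have [sNPhi _ iN _] := maximal_2group tPhi mN.
have sNP := subset_trans sNPhi sPhi.
have nNP : N <| P by apply: sub_der1_normal.
have abQ : abelian (P / N) by apply: sub_der1_abelian.
have cQ : #|P / N| = 8.
  by rewrite card_quotient ?normal_norm // -(Lagrange_index sPhi sNPhi) iPhi iN.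
have [v vQ v2] : exists2 v, v \in P / N & v ^+ 2 != 1.
  apply/exists_inP; apply: contraT => /exists_inPn h.
  have : 'Phi(P) \subset N.
    apply: (Phi_min tP) (normal_norm nNP) _.
    rewrite abelemE // abQ; apply/exponentP => x xQ.
    by have := h x xQ; rewrite negbK => /eqP.
  by rewrite -indexg_eq1 iN.
have [Nb [nNb cNb dNb]] := abelian8_cyclic4_quotient abQ cQ (ex_intro2 _ _ v vQ v2).
pose M := (coset N @*^-1 Nb)%G.
have qM : M / N = Nb by rewrite cosetpreK.
have nM : M <| P.
  have -> : P :=: coset N @*^-1 (P / N) by rewrite quotientGK.
  by rewrite cosetpre_normal.
have sNM : N \subset M by rewrite sub_cosetpre.
have is_o := third_isog sNM nNP nM; rewrite qM in is_o.
by exists M; rewrite nM -(isog_cyclic is_o) -(card_isog is_o).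
Qed.

End TwoGroupQuotients.

(** * Degree two cohomology classes vanishing on proper subgroups *)

Section Stable.

Variables (gT : finGroupType) (P : {group gT}).
Implicit Types (x y l : gT -> bool) (X Y D : gT -> bool) (g c v p q : gT).
Implicit Types (k : gT -> gT -> bool) (f : gT -> gT -> gT -> bool).
Local Open Scope group_scope.

(* Z/2 is bool with (+), and cochains on P are represented by homogeneous,
   P-invariant functions on G. *)
Definition char_on x := {in P &, forall p q, x (p * q) = x p (+) x q}.

(** [X] is a 0-cochain on G whose coboundary, the P-invariant 1-cocycle [X v0 (+) X v1], represents
    the character [x]. *)
Definition eqvar x X := forall p v, p \in P -> X (p * v) = x p (+) X v.

Definition pinv1 k := forall p v0 v1, p \in P -> k (p * v0) (p * v1) = k v0 v1.

Definition d1 k v0 v1 v2 := k v1 v2 (+) k v0 v2 (+) k v0 v1.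

Definition cup2 X Y v0 v1 v2 := (X v0 (+) X v1) && (Y v1 (+) Y v2).

Definition cohom f f' := exists2 k, pinv1 k
  & forall v0 v1 v2, f v0 v1 v2 = f' v0 v1 v2 (+) d1 k v0 v1 v2.

Lemma cohom_refl f : cohom f f.
Proof. by exists (fun _ _ => false) => // v0 v1 v2; rewrite /d1 /= addbF. Qed.

Lemma cohom_sym f f' : cohom f f' -> cohom f' f.
Proof. by move=> [k kP fk]; exists k => // v0 v1 v2; rewrite fk addbK. Qed.

Lemma cohom_add f f' e e' : cohom f f' -> cohom e e' ->
  cohom (fun a b c => f a b c (+) e a b c) (fun a b c => f' a b c (+) e' a b c).
Proof.
move=> [k kP fk] [m mP em]; exists (fun a b => k a b (+) m a b).
  by move=> p v0 v1 pP; rewrite kP ?mP.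
move=> v0 v1 v2; rewrite fk em /d1.
by case: (f' _ _ _); case: (e' _ _ _); case: (k v1 v2); case: (k v0 v2); case: (k v0 v1);
   case: (m v1 v2); case: (m v0 v2); case: (m v0 v1).
Qed.

Lemma cohom_trans f' f f'' : cohom f f' -> cohom f' f'' -> cohom f f''.
Proof.
move=> [k kP fk] [m mP em]; exists (fun a b => k a b (+) m a b).
  by move=> p v0 v1 pP; rewrite kP ?mP.
move=> v0 v1 v2; rewrite fk em /d1.
by case: (f'' _ _ _); case: (k v1 v2); case: (k v0 v2); case: (k v0 v1);
   case: (m v1 v2); case: (m v0 v2); case: (m v0 v1).
Qed.

Lemma cohom_ext f f' : (forall a b c, f a b c = f' a b c) -> cohom f f'.
Proof. by move=> e; exists (fun _ _ => false) => // v0 v1 v2; rewrite e /d1 /= addbF. Qed.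

Definition f0 (v0 v1 v2 : gT) := false.

Lemma eqvar_diff x X p v0 v1 : eqvar x X -> p \in P ->
  X (p * v0) (+) X (p * v1) = X v0 (+) X v1.
Proof.
by move=> xX pP; rewrite !xX //; case: (x p); case: (X v0); case: (X v1).
Qed.

(** The primitive is the cup-1 product of the two 1-cocycles. *)
Lemma cup2C x y X Y : eqvar x X -> eqvar y Y -> cohom (cup2 X Y) (cup2 Y X).
Proof.
move=> xX yY; exists (fun a b => (X a (+) X b) && (Y a (+) Y b)).
  by move=> p v0 v1 pP; rewrite (eqvar_diff _ _ xX) // (eqvar_diff _ _ yY).
move=> v0 v1 v2; rewrite /cup2 /d1; case: (X v0); case: (X v1); case: (X v2);
by case: (Y v0); case: (Y v1); case: (Y v2).
Qed.

(** [X] and [X'] differ by a P-invariant function, whose cup product with the cocycle of [Y] is the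
    primitive. *)
Lemma cup2_same x y X X' Y : eqvar x X -> eqvar x X' -> eqvar y Y ->
  cohom (cup2 X Y) (cup2 X' Y).
Proof.
move=> xX xX' yY; exists (fun a b => (X a (+) X' a) && (Y a (+) Y b)).
  move=> p v0 v1 pP; rewrite (eqvar_diff _ _ yY) // xX // xX' //.
  by case: (x p); case: (X v0); case: (X' v0).
move=> v0 v1 v2; rewrite /cup2 /d1; case: (X v0); case: (X v1); case: (X v2);
by case: (X' v0); case: (X' v1); case: (X' v2); case: (Y v0); case: (Y v1); case: (Y v2).
Qed.

Lemma cup2_samer x y X Y Y' : eqvar x X -> eqvar y Y -> eqvar y Y' ->
  cohom (cup2 X Y) (cup2 X Y').
Proof.
move=> xX yY yY'; apply: cohom_trans (cup2C xX yY) _.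
by apply: cohom_trans (cup2_same yY yY' xX) _; apply: cup2C yY' xX.
Qed.

Lemma eqvar_add x y X Y : eqvar x X -> eqvar y Y ->
  eqvar (fun p => x p (+) y p) (fun v => X v (+) Y v).
Proof. by move=> xX yY p v pP; rewrite xX ?yY //; case: (x p); case: (y p); case: (X v); case: (Y v). Qed.

Lemma memJVn c p : c \in 'N(P) -> p \in P -> p ^ c^-1 \in P.
Proof. by move=> cN pP; rewrite memJ_norm // groupV. Qed.

Definition shift c f v0 v1 v2 := f (c * v0) (c * v1) (c * v2).

Lemma cohom_shift c f f' : c \in 'N(P) -> cohom f f' ->
  cohom (shift c f) (shift c f').
Proof.
move=> cN [k kP fk]; exists (fun a b => k (c * a) (c * b)).
  move=> p v0 v1 pP; have e v : c * (p * v) = (p ^ c^-1) * (c * v).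
    by rewrite conjgE invgK !mulgA mulgKV.
  by rewrite !e (kP _ _ _ (memJVn cN pP)).
by move=> v0 v1 v2; rewrite /shift fk.
Qed.

Lemma eqvar_shift c x X : c \in 'N(P) -> eqvar x X ->
  eqvar (fun p => x (p ^ c^-1)) (fun v => X (c * v)).
Proof.
move=> cN xX p v pP; have -> : c * (p * v) = (p ^ c^-1) * (c * v).
  by rewrite conjgE invgK !mulgA mulgKV.
by rewrite (xX _ _ (memJVn cN pP)).
Qed.

Lemma char_shift c x : c \in 'N(P) -> char_on x -> char_on (fun p => x (p ^ c^-1)).
Proof.
by move=> cN xP p q pP qP; rewrite conjMg xP // memJ_norm // groupV.
Qed.

Variables (x y : gT -> bool) (h : gT -> bool).
Hypotheses (xP : char_on x) (yP : char_on y).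
(** [h] is a primitive on P of the cup square of [x]; a lift of [x] to Z/4 provides one. *)
Hypothesis hP : {in P &, forall p q, h p (+) h q (+) h (p * q) = x p && x q}.
Hypothesis H1 : forall l, char_on l ->
  exists a b, {in P, forall p, l p = a && x p (+) b && y p}.
Hypothesis indep : forall a b, {in P, forall p, a && x p (+) b && y p = false} ->
  a = false /\ b = false.

(* A P-equivariant retraction of G onto P, which extends characters of P to G. *)
Definition retr g := g * (fingroup.repr (P :* g))^-1.

Lemma retrM p g : p \in P -> retr (p * g) = p * retr g.
Proof.
move=> pP; rewrite /retr mulgA; suff -> : P :* (p * g) = P :* g by [].
by rewrite rcosetM (rcoset_id pP).
Qed.

Lemma retrP g : retr g \in P.
Proof.
have := mem_repr_rcoset P g; rewrite mem_rcoset => /groupVr.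
by rewrite invMg invgK.
Qed.

Let X v := x (retr v).
Let Y v := y (retr v).

Let xX : eqvar x X. Proof. by move=> p v pP; rewrite /X retrM // xP ?retrP. Qed.
Let yY : eqvar y Y. Proof. by move=> p v pP; rewrite /Y retrM // yP ?retrP. Qed.

Lemma char1 l : char_on l -> l 1 = false.
Proof. by move=> lP; have := lP 1 1 (group1 P) (group1 P); rewrite mulg1 addbb. Qed.

Lemma charV l p : char_on l -> p \in P -> l p^-1 = l p.
Proof.
move=> lP pP; have := lP p p^-1 pP (groupVr pP); rewrite mulgV char1 //.
by case: (l p); case: (l _).
Qed.

Definition kx v0 v1 := h ((retr v0)^-1 * retr v1).

Lemma kx_inv : pinv1 kx.
Proof. by move=> p v0 v1 pP; rewrite /kx !retrM // invMg -mulgA mulKg. Qed.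

Lemma kxE v0 v1 v2 : cup2 X X v0 v1 v2 = d1 kx v0 v1 v2.
Proof.
have e a b : retr a \in P -> retr b \in P -> x ((retr a)^-1 * retr b) = X a (+) X b.
  by move=> aP bP; rewrite xP ?groupV // charV.
have := hP (groupM (groupVr (retrP v0)) (retrP v1)) (groupM (groupVr (retrP v1)) (retrP v2)).
rewrite -mulgA mulKVg !e ?retrP // /cup2 /d1 /kx => <-.
by case: (h _); case: (h _); case: (h _).
Qed.

Lemma cup2XX : cohom (cup2 X X) f0.
Proof. by exists kx => [|v0 v1 v2]; [exact: kx_inv | rewrite kxE]. Qed.

Lemma eqvar_ext l l' Z : {in P, l =1 l'} -> eqvar l Z -> eqvar l' Z.
Proof. by move=> ll lZ p v pP; rewrite lZ // ll. Qed.

(** Conjugation by c acts on the characters by an invertible matrix: x becomes a x + b y and y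
    becomes d x + e y. In the expansion of the product x u x = 0, and if b = 1 the vanishing of the
    conjugate of x u x gives y u y = 0. The remaining coefficient a e + b d of x u y is the
    determinant, equal to 1. *)
Lemma shift_cup2 c : c \in 'N(P) -> cohom (shift c (cup2 X Y)) (cup2 X Y).
Proof.
move=> cN.
pose X' v := X (c * v); pose Y' v := Y (c * v).
have eX := eqvar_shift cN xX; have eY := eqvar_shift cN yY.
have X'0 : cohom (cup2 X' X') f0 by apply: cohom_shift cN cup2XX.
have [a [b xab]] := H1 (char_shift cN xP).
have [d [e yde]] := H1 (char_shift cN yP).
pose XX v := a && X v (+) b && Y v; pose YY v := d && X v (+) e && Y v.
have scal t l Z : eqvar l Z -> eqvar (fun p => t && l p) (fun v => t && Z v).
  by case: t => // lZ p v.
have eXX : eqvar (fun p => x (p ^ c^-1)) XX.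
  apply: eqvar_ext (eqvar_add (scal a _ _ xX) (scal b _ _ yY)).
  by move=> p pP; rewrite xab.
have eYY : eqvar (fun p => y (p ^ c^-1)) YY.
  apply: eqvar_ext (eqvar_add (scal d _ _ xX) (scal e _ _ yY)).
  by move=> p pP; rewrite yde.
have XX0 : cohom (cup2 XX XX) f0.
  apply: cohom_trans X'0; apply: cohom_trans (cup2_same eXX eX eXX) _.
  exact: (cup2_samer eX eXX eX).
apply: (cohom_trans (cup2_same eX eXX eY)).
apply: (cohom_trans (cup2_samer eXX eY eYY)).
have conj p : p \in P -> p ^ c \in P by move=> pP; rewrite memJ_norm.
(* Over F_2, two distinct nonzero rows have determinant 1. *)
have ad : ~~ [&& a == d & b == e].
  apply/negP => /andP[/eqP ad /eqP be].
  have [] := indep (a := true) (b := true).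
    move=> p pP; have := xab _ (conj p pP); have := yde _ (conj p pP).
    by rewrite conjgK ad be => -> ->; rewrite /= addbb.
  by [].
have ab : a || b.
  apply: contraT => /ssrbool.norP[a0 b0]; have [] := indep (a := true) (b := false) => // p pP.
  by have := xab _ (conj p pP); rewrite conjgK (negbTE a0) (negbTE b0) /= addbF.
have de : d || e.
  apply: contraT => /ssrbool.norP[a0 b0]; have [] := indep (a := false) (b := true) => // p pP.
  by have := yde _ (conj p pP); rewrite conjgK (negbTE a0) (negbTE b0) /=.
pose S : gT -> gT -> gT -> bool := fun u v w =>
  (a && d && cup2 X X u v w (+) b && e && cup2 Y Y u v w)
  (+) (a && e && cup2 X Y u v w (+) b && d && cup2 Y X u v w).
have S1 : cohom (cup2 XX YY) S.
  apply: cohom_ext => u v w; rewrite /S /cup2 /XX /YY.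
  by case: (a); case: (b); case: (d); case: (e); case: (X u); case: (X v); case: (X w);
     case: (Y u); case: (Y v); case: (Y w).
apply: cohom_trans S1 _.
have YX := cup2C yY xX.
have YY0 : b -> cohom (cup2 Y Y) f0.
  move=> b1; pose T : gT -> gT -> gT -> bool := fun u v w =>
    (a && cup2 X X u v w (+) cup2 Y Y u v w)
    (+) (a && cup2 X Y u v w (+) a && cup2 Y X u v w).
  have : cohom T f0.
    apply: cohom_trans XX0; apply: cohom_ext => u v w; rewrite /T /cup2 /XX b1.
    by case: (a); case: (X u); case: (X v); case: (X w); case: (Y u); case: (Y v); case: (Y w).
  move=> T0; pose R : gT -> gT -> gT -> bool := fun u v w =>
    T u v w (+) (a && cup2 X X u v w (+) (a && cup2 X Y u v w (+) a && cup2 Y X u v w)).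
  apply: (@cohom_trans R).
    apply: cohom_ext => u v w; rewrite /R /T.
    by case: (a); case: (cup2 X X _ _ _); case: (cup2 X Y _ _ _); case: (cup2 Y X _ _ _); case: (cup2 Y Y _ _ _).
  apply: (@cohom_trans (fun u v w => f0 u v w (+)
    (f0 u v w (+) (a && cup2 X Y u v w (+) a && cup2 X Y u v w)))).
    apply: cohom_add T0 _; apply: cohom_add.
      by case: (a) => //=; [exact: cup2XX | exact: cohom_refl].
    apply: cohom_add; first exact: cohom_refl.
    by case: (a) => //=; exact: cohom_refl.
  by apply: cohom_ext => u v w; rewrite addbb.
apply: (@cohom_trans (fun u v w =>
   (a && d && f0 u v w (+) b && e && f0 u v w)
  (+) (a && e && cup2 X Y u v w (+) b && d && cup2 X Y u v w))).
  apply: cohom_add; apply: cohom_add.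
  - by case: (a && d) => //=; [exact: cup2XX | exact: cohom_refl].
  - case: (boolP b) => b0 /=; last exact: cohom_refl.
    by case: (e) => /=; [exact: YY0 | exact: cohom_refl].
  - exact: cohom_refl.
  - by case: (b && d) => //=; exact: cohom_refl.
apply: cohom_ext => u v w; move: ad ab de.
by case: (a); case: (b); case: (d); case: (e) => //=;
   rewrite /f0 /=; case: (cup2 _ _ _ _ _).
Qed.

Hypothesis tP : 2.-group P.

Lemma index2_char (M : {group gT}) : M <| P -> #|P : M| = 2%N ->
  char_on (fun p => p \notin M).
Proof.
move=> nMP iM p q pP qP.
have [pM|pM] := boolP (p \in M); first by rewrite groupMl.
have [qM|qM] := boolP (q \in M); first by rewrite groupMr ?(negbTE pM).
apply/negbTE; rewrite negbK.
have [pN qN] : p \in 'N(M) /\ q \in 'N(M) by rewrite !(subsetP (normal_norm nMP)).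
have cq : #|P / M| = 2%N by rewrite card_quotient ?normal_norm.
have pn1 : coset M p != 1 by apply: contra pM => /eqP/(coset_idr pN).
have qn1 : coset M q != 1 by apply: contra qM => /eqP/(coset_idr qN).
have defQ : P / M = [set 1; coset M p].
  apply/esym/eqP; rewrite eqEcard cq cards2 eq_sym pn1 andbT.
  by rewrite subUset !sub1set group1 mem_quotient.
have : coset M q \in P / M by rewrite mem_quotient.
rewrite defQ !inE (negbTE qn1) /= => /eqP qp.
apply: coset_idr; first exact: groupM.
rewrite morphM //= qp; have := expg_cardG (mem_quotient M pP).
by rewrite cq expgS expg1.
Qed.

(** A maximal subgroup above M is the kernel of a character, which by [H1] is a nonzero combination
    of [x] and [y]. *)
Lemma proper_char (M : {group gT}) : M \proper P ->
  exists a b, (a || b) /\ {in M, forall p, a && x p (+) b && y p = false}.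
Proof.
move=> prM; have [e|[M' mM' sM]] := maximal_exists (proper_sub prM).
  by rewrite e properxx in prM.
have [sM'P nM' iM' _] := maximal_2group tP mM'.
have [a [b lab]] := H1 (index2_char nM' iM').
exists a, b; split; last first.
  by move=> p pM; rewrite -lab ?(subsetP sM'P) ?(subsetP sM) // (subsetP sM).
have [p pP pM] : exists2 p, p \in P & p \notin M'.
  by apply/subsetPn; have /maxgroupp/andP[] := mM'.
by have := lab p pP; rewrite pM; case: a {lab}; case: b.
Qed.

(** A primitive of x u y, invariant under the elements of P on which a x + b y vanishes. The three
    cases are x = 0, y = 0 and x = y; in the last one x u y equals x u x there, whence the term
    [kx]. *)
Definition eta (a b : bool) v0 v1 :=
  if ~~ b then X v0 && (Y v0 (+) Y v1)
  else if ~~ a then (X v0 (+) X v1) && Y v1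
  else kx v0 v1 (+) (X v0 (+) X v1) && (X v1 (+) Y v1).

Lemma etaE a b v0 v1 v2 : a || b -> d1 (eta a b) v0 v1 v2 = cup2 X Y v0 v1 v2.
Proof.
case: b => [_|].
  case: a; last by rewrite /d1 /eta /cup2 /=; case: (X v0); case: (X v1); case: (X v2);
    case: (Y v1); case: (Y v2).
  have := kxE v0 v1 v2; rewrite /d1 /eta /cup2 /=.
  by case: (kx v1 v2); case: (kx v0 v2); case: (kx v0 v1); case: (X v0); case: (X v1); case: (X v2);
     case: (Y v1); case: (Y v2).
case: a => // _; rewrite /d1 /eta /cup2 /=; case: (X v0); case: (X v1);
by case: (Y v0); case: (Y v1); case: (Y v2).
Qed.

Lemma eta_inv a b p v0 v1 : a || b -> p \in P -> a && x p (+) b && y p = false ->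
  eta a b (p * v0) (p * v1) = eta a b v0 v1.
Proof.
move=> ab pP; rewrite /eta kx_inv // !xX // !yY //.
by case: b ab => /=; case: a => //= _; case: (x p); case: (y p) => //= _;
   case: (X v0); case: (X v1); case: (Y v0); case: (Y v1).
Qed.

Let S := rcosets P [set: gT].
Hypothesis oddS : odd #|S|.

Lemma mem_S C : C \in S -> C = P :* fingroup.repr C.
Proof.
by case/rcosetsP => g _ ->; rewrite rcoset_repr.
Qed.

Lemma rcoset_S C g : C \in S -> C :* g \in S.
Proof.
case/rcosetsP => c _ ->; rewrite -rcosetM; apply/rcosetsP.
by exists (c * g); rewrite ?inE.
Qed.

Lemma repr_S C c (phi : gT -> bool) : (forall p v, p \in P -> phi (p * v) = phi v) ->
  C \in S -> c \in C -> phi (fingroup.repr C) = phi c.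
Proof.
move=> phiP CS; rewrite {1}(mem_S CS) => /rcosetP[p pP ->].
by rewrite phiP.
Qed.

Lemma transfer_inv (phi : gT -> bool) g :
  (forall p v, p \in P -> phi (p * v) = phi v) ->
  \big[addb/false]_(C in S) phi (fingroup.repr C * g)
  = \big[addb/false]_(C in S) phi (fingroup.repr C).
Proof.
move=> phiP; rewrite [RHS](reindex_inj (@rcoset_inj _ g)) /=.
apply: eq_big => [C|C CS].
  apply/idP/idP => [|/(rcoset_S g^-1)]; first exact: rcoset_S.
  by rewrite -rcosetM mulgV rcoset1.
apply/esym/(repr_S phiP (rcoset_S g CS)).
by rewrite mem_rcoset mulgK {2}(mem_S CS) rcoset_refl.
Qed.

(** Corestriction from P to G at the level of cochains; for P-invariant [f] the choice of coset
    representatives does not matter. *)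
Definition transfer f v0 v1 v2 := \big[addb/false]_(C in S)
  f (fingroup.repr C * v0) (fingroup.repr C * v1) (fingroup.repr C * v2).

Let F := transfer (cup2 X Y).

Lemma cup2_inv p v0 v1 v2 : p \in P ->
  cup2 X Y (p * v0) (p * v1) (p * v2) = cup2 X Y v0 v1 v2.
Proof. by move=> pP; rewrite /cup2 (eqvar_diff _ _ xX) // (eqvar_diff _ _ yY). Qed.

Lemma F_inv g v0 v1 v2 : F (g * v0) (g * v1) (g * v2) = F v0 v1 v2.
Proof.
have := @transfer_inv (fun c => cup2 X Y (c * v0) (c * v1) (c * v2)) g.
rewrite /F /transfer => /= <-; first by apply: eq_bigr => C _; rewrite !mulgA.
by move=> p v pP /=; rewrite -!mulgA; apply: cup2_inv.
Qed.

Lemma cohom_sum (I : finType) (A : {set I}) (u u' : I -> gT -> gT -> gT -> bool) :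
  (forall i, i \in A -> cohom (u i) (u' i)) ->
  cohom (fun a b c => \big[addb/false]_(i in A) u i a b c)
        (fun a b c => \big[addb/false]_(i in A) u' i a b c).
Proof.
move=> uu.
pose s := enum A; have sA i : i \in s -> i \in A by rewrite mem_enum.
have {uu}: forall i, i \in s -> cohom (u i) (u' i) by move=> i /sA; apply: uu.
have e (z : I -> gT -> gT -> gT -> bool) (a b c : gT) :
  \big[addb/false]_(i in A) z i a b c = \big[addb/false]_(i <- s) z i a b c.
  by rewrite big_enum.
move=> uu; apply: cohom_trans (cohom_ext (e u)) _.
apply: cohom_trans (cohom_sym (cohom_ext (e u'))).
elim: s uu {e sA} => [|i s IH] uu.
  by apply: cohom_ext => a b c; rewrite !big_nil.
apply: (@cohom_trans (fun a b c => u i a b c (+) \big[addb/false]_(j <- s) u j a b c)).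
  by apply: cohom_ext => a b c; rewrite big_cons.
apply: (@cohom_trans (fun a b c => u' i a b c (+) \big[addb/false]_(j <- s) u' j a b c)).
  apply: cohom_add; first by apply: uu; rewrite mem_head.
  by apply: IH => j js; apply: uu; rewrite in_cons js orbT.
by apply: cohom_ext => a b c; rewrite big_cons.
Qed.

(** An orbit of P on its right cosets is a double coset P c P, and the sum over it is one term of
    the double coset formula. If c normalizes P, the orbit is a single coset and the term is a
    conjugate of x u y, which is stable. Otherwise the orbit has even size and the term is a
    transfer from the proper subgroup M of P, on which [eta] is a primitive. *)
Lemma orbit_transfer C0 : C0 \in S ->
  cohom (fun v0 v1 v2 => \big[addb/false]_(C in orbit 'Rs P C0)
           cup2 X Y (fingroup.repr C * v0) (fingroup.repr C * v1) (fingroup.repr C * v2))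
        (fun v0 v1 v2 => odd #|orbit 'Rs P C0| && cup2 X Y v0 v1 v2).
Proof.
move=> C0S; pose c := fingroup.repr C0; pose O := orbit 'Rs P C0.
have defC0 : C0 = P :* c := mem_S C0S.
pose Q := 'C_P[C0 | 'Rs]%G.
have QE p : (p \in Q) = (p \in P) && (C0 :* p == C0).
  rewrite in_setI -rcosetE; congr (_ && _).
  by apply/idP/eqP; [move/astab1P | move=> e; apply/astab1P].
have sQP : Q \subset P by apply: subsetIl.
have cO : #|O| = #|P : Q| by apply: card_orbit.
pose M := (Q :^ c^-1)%G.
have sMP : M \subset P.
  apply/subsetP => _ /imsetP[q + ->]; rewrite QE => /andP[_ /eqP e].
  have : c * q \in C0 by rewrite -e mem_rcoset mulgK defC0 rcoset_refl.
  by rewrite defC0 mem_rcoset conjgE invgK mulgA.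
have OS C : C \in O -> C \in S by case/orbitP => p _ <-; rewrite /= rcosetE; apply: rcoset_S.
have [eMP|neMP] := eqVneq (M : {set gT}) P.
  have eQ : Q :=: P.
    by apply/eqP; rewrite eqEcard sQP -eMP /= cardJg.
  have cN : c \in 'N(P).
    rewrite -groupV; apply/normP; rewrite -[in RHS]eMP /=; congr (_ :^ _); exact/esym.
  have O1 : O = [set C0].
    apply/eqP; rewrite eq_sym eqEcard sub1set orbit_refl cards1 cO eQ indexgg //.
  rewrite -/O O1 cards1; apply: cohom_trans (shift_cup2 cN).
  by apply: cohom_ext => v0 v1 v2; rewrite big_set1.
have prM : M \proper P by rewrite properEneq neMP.
have evO : odd #|O| = false.
  apply/negP => oO; case/negP: neMP; apply/eqP.
  have /eqP e : #|P : Q| == 1%N.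
    have [t e] := p_natP (pnat_dvd (dvdn_indexg P Q) tP).
    by move: oO; rewrite cO e oddX orbF => /eqP ->.
  apply/eqP; rewrite eqEcard sMP /= cardJg -(Lagrange sQP) e muln1 //.
have [a [b [ab abM]]] := proper_char prM.
(* [pc C] is an element of P carrying [C0] to [C], with default value 1 off the orbit; by [key] the
   choice has no influence on [eta]. *)
pose pc C := odflt 1 [pick p in P | C0 :* p == C].
have pcP C : C \in O -> pc C \in P /\ C0 :* pc C = C.
  case/orbitP => p pP; rewrite /= rcosetE => e; rewrite /pc; case: pickP => [q /andP[qP /eqP]|/(_ p)] //.
  by rewrite pP -e eqxx.
have key p p' v0 v1 : p \in P -> p' \in P -> C0 :* p = C0 :* p' ->
    eta a b (c * p * v0) (c * p * v1) = eta a b (c * p' * v0) (c * p' * v1).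
  move=> pP p'P e; pose m := (p * p'^-1) ^ c^-1.
  have mM : m \in M.
    rewrite mem_conjg invgK conjgKV QE groupM ?groupV //=.
    by rewrite rcosetM e -rcosetM mulgV rcoset1.
  have e' v : c * p * v = m * (c * p' * v).
    by rewrite /m conjgE invgK !mulgA !mulgKV.
  by rewrite !e' eta_inv ?(subsetP sMP) ?abM.
rewrite -/O evO.
exists (fun v0 v1 => \big[addb/false]_(C in O) eta a b (c * pc C * v0) (c * pc C * v1)).
  move=> p v0 v1 pP; rewrite [RHS](reindex_inj (@rcoset_inj _ p)) /=.
  have OM C : (C :* p \in O) = (C \in O).
    by rewrite -rcosetE -[rcoset C p]/('Rs%act C p) orbit_actr_in ?subsetT.
  apply: eq_big => [C|C CO]; first by rewrite OM.
  have [pcC e] := pcP C CO; have [|pcC' e'] := pcP (C :* p); first by rewrite OM.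
  rewrite !mulgA -[c * pc C * p]mulgA; apply: key; rewrite ?groupM //.
  by rewrite rcosetM e e'.
move=> v0 v1 v2; rewrite /= /d1 -!big_split /=; apply: eq_bigr => C CO.
rewrite -[RHS]/(d1 (eta a b) _ _ _) etaE //.
have [pcC e] := pcP C CO.
apply: (@repr_S C _ (fun d => cup2 X Y (d * v0) (d * v1) (d * v2))).
- by move=> p v pP /=; rewrite -!mulgA; apply: cup2_inv.
- exact: OS.
- by rewrite -{2}e mem_rcoset mulgK defC0 rcoset_refl.
Qed.

(** Each orbit of odd size contributes one copy of x u y and the others nothing; the number of odd
    orbits has the parity of the index of P. *)
Lemma F_cohom : cohom F (cup2 X Y).
Proof.
have actS : [acts P, on S | 'Rs].
  by apply: subset_trans (subsetT _) _; apply: actsRs_rcosets.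
have part := orbit_partition actS.
apply: (@cohom_trans (fun v0 v1 v2 => \big[addb/false]_(O in orbit 'Rs P @: S)
    \big[addb/false]_(C in O) cup2 X Y (fingroup.repr C * v0) (fingroup.repr C * v1) (fingroup.repr C * v2))).
  by apply: cohom_ext => a b c; rewrite /F /transfer (set_partition_big _ part).
apply: (@cohom_trans (fun v0 v1 v2 => \big[addb/false]_(O in orbit 'Rs P @: S)
    (odd #|O| && cup2 X Y v0 v1 v2))).
  by apply: cohom_sum => _ /imsetP[C0 C0S ->]; apply: orbit_transfer.
apply: cohom_ext => a b c.
have e : odd #|S| = \big[addb/false]_(O in orbit 'Rs P @: S) odd #|O|.
  by rewrite (card_partition part) (big_morph odd oddD (erefl _)).
case: (cup2 X Y a b c).
  by rewrite -[RHS]oddS e; apply: eq_bigr => O _; rewrite andbT.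
by rewrite big1 // => O _; rewrite andbF.
Qed.

Definition FF v0 v1 v2 v3 v4 := F v0 v1 v2 && F v2 v3 v4.

Definition d3 (H : gT -> gT -> gT -> gT -> bool) v0 v1 v2 v3 v4 :=
  H v1 v2 v3 v4 (+) H v0 v2 v3 v4 (+) H v0 v1 v3 v4 (+) H v0 v1 v2 v4 (+) H v0 v1 v2 v3.

Lemma cup2_cocycle v0 v1 v2 v3 : cup2 X Y v1 v2 v3 (+) cup2 X Y v0 v2 v3
  (+) cup2 X Y v0 v1 v3 (+) cup2 X Y v0 v1 v2 = false.
Proof.
rewrite /cup2; case: (X v0); case: (X v1); case: (X v2);
by case: (Y v1); case: (Y v2); case: (Y v3).
Qed.

Lemma F_cocycle v0 v1 v2 v3 :
  F v1 v2 v3 (+) F v0 v2 v3 (+) F v0 v1 v3 (+) F v0 v1 v2 = false.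
Proof.
have [k _ Fk] := F_cohom; rewrite !Fk /d1; have := cup2_cocycle v0 v1 v2 v3.
case: (cup2 X Y v1 v2 v3); case: (cup2 X Y v0 v2 v3); case: (cup2 X Y v0 v1 v3);
case: (cup2 X Y v0 v1 v2) => // _;
case: (k v0 v1); case: (k v0 v2); case: (k v0 v3); case: (k v1 v2); case: (k v1 v3);
by case: (k v2 v3).
Qed.

(** Pieces of a primitive of F u F. With F = x u y + dk, [H1c] and [H2c] replace the two factors by
    x u y in turn; [H3c] exchanges the inner y and x by a cup-1 product, and [H4c] kills x u x u y u
    y through the primitive [kx] of x u x. *)
Definition H1c k v0 v1 v2 v3 := k v0 v1 && F v1 v2 v3.
Definition H2c k v0 v1 v2 v3 := cup2 X Y v0 v1 v2 && k v2 v3.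
Definition H3c v0 v1 v2 v3 := (X v0 (+) X v1) &&
  ((X v1 (+) X v2) && (Y v1 (+) Y v2)) && (Y v2 (+) Y v3).
Definition H4c v0 v1 v2 v3 := kx v0 v1 && (Y v1 (+) Y v2) && (Y v2 (+) Y v3).

Lemma d3_H1c k v0 v1 v2 v3 v4 :
  d3 (H1c k) v0 v1 v2 v3 v4 = d1 k v0 v1 v2 && F v2 v3 v4.
Proof.
rewrite /d3 /H1c /d1; have := F_cocycle v1 v2 v3 v4.
case: (F v2 v3 v4); case: (F v1 v3 v4); case: (F v1 v2 v4); case: (F v1 v2 v3) => // _;
by case: (k v0 v1); case: (k v1 v2); case: (k v0 v2).
Qed.

Lemma d3_H2c k v0 v1 v2 v3 v4 :
  d3 (H2c k) v0 v1 v2 v3 v4 = cup2 X Y v0 v1 v2 && d1 k v2 v3 v4.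
Proof.
rewrite /d3 /H2c /d1; have := cup2_cocycle v0 v1 v2 v3.
case: (cup2 X Y v1 v2 v3); case: (cup2 X Y v0 v2 v3); case: (cup2 X Y v0 v1 v3);
case: (cup2 X Y v0 v1 v2) => // _;
by case: (k v2 v3); case: (k v2 v4); case: (k v3 v4).
Qed.

Lemma d3_H34c v0 v1 v2 v3 v4 :
  d3 H3c v0 v1 v2 v3 v4 (+) d3 H4c v0 v1 v2 v3 v4 =
  cup2 X Y v0 v1 v2 && cup2 X Y v2 v3 v4.
Proof.
have -> : d3 H4c v0 v1 v2 v3 v4 =
    cup2 X X v0 v1 v2 && (Y v2 (+) Y v3) && (Y v3 (+) Y v4).
  rewrite kxE /d3 /H4c /d1; case: (kx v1 v2); case: (kx v0 v2); case: (kx v0 v1) => //=;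
  by case: (Y v1); case: (Y v2); case: (Y v3); case: (Y v4).
rewrite /d3 /H3c /cup2.
case: (X v0); case: (X v1); case: (X v2); case: (X v3); case: (X v4) => //=;
by case: (Y v1); case: (Y v2); case: (Y v3); case: (Y v4).
Qed.

Lemma d3_add H H' v0 v1 v2 v3 v4 :
  d3 (fun a b c d => H a b c d (+) H' a b c d) v0 v1 v2 v3 v4
  = d3 H v0 v1 v2 v3 v4 (+) d3 H' v0 v1 v2 v3 v4.
Proof.
rewrite /d3; case: (H v0 _ _ _); case: (H _ _ _ _); case: (H _ _ _ _); case: (H _ _ _ _);
case: (H _ _ _ _); case: (H' _ _ _ _); case: (H' _ _ _ _); case: (H' _ _ _ _);
by case: (H' _ _ _ _); case: (H' _ _ _ _).
Qed.

(* On P, F u F is cohomologous to (x u y) u (x u y), a coboundary since x u x = dh.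
   Summing a P-invariant primitive over the cosets of P, which are odd in number,
   makes it G-invariant. *)
Lemma FF_coboundary : exists2 H : gT -> gT -> gT -> gT -> bool,
    (forall g v0 v1 v2 v3, H (g * v0) (g * v1) (g * v2) (g * v3) = H v0 v1 v2 v3)
  & (forall v0 v1 v2 v3 v4, FF v0 v1 v2 v3 v4 = d3 H v0 v1 v2 v3 v4).
Proof.
have [k kP Fk] := F_cohom.
pose H v0 v1 v2 v3 := H2c k v0 v1 v2 v3 (+) H1c k v0 v1 v2 v3
  (+) (H3c v0 v1 v2 v3 (+) H4c v0 v1 v2 v3).
have HP p v0 v1 v2 v3 : p \in P ->
    H (p * v0) (p * v1) (p * v2) (p * v3) = H v0 v1 v2 v3.
  move=> pP; rewrite /H /H1c /H2c /H3c /H4c cup2_inv // !kP // F_inv kx_inv //.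
  by rewrite !(eqvar_diff _ _ xX) // !(eqvar_diff _ _ yY).
have HFF v0 v1 v2 v3 v4 : FF v0 v1 v2 v3 v4 = d3 H v0 v1 v2 v3 v4.
  have -> : d3 H v0 v1 v2 v3 v4 = d3 (H2c k) v0 v1 v2 v3 v4 (+) d3 (H1c k) v0 v1 v2 v3 v4
     (+) (d3 H3c v0 v1 v2 v3 v4 (+) d3 H4c v0 v1 v2 v3 v4).
    by rewrite !d3_add.
  rewrite d3_H1c d3_H2c d3_H34c /FF !Fk.
  case: (cup2 X Y v0 v1 v2); case: (cup2 X Y v2 v3 v4); case: (d1 k v0 v1 v2);
  by case: (d1 k v2 v3 v4).
exists (fun v0 v1 v2 v3 => \big[addb/false]_(C in S)
  let c := fingroup.repr C in H (c * v0) (c * v1) (c * v2) (c * v3)).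
  move=> g v0 v1 v2 v3.
  have := @transfer_inv (fun c => H (c * v0) (c * v1) (c * v2) (c * v3)) g.
  move=> /= <-; first by apply: eq_bigr => C _; rewrite !mulgA.
  by move=> p v pP /=; rewrite -!mulgA; apply: HP.
move=> v0 v1 v2 v3 v4; rewrite /d3 /= -!big_split /=.
rewrite (eq_bigr (fun=> FF v0 v1 v2 v3 v4)) => [|C _]; last first.
  by rewrite -[LHS]/(d3 H _ _ _ _ _) -HFF /FF !F_inv.
have e : odd #|S| = \big[addb/false]_(C in S) true.
  by rewrite -sum1_card (big_morph odd oddD (erefl _)).
case: (FF v0 v1 v2 v3 v4); first by rewrite -[LHS]oddS e.
by rewrite big1.
Qed.

Hypothesis reduced : two_reduced gT.

Definition toF2 (b : bool) : 'F_2 := (nat_of_bool b)%:R%R.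

Lemma toF2D a b : toF2 (a (+) b) = (toF2 a + toF2 b)%R.
Proof. by apply/val_inj; case: a; case: b. Qed.

Lemma toF2M a b : toF2 (a && b) = (toF2 a * toF2 b)%R.
Proof. by apply/val_inj; case: a; case: b. Qed.

Lemma toF2K (u : 'F_2) : toF2 (u != 0%R) = u.
Proof. by apply/val_inj; case: u => [[|[|]]]. Qed.

Lemma toF2_inj : injective toF2.
Proof. by case; case. Qed.

Lemma signF2 n (u : 'F_2) : ((-1) ^+ n * u = u)%R.
Proof.
have -> : (-1 = 1 :> 'F_2)%R by apply/val_inj.
by rewrite expr1n mul1r.
Qed.

Lemma ffun_val n (u : {ffun 'I_n -> gT}) (i j : 'I_n) : i = j :> nat -> u i = u j.
Proof. by move/val_inj->. Qed.

(** By [FF_coboundary] the class of F has zero square, so [reduced] makes it trivial. Homogeneous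
    cochains become inhomogeneous by evaluation at (1, p, p q, ...). *)
Lemma cup_reduced : exists b : gT -> bool, forall p q,
  F 1 p (p * q) = b q (+) b (p * q) (+) b p.
Proof.
pose i0 : 'I_2 := ord0; pose i1 : 'I_2 := lift ord0 ord0.
pose Fc : cochain gT 2 := [ffun v : {ffun 'I_2 -> gT} => toF2 (F 1 (v i0) (v i0 * v i1))].
have FcZ : is_cocycle Fc.
  rewrite /is_cocycle /coboundary; apply/ffunP => v; rewrite !ffunE.
  rewrite !big_ord_recl big_ord0 !signF2 /Fc !ffunE /= GRing.addr0.
  have vE := @ffun_val _ v.
  rewrite (vE (widen_ord _ i1) (lift ord0 i0)) //.
  set a := v (widen_ord _ i0); set b := v (lift ord0 i0); set c := v (lift ord0 i1).
  rewrite -(F_inv a 1) mulg1 -!toF2D !mulgA.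
  have := F_cocycle 1 a (a * b) (a * b * c).
  by rewrite -!addbA => ->; apply/val_inj.
have [|h1 eh1] := reduced FcZ.
  exists 2%N; have [H HG eH] := FF_coboundary.
  pose j0 : 'I_3 := ord0; pose j1 : 'I_3 := lift ord0 ord0.
  pose j2 : 'I_3 := lift ord0 (lift ord0 ord0).
  exists [ffun v : {ffun 'I_3 -> gT} =>
    toF2 (H 1 (v j0) (v j0 * v j1) (v j0 * v j1 * v j2))].
  apply/ffunP => v; rewrite /cup_exp /coboundary /cup !ffunE.
  rewrite !big_ord_recl big_ord0 !signF2 /Fc !ffunE /= GRing.addr0 GRing.mulr1.
  have vE := @ffun_val _ v.
  rewrite (vE (widen_ord _ j1) (lift ord0 j0)) // (vE (widen_ord _ j2) (lift ord0 j1)) //.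
  rewrite (vE (lshift _ i0) (widen_ord (leqnSn 3) j0)) //.
  rewrite (vE (lshift _ i1) (lift ord0 j0)) //.
  rewrite (vE (rshift 2 (lshift (0 * 2) i0)) (lift ord0 j1)) //.
  rewrite (vE (rshift 2 (lshift (0 * 2) i1)) (lift ord0 j2)) //.
  rewrite -![widen_ord (leqnSn (1 * 2).+1) j0]/(widen_ord (leqnSn 3) j0).
  set a := v (widen_ord _ j0); set b := v (lift ord0 j0).
  set c := v (lift ord0 j1); set d := v (lift ord0 j2).
  rewrite -(F_inv (a * b) 1 c) -(HG a 1) !mulg1 -!toF2D -toF2M !mulgA; congr toF2.
  by have := eH 1 a (a * b) (a * b * c) (a * b * c * d); rewrite /FF /d3 -!addbA.
exists (fun g => h1 [ffun=> g] != 0%R) => p q; apply: toF2_inj.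
rewrite !toF2D !toF2K.
pose v : {ffun 'I_2 -> gT} := [ffun i => if i == i0 then p else q].
have := congr1 (fun f : cochain gT 2 => f v) eh1; rewrite /coboundary !ffunE /=.
rewrite !big_ord_recl big_ord0 !signF2 GRing.addr0 GRing.addrA => ->.
congr (_ + _ + _)%R; congr (h1 _); apply/ffunP => j; rewrite !ffunE !ord1 //=.
Qed.

(** On P, [b] is a primitive of F and [k] one of the difference between F and x u y; their sum is a
    primitive of x u y. *)
Theorem cup_killed : exists k : gT -> bool,
  {in P &, forall p q, k p (+) k q (+) k (p * q) = x p && y q}.
Proof.
have [b Fb] := cup_reduced; have [k kP Fk] := F_cohom.
exists (fun p => b p (+) k 1 p) => p q pP qP.
have := Fk 1 p (p * q); rewrite Fb /d1 /cup2.
have -> : X 1 (+) X p = x p by rewrite -[in X p](mulg1 p) xX //; case: (x p); case: (X 1).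
have -> : Y p (+) Y (p * q) = y q.
  by rewrite -[in Y p](mulg1 p) !yY //  -[q in LHS]mulg1 yY //; case: (y p); case: (y q); case: (Y 1).
have -> : k p (p * q) = k 1 q by rewrite -[p in k p]mulg1 kP.
case: (x p && y q); case: (b p); case: (b q); case: (b _); case: (k 1 q); case: (k 1 p);
by case: (k 1 _).
Qed.

End Stable.

(** * 2-reduced groups *)

Section Reduced.

Variable gT : finGroupType.
Implicit Types (P J M N : {group gT}) (l x y : gT -> bool).
Local Open Scope nat_scope.
Local Open Scope group_scope.

Lemma char_ker P l : char_on P l -> (exists2 t, t \in P & l t) ->
  exists M, [/\ maximal M P, #|P : M| = 2 & forall p, (p \in M) = (p \in P) && ~~ l p].
Proof.
move=> lP [t tP lt]; pose K := [set p in P | ~~ l p].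
have KE p : (p \in K) = (p \in P) && ~~ l p by rewrite inE.
have gK : group_set K.
  apply/group_setP; split; first by rewrite KE group1 (char1 lP).
  move=> p q; rewrite !KE => /andP[pP lp] /andP[qP lq].
  by rewrite groupM // lP // (negbTE lp) (negbTE lq).
exists (group gK).
have sKP : K \subset P by apply/subsetP => p; rewrite KE => /andP[].
have cD : P :\: K = t *: K.
  apply/setP => p; rewrite mem_lcoset in_setD !KE.
  have [pP|pP] := boolP (p \in P); last by rewrite andbF /= groupMl ?groupV // (negbTE pP).
  by rewrite groupM ?groupV // lP ?groupV // (charV lP) // lt andbT /=.
have iK : #|P : group gK| = 2.
  apply/eqP; rewrite -(eqn_pmul2l (cardG_gt0 (group gK))) Lagrange //= -(cardsID K P).
  by rewrite (setIidPr sKP) cD card_lcoset muln2 addnn.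
by split=> //; apply: p_index_maximal; rewrite ?iK.
Qed.

Lemma char_Phi P l p : char_on P l -> p \in 'Phi(P) -> l p = false.
Proof.
move=> lP pPhi; have pP := subsetP (Phi_sub P) p pPhi.
apply/negP => lp; have [|M [mM _ ME]] := char_ker lP; first by exists p.
by have := subsetP (Phi_sub_max mM) _ pPhi; rewrite ME lp andbF.
Qed.

(** The values of y, h, k at b, a, c form a unitriangular matrix, so the three characters map
    J/Phi(J) onto F_2^3. *)
Lemma three_chars J (h y k : gT -> bool) (a b c : gT) :
  char_on J h -> char_on J y -> char_on J k -> a \in J -> b \in J -> c \in J ->
  h a -> h c = false -> y a = false -> y b -> y c = false -> k c ->
  8 <= #|J : 'Phi(J)|.
Proof.
move=> hJ yJ kJ aJ bJ cJ ha hc ya yb yc kc.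
pose f (C : {set gT}) := (h (fingroup.repr C), y (fingroup.repr C), k (fingroup.repr C)).
pose ph p := (h p, y p, k p).
have fE p : p \in J -> f ('Phi(J) :* p) = ph p.
  move=> pJ; have /rcosetP[u uPhi e] := mem_repr_rcoset 'Phi(J) p.
  have uJ := subsetP (Phi_sub J) u uPhi.
  have zero l : char_on J l -> l (u * p) = l p by move=> lJ; rewrite lJ // (char_Phi lJ).
  by rewrite /f /ph; have /= -> := e; rewrite !zero.
suff: [set: bool * bool * bool] \subset f @: rcosets 'Phi(J) J.
  move/subset_leq_card; rewrite cardsT !card_prod card_bool => /leq_trans; apply.
  exact: leq_imset_card.
have im p : p \in J -> ph p \in f @: rcosets 'Phi(J) J.
  by move=> pJ; rewrite -fE //; apply: imset_f; apply/rcosetsP; exists p.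
have phM p q : p \in J -> q \in J -> ph (p * q) = (h p (+) h q, y p (+) y q, k p (+) k q).
  by move=> pJ qJ; rewrite /ph hJ ?yJ ?kJ.
have step p r : p \in J -> ph p = r -> r \in f @: rcosets 'Phi(J) J.
  by move=> pJ <-; apply: im.
have h1 := char1 hJ; have y1 := char1 yJ; have k1 := char1 kJ.
apply/subsetP => -[[u v] w] _.
pose p0 := if u (+) (v && h b) then a else 1; pose p1 := if v then b else 1.
have p0J : p0 \in J by rewrite /p0; case: ifP.
have p1J : p1 \in J by rewrite /p1; case: ifP.
pose p2 := if w (+) (k p0 (+) k p1) then c else 1.
have p2J : p2 \in J by rewrite /p2; case: ifP.
apply: (step (p0 * p1 * p2)); first by rewrite !groupM.
rewrite phM ?groupM // hJ // yJ // kJ //; congr (_, _, _).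
- have -> : h p2 = false by rewrite /p2; case: ifP.
  rewrite /p0 /p1; case: u {p0 p1 p0J p1J p2 p2J}; case: v => //=; rewrite ?ha ?h1;
  by case eb: (h b) => /=; rewrite ?ha ?h1 ?eb.
- have -> : y p2 = false by rewrite /p2; case: ifP.
  have -> : y p0 = false by rewrite /p0; case: ifP.
  by rewrite /p1; case: (v); rewrite ?yb ?y1.
- rewrite /p2; case: ifP; rewrite ?kc ?k1; case: (k p0); case: (k p1); case: (w) => //.
Qed.

(** The second binary digit of a residue modulo 4 is additive up to the carry, which is the product
    of the last digits; this makes it a primitive of a cup square. *)
Lemma mod4_half (i j m : nat) : m = i + j %[mod 4] ->
  (odd m = odd i (+) odd j) /\ (odd i./2 (+) odd j./2 (+) odd m./2 = odd i && odd j).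
Proof.
have red n : odd n = odd (n %% 4) /\ odd n./2 = odd (n %% 4)./2.
  rewrite {1 3}(divn_eq n 4); set q := (n %/ 4)%N; set r := (n %% 4)%N.
  have -> : (q * 4 = (q * 2).*2)%N by rewrite -muln2 -mulnA.
  by rewrite halfD odd_double /= doubleK !oddD odd_double oddM andbF /=.
move=> e; have [m1 m2] := red m; have [i1 i2] := red i; have [j1 j2] := red j.
rewrite m1 m2 i1 i2 j1 j2 e -modnDm.
have := ltn_mod i 4; have := ltn_mod j 4.
by case: (i %% 4)%N => [|[|[|[|i']]]] //; case: (j %% 4)%N => [|[|[|[|j']]]].
Qed.

(** [x] and [h] are the two binary digits of the discrete logarithm modulo 4 in the cyclic quotient.
    As [s] lifts the generator, [s * s] has logarithm 2. *)
Lemma cyclic4_chars P N : N <| P -> cyclic (P / N) -> 4 %| #|P / N| ->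
  exists x h s, [/\ char_on P x,
    {in P &, forall p q, h p (+) h q (+) h (p * q) = x p && x q},
    s \in P, x s & h (s * s)].
Proof.
move=> nNP /cyclicP[a defQ] d4; have {d4} d4 : 4 %| #[a] by rewrite orderE -defQ.
pose dl p : nat := odflt ord0 [pick i : 'I_#[a].+1 | a ^+ i == coset N p].
have dlE p : p \in P -> a ^+ dl p = coset N p.
  move=> pP; rewrite /dl; case: pickP => [i /eqP //|no].
  have : coset N p \in <[a]> by rewrite -defQ mem_quotient.
  case/cyclePmin => i ia e; have := no (Ordinal (ltnW ia : i < #[a].+1)).
  by rewrite /= -e eqxx.
have mod4 i j : a ^+ i = a ^+ j -> i = j %[mod 4].
  move/eqP; rewrite eq_expg_mod_order => /eqP e.
  by rewrite -(modn_dvdm i d4) e modn_dvdm.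
have nP p : p \in P -> p \in 'N(N) by apply: (subsetP (normal_norm nNP)).
have dlM p q : p \in P -> q \in P -> dl (p * q) = dl p + dl q %[mod 4].
  move=> pP qP; apply: mod4; rewrite expgD !dlE ?groupM // morphM //; exact: nP.
have [s [sN sP es]] : exists s, [/\ s \in 'N(N), s \in P & coset N s = a].
  have : a \in P / N by rewrite defQ cycle_id.
  by case/morphimP => s sN sP e; exists s.
have ds : dl s = 1 %[mod 4] by apply: mod4; rewrite dlE // es.
exists (fun p => odd (dl p)), (fun p => odd (dl p)./2), s.
have dss := dlM s s sP sP.
split=> //.
- by move=> p q pP qP; have [] := mod4_half (dlM p q pP qP).
- by move=> p q pP qP; have [] := mod4_half (dlM p q pP qP).
- have [/= -> _] := @mod4_half 1 0 (dl s) ds; by [].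
- have e2 : dl (s * s) = 1 + 1 %[mod 4] by rewrite dss -modnDm ds modnDm.
  by have [_ /=] := mod4_half e2; case: (odd _).
Qed.

Lemma two_maximals P (A B : {group gT}) : 2.-group P ->
    maximal A P -> maximal B P -> A != B ->
  [/\ (exists2 p, p \in A & p \notin B), #|P : A :&: B| = 4 & A :&: B \subset P].
Proof.
move=> tP mA mB AB; have [sA nA iA cA] := maximal_2group tP mA.
have [sB nB iB cB] := maximal_2group tP mB.
have cAB : #|A| = #|B| by apply/eqP; rewrite -(eqn_pmul2l (isT : 0 < 2)) cA cB.
have nAB : ~~ (A \subset B).
  by apply: contra AB => s; rewrite -val_eqE /= eqEcard s cAB leqnn.
have sAB : A :&: B \subset A := subsetIl A B.
split; [exact/subsetPn | | exact: subset_trans sAB sA].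
have AB_P : B * A = P := mulg_normal_maximal nB mB sA nAB.
have iAB : #|A : A :&: B| = 2 by rewrite indexgI -(indexMg B A) AB_P.
by rewrite -(Lagrange_index sA sAB) iA iAB.
Qed.

Lemma order8_subquotient P : two_reduced gT -> P \in 'Syl_2([set: gT]) ->
  ~~ cyclic P -> 8 %| #|P| ->
  exists2 J : {group gT}, J \subset P
    & 8 <= #|J : 'Phi(J)| \/ #|J| = 8 /\ ~~ abelian J.
Proof.
move=> red sylP ncP d8; have := sylP; rewrite inE => sP.
have tP : 2.-group P := pHall_pgroup sP.
have P8 : 8 <= #|P| by rewrite dvdn_leq.
have [J1 [J2 [mJ1 mJ2 J12]]] := noncyclic_maximals tP ncP.
have i4 (A B : {group gT}) := @two_maximals P A B tP.
have [p8|p8] := leqP 8 #|P : 'Phi(P)|; first by exists P => //; left.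
have two_pow (A : {group gT}) : A \subset P -> exists m, #|P : A| = (2 ^ m)%N.
  move=> sA; have [m ->] := p_natP (pnat_dvd (dvdn_indexg P A) tP); first by exists m.
have dPhi (A : {group gT}) : A \subset 'Phi(P) -> 4 %| #|P : A|.
  move=> sA; have [_ i12 s12] := i4 _ _ mJ1 mJ2 J12.
  have sA12 : A \subset J1 :&: J2.
    by rewrite subsetI !(subset_trans sA) ?Phi_sub_max.
  by rewrite -(Lagrange_index s12 sA12) i12 dvdn_mulr.
have iPhi : #|P : 'Phi(P)| = 4.
  have [m em] := two_pow _ (Phi_sub P); have := dPhi _ (subxx 'Phi(P)).
  by move: p8; rewrite /= em; case: m {em} => [|[|[|m]]] //; rewrite !expnS; lia.
have sP'Phi : P^`(1) \subset 'Phi(P) by rewrite (Phi_joing tP) joing_subl.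
(* Index 4 is the case of maximal class, settled by a nonabelian subgroup of order 8. *)
have [iP'|iP'] := eqVneq #|P : P^`(1)| 4.
  have [C [sCP cC iC]] := cyclic_index2 (leqnn _) tP iP'.
  have [H [sHP H8 nabH]] := nonabelian_order8_sub tP P8 iP' sCP cC iC.
  by exists H => //; right.
have {iP'} iP' : 8 <= #|P : P^`(1)|.
  have [m em] := two_pow _ (der_sub 1 P); have := dPhi _ sP'Phi; move: iP'.
  rewrite /= em; case: m {em} => [|[|[|m]]] // _ _.
  by rewrite !expnS; have := expn_gt0 2 m; lia.
have [N [nNP cPN d4]] := cyclic4_quotient tP iPhi iP'.
have [x [h [s [xP hP sP' xs hss]]]] := cyclic4_chars nNP cPN d4.
have [J [mJ iJ JE]] := char_ker xP (ex_intro2 _ _ s sP' xs).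
have [M mM JM] : exists2 M : {group gT}, maximal M P & M != J.
  by have [<-|?] := eqVneq J1 J; [exists J2 => //; rewrite eq_sym | exists J1].
have [sM nM iM _] := maximal_2group tP mM.
have [[sx sxM sxJ] _ _] := i4 _ _ mM mJ JM.
have JM' : J != M by rewrite eq_sym.
have [[sy syJ syM] iJM sJMP] := i4 _ _ mJ mM JM'.
pose y p := p \notin M.
have yP : char_on P y := index2_char nM iM.
have PhiE : J :&: M = 'Phi(P).
  apply/esym/eqP; rewrite eqEcard subsetI !Phi_sub_max //=.
  have := Lagrange sJMP; have := Lagrange (Phi_sub P); rewrite /= iJM iPhi => <-.
  by move/eqP; rewrite eqn_pmul2r // => /eqP ->.
have [sxP syP] : sx \in P /\ sy \in P.
  by split; [apply: (subsetP sM) | move: syJ; rewrite JE => /andP[]].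
have xsx : x sx by move: sxJ; rewrite JE sxP negbK.
have ysx : y sx = false by rewrite /y sxM.
have xsy : x sy = false by move: syJ; rewrite JE syP => /negbTE.
have ysy : y sy by [].
(* A character is determined by its values at [sx] and [sy], which are dual to x and y modulo
   Phi(P). *)
have char0 l p : char_on P l -> p \in P -> x p = false -> y p = false -> l p = false.
  move=> lP pP xp yp; apply: (char_Phi lP).
  by rewrite -PhiE inE JE pP xp /=; move/negbFE: yp.
have H1 l : char_on P l -> exists a b, {in P, forall p, l p = a && x p (+) b && y p}.
  move=> lP; exists (l sx), (l sy) => p pP.
  have xysx : x (p * sx) = ~~ x p /\ y (p * sx) = y p.
    by rewrite xP // yP // xsx ysx addbT addbF.
  have xysy q : q \in P -> x (q * sy) = x q /\ y (q * sy) = ~~ y q.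
    by move=> qP; rewrite xP // yP // xsy ysy addbT addbF.
  have [xsyp ysyp] := xysy p pP.
  have [xsxy ysxy] := xysy (p * sx) (groupM pP sxP).
  have lx q : q \in P -> l (q * sx) = l q (+) l sx by move=> qP; rewrite lP.
  have ly q : q \in P -> l (q * sy) = l q (+) l sy by move=> qP; rewrite lP.
  case: xysx => xpx ypx.
  case ex: (x p); case ey: (y p) => /=; rewrite ?andbT ?andbF ?addbF /=.
  - have := char0 l (p * sx * sy) lP; rewrite xsxy ysxy xpx ypx ex ey ly ?lx ?groupM //.
    by case: (l p); case: (l sx); case: (l sy) => // H; have := H isT erefl erefl.
  - have := char0 l (p * sx) lP; rewrite xpx ypx ex ey ?lx ?groupM //.
    by case: (l p); case: (l sx) => // H; have := H isT erefl erefl.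
  - have := char0 l (p * sy) lP; rewrite xsyp ysyp ex ey ?ly ?groupM //.
    by case: (l p); case: (l sy) => // H; have := H isT erefl erefl.
  - exact: char0.
have indep a b : {in P, forall p, a && x p (+) b && y p = false} -> a = false /\ b = false.
  move=> ab; have := ab _ sxP; have := ab _ syP.
  by rewrite xsx ysx xsy ysy !andbT !andbF addbF.
have oddS : odd #|rcosets P [set: gT]|.
  by case/and3P: sP => _ _; rewrite p'natE // dvdn2 negbK.
have [k kP] := cup_killed xP yP hP H1 indep tP oddS red.
exists J; first by have [] := maximal_2group tP mJ.
left; have sJP : J \subset P by have [] := maximal_2group tP mJ.
have xJ p : p \in J -> x p = false by rewrite JE => /andP[_ /negbTE].
have PJ := subsetP sJP.
have hJ : char_on J h.
  move=> p q pJ qJ; have := hP p q (PJ _ pJ) (PJ _ qJ); rewrite (xJ _ pJ) /=.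
  by case: (h _); case: (h _); case: (h _).
have yJ : char_on J y by move=> p q pJ qJ; rewrite yP ?PJ.
have kJ : char_on J k.
  move=> p q pJ qJ; have := kP p q (PJ _ pJ) (PJ _ qJ); rewrite (xJ _ pJ) /=.
  by case: (k _); case: (k _); case: (k _).
(* On J both h and k are characters. The relation dk = x u y is not symmetric in its arguments:
   writing sx sy = u sx gives k u = k sy + 1, while h u = h sy and y u = y sy. Hence [sy * u] is
   killed by h and y but not by k. *)
pose u := sx * sy * sx^-1.
have uP : u \in P by rewrite !groupM ?groupV.
have uJ : u \in J by rewrite JE uP /u !xP ?groupM ?groupV // (charV xP) // xsx xsy.
have us : u * sx = sx * sy by rewrite /u mulgKV.
have ku : k u = ~~ k sy.
  have := kP sx sy sxP syP; have := kP u sx uP sxP; rewrite us ysx ysy xsx andbF /=.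
  by case: (k u); case: (k sx); case: (k sy); case: (k _).
have hu : h u = h sy.
  have := hP sx sy sxP syP; have := hP u sx uP sxP; rewrite us (xJ _ uJ) xsy andbF /=.
  by case: (h u); case: (h sx); case: (h sy); case: (h _).
have yu : y u = y sy by rewrite /u !yP ?groupM ?groupV // (charV yP) // ysx addbF.
apply: (@three_chars J h y k (s * s) sy (sy * u)) => //.
- by rewrite JE groupM // xP // addbb.
- exact: groupM.
- by rewrite hJ // hu addbb.
- by rewrite yP // addbb.
- by rewrite yP // yu addbb.
- by rewrite kJ // ku; case: (k sy).
Qed.

End Reduced.

(** * Odd degree extensions *)

Section Orthogonal.

Variables (k : fieldType) (V : vectType k) (B : V -> V -> k).
Hypotheses (two : 2%:R != 0 :> k) (BC : forall x y, B x y = B y x).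
Hypotheses (BD : forall x y z, B (x + y) z = B x z + B y z).
Hypothesis BZ : forall a x z, B (a *: x) z = a * B x z.
Hypothesis Bnd : forall x, x != 0 -> exists y, B x y != 0.

Lemma bil_sum (J : finType) (c : J -> k) (e : J -> V) z :
  B (\sum_j c j *: e j) z = \sum_j c j * B (e j) z.
Proof.
have B0 : B 0 z = 0 by rewrite -(scale0r 0) BZ mul0r.
rewrite (big_morph (B^~ z) (fun x y => BD x y z) B0).
by apply: eq_bigr => j _; rewrite BZ.
Qed.

Definition orth n (e : 'I_n -> V) (a : 'I_n -> k) :=
  (forall i j, B (e i) (e j) = a i *+ (i == j)) /\ forall i, a i != 0.

Definition orth_res n (e : 'I_n -> V) (a : 'I_n -> k) x :=
  x - \sum_i (B x (e i) / a i) *: e i.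

Lemma orth_resP n (e : 'I_n -> V) a x j : orth e a -> B (orth_res e a x) (e j) = 0.
Proof.
move=> [ee a0]; rewrite /orth_res BD -scaleN1r BZ bil_sum (bigD1 j) //= ee eqxx.
rewrite divfK // big1 ?addr0 ?mulN1r ?subrr // => i ij.
by rewrite ee (negbTE ij) mulr0.
Qed.

(** Take z outside the span, made orthogonal to it, and u orthogonal to the span with B z u != 0. If
    z and u are both isotropic, z + u has norm 2 B z u. *)
Lemma orth_extend n (e : 'I_n -> V) a : orth e a -> (n < \dim {:V})%N ->
  exists (e' : 'I_n.+1 -> V) a', orth e' a'.
Proof.
move=> oe nV; have [ee a0] := oe.
have [v vW v0] : exists2 v, forall j, B v (e j) = 0 & B v v != 0.
  have : ~~ ({:V} <= <<[seq e i | i <- enum 'I_n]>>)%VS.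
    apply: contraL nV => /dimvS h; rewrite -leqNgt (leq_trans h) //.
    by rewrite (leq_trans (dim_span _)) // size_map size_enum_ord.
  case/subvPn => y _ ys; pose z := orth_res e a y.
  have zW j : B z (e j) = 0 by apply: orth_resP.
  have z0 : z != 0.
    apply: contra ys; rewrite subr_eq0 => /eqP ->; rewrite memv_suml // => i _.
    by rewrite memvZ // memv_span // map_f // mem_enum.
  have [zz|zz] := eqVneq (B z z) 0; last by exists z.
  have [t zt] := Bnd z0; pose u := orth_res e a t.
  have uW j : B u (e j) = 0 by apply: orth_resP.
  have zu : B z u = B z t.
    rewrite [LHS]BC BD -scaleN1r BZ bil_sum big1 ?mulr0 ?addr0 => [|i _]; first exact: BC.
    by rewrite [B (e i) z]BC zW mulr0.
  have [uu|uu] := eqVneq (B u u) 0; last by exists u.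
  exists (z + u) => [j|]; first by rewrite BD zW uW addr0.
  clearbody u z; have -> : B (z + u) (z + u) = 2%:R * B z t; last by rewrite mulf_neq0.
  by rewrite BD (BC z (z + u)) (BC u (z + u)) !BD zz uu (BC u z) zu; ring.
exists (fun i => if unlift ord0 i is Some j then e j else v).
exists (fun i => if unlift ord0 i is Some j then a j else B v v).
split=> [i j|i]; last by case: unliftP.
case: unliftP => [i' ->|->]; case: unliftP => [j' ->|->].
- by rewrite ee (inj_eq lift_inj).
- by rewrite BC vW.
- by rewrite vW.
- by rewrite eqxx.
Qed.

Lemma orth_family : exists (e : 'I_(\dim {:V}) -> V) a, orth e a.
Proof.
suff: forall n, (n <= \dim {:V})%N -> exists (e : 'I_n -> V) a, orth e a by apply.
elim=> [_|n IH nV]; last by have [e [a oe]] := IH (ltnW nV); apply: orth_extend oe nV.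
by exists (fun=> 0), (fun=> 1); split=> [[]|[]].
Qed.

Lemma orth_expand (e : 'I_(\dim {:V}) -> V) a x : orth e a ->
  x = \sum_i (B x (e i) / a i) *: e i.
Proof.
move=> oe; have [ee a0] := oe; pose X := [tuple e i | i < \dim {:V}].
have XE (i : 'I_(\dim {:V})) : X`_i = e i by rewrite -tnth_nth tnth_mktuple.
have coordB (c : 'I_(\dim {:V}) -> k) j : B (\sum_i c i *: X`_i) (e j) = c j * a j.
  under eq_bigr do rewrite XE; rewrite bil_sum (bigD1 j) //= ee eqxx big1 ?addr0 // => i ij.
  by rewrite ee (negbTE ij) mulr0.
have fX : free X.
  apply/freeP => c c0 j; have := coordB c j; rewrite c0.
  have -> : B 0 (e j) = 0 by rewrite -(scale0r 0) BZ mul0r.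
  by move/esym/eqP; rewrite mulf_eq0 (negbTE (a0 j)) orbF => /eqP.
have /coord_span xE : x \in <<X>>%VS.
  have : basis_of {:V} X by rewrite basisEfree fX subvf size_tuple leqnn.
  by move/span_basis->; rewrite memvf.
rewrite [LHS]xE; apply: eq_bigr => i _; rewrite XE; congr (_ *: _).
by rewrite [in RHS]xE coordB mulfK.
Qed.

Lemma parseval (e : 'I_(\dim {:V}) -> V) a x y : orth e a ->
  B x y = \sum_i B x (e i) * B y (e i) / a i.
Proof.
move=> oe; rewrite {1}(orth_expand x oe) bil_sum; apply: eq_bigr => i _.
by rewrite (BC (e i)); ring.
Qed.

End Orthogonal.

Section Springer.

Variables (k : fieldType) (M : fieldExtType k).
Hypotheses (two : 2%:R != 0 :> k) (oddM : odd (\dim {:M})).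

(** The degree of c over k is at most 2 and divides an odd number. *)
Lemma odd_ext_sqr (d : k) (c : M) : d%:A = c ^+ 2 -> exists2 e, d = e ^+ 2 & c = e%:A.
Proof.
move=> dc; suff /vlineP[e ce] : c \in 1%VS.
  exists e => //; apply: (fmorph_inj (in_alg M)).
  by rewrite rmorphXn; rewrite ce in dc.
rewrite -adjoin_deg_eq1.
have le2 : (adjoin_degree 1 c <= 2)%N.
  have pO : ('X^2 - (d%:A)%:P : {poly M}) \is a polyOver 1%VS.
    by rewrite rpredB ?rpredX ?polyOverX // polyOverC rpredZ ?mem1v.
  have pr : root ('X^2 - (d%:A)%:P : {poly M}) c.
    by rewrite rootE !hornerE dc subrr.
  have := dvdp_leq _ (minPoly_dvdp pO pr).
  by rewrite size_minPoly size_XnsubC // ltnS; apply; rewrite -size_poly_eq0 size_XnsubC.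
have : (\dim <<1; c>> %| \dim {:M})%N by apply: field_dimS; apply: subvf.
rewrite dim_Fadjoin dimv1 muln1.
rewrite -[(_ == 1)%N]/(adjoin_degree 1 c == 1%N).
case: (adjoin_degree 1 c) le2 => [|[|[|n]]] // _ d2.
  by move: d2 oddM; rewrite dvd0n => /eqP ->.
by move: oddM; rewrite -[odd _]negbK -dvdn2 d2.
Qed.

(** Transfer by a linear form s with s 1 != 0: if the Pfister form is hyperbolic over M, its product
    with the form s (x y), of odd rank over k, is hyperbolic over k. By [pf_univ] this product is
    the Pfister class taken an odd number of times, and twice that class is zero. *)
Lemma springer_pf (u v : k) : five_isotropic k -> minus_one_two_squares k ->
  u != 0 -> v != 0 -> pf (u%:A : M) v%:A = 0 -> pf u v = 0.
Proof.
move=> k5 k2 u0 v0 pM.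
have [i si] : exists i, coord (vbasis {:M}) i (1 : M) != 0.
  apply/existsP; apply: contraT; rewrite negb_exists => /forallP v0'.
  have := oner_neq0 M; rewrite (coord_vbasis (memvf (1 : M))) big1 ?eqxx // => i _.
  by have := v0' i; rewrite negbK => /eqP ->; rewrite scale0r.
pose s (x : M) := coord (vbasis {:M}) i x; pose B (x y : M) := s (x * y).
have sD x y : s (x + y) = s x + s y by rewrite /s linearD.
have sZ a x : s (a *: x) = a * s x by rewrite /s linearZ.
have BC x y : B x y = B y x by rewrite /B mulrC.
have BD x y z : B (x + y) z = B x z + B y z by rewrite /B mulrDl sD.
have BZ a x z : B (a *: x) z = a * B x z by rewrite /B -scalerAl sZ.
have Bnd x : x != 0 -> exists y, B x y != 0.
  by move=> x0; exists x^-1; rewrite /B divff.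
have [f [c of_]] := orth_family two BC BD BZ Bnd.
have [ff c0] := of_.
(* [a] is the Pfister form and [b] the hyperbolic form of the same rank. *)
pose a (j : 'I_4) := [:: 1; - u; - v; u * v]`_j.
pose b (j : 'I_4) := [:: 1; -1; 1; -1 : k]`_j.
have a0 j : a j != 0.
  by case: j => [[|[|[|[|//]]]] ?]; rewrite /a /= ?oppr_eq0 ?oner_eq0 ?mulf_neq0.
have b0 j : b j != 0.
  by case: j => [[|[|[|[|//]]]] ?]; rewrite /b /= ?oppr_eq0 ?oner_eq0.
have aS (k' : fieldType) (h : {rmorphism k -> k'}) : \sum_j w (h (a j)) = pf (h u) (h v).
  rewrite !big_ord_recl big_ord0 /a /= rmorph1 !rmorphN rmorphM !wN wM w1 /pf; ring.
have bS (k' : fieldType) (h : {rmorphism k -> k'}) : \sum_j w (h (b j)) = 0.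
  rewrite !big_ord_recl big_ord0 /b /= !rmorphN !rmorph1 !wN w1; ring.
have two' : 2%:R != 0 :> M by rewrite -(rmorph_nat (in_alg M)) fmorph_eq0.
have [_ [C Cab]] : isoI (fun j => in_alg M (a j)) (fun j => in_alg M (b j)).
  apply: sum_w_iso => //; try by move=> j; rewrite fmorph_eq0.
  by rewrite aS bS; exact: pM.
have iso : isoI (fun ip : 'I_4 * 'I_(\dim {:M}) => a ip.1 * c ip.2)
                (fun ip : 'I_4 * 'I_(\dim {:M}) => b ip.1 * c ip.2).
  split=> //; exists (fun ip jq => B (C ip.1 jq.1 * f ip.2) (f jq.2) / c jq.2).
  move=> [i1 p1] [i2 p2] /=.
  rewrite -(pair_bigA _ (fun j q => B (C i1 j * f p1) (f q) / c q
    * (B (C i2 j * f p2) (f q) / c q) * (b j * c q))) /=.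
  transitivity (\sum_j s (in_alg M (b j) * (C i1 j * f p1 * (C i2 j * f p2)))).
    apply: eq_bigr => j _; rewrite /= -scalerAl mul1r sZ -/(B _ _).
    rewrite (parseval BC BD BZ _ _ of_) mulr_sumr; apply: eq_bigr => q _.
    by field; exact: c0.
  have s0 : s 0 = 0 by rewrite -(scale0r 0) sZ mul0r.
  rewrite -(big_morph s sD s0).
  transitivity (s ((\sum_j C i1 j * C i2 j * in_alg M (b j)) * (f p1 * f p2))).
    by rewrite mulr_suml; congr s; apply: eq_bigr => j _; ring.
  rewrite Cab mulrnAl; have := ff p1 p2; rewrite /B => e.
  rewrite /= -mulrnAr -scalerAl mul1r sZ xpair_eqE.
  by case: (i1 == i2); rewrite ?mulr1n ?mulr0n ?s0 ?mulr0 //= e mulrnAr.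
have := iso_sum_w _ _ iso.
have sumM (e : 'I_4 -> k) : \sum_(ip : 'I_4 * 'I_(\dim {:M})) w (e ip.1 * c ip.2)
    = (\sum_j w (e j)) * \sum_p w (c p).
  rewrite big_distrlr /= pair_bigA; apply: eq_bigr => -[j p] _ /=; exact: wM.
rewrite !sumM (aS _ idfun) (bS _ idfun) mul0r => H.
have {H}: pf u v * \sum_p w (c p) = 0.
  by apply: H => -[j p]; rewrite mulf_neq0.
rewrite mulr_sumr (eq_bigr (fun=> pf u v)) => [|p _]; last exact: pf_univ.
rewrite sumr_const card_ord -(odd_double_half (\dim {:M})) oddM -mul2n mulrnDr mulrnA.
have -> : pf u v *+ 2 = 0.
  rewrite mulr2n -{1}(pf_univ k5 u0 v0 (_ : -1 != 0)) ?oppr_eq0 ?oner_eq0 //.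
  by rewrite wN w1 mulrN1 addNr.
by rewrite mul0rn addr0.
Qed.

End Springer.

(** * Trace forms of Galois extensions *)

Section Gram.

Variables (k F : fieldType) (iota : {rmorphism k -> F}).

(* Two orthogonal bases of the same form are compared through the matrices of
   their conjugates, so no dimension count is needed. *)
Lemma gram_iso (I I' J : finType) (e : I -> J -> F) (e' : I' -> J -> F)
    (a : I -> k) (a' : I' -> k) (c : I -> I' -> k) :
  #|I| = #|J| -> #|I'| = #|J| -> (forall i, a' i != 0) ->
  (forall i i2, \sum_j e i j * e i2 j = iota (a i) *+ (i == i2)) ->
  (forall i i2, \sum_j e' i j * e' i2 j = iota (a' i) *+ (i == i2)) ->
  (forall i i', \sum_j e i j * e' i' j = iota (c i i')) -> isoI a a'.
Proof.
move=> IJ I'J a'0 ee ee' ecc; split; first by rewrite IJ.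
have ia0 i : iota (a' i) != 0 by rewrite fmorph_eq0.
have dual : forall j l, \sum_i e' i j * (e' i l / iota (a' i)) = (j == l)%:R.
  apply: (@mul_funs1C F I' J (fun i l => e' i l / iota (a' i)) (fun j i => e' i j)) => // i i2.
  under eq_bigr do rewrite mulrAC; rewrite -mulr_suml ee'.
  by case: eqP => [->|]; rewrite ?mulr1n ?mulr0n ?mul0r // divff.
exists (fun i i' => c i i' / a' i') => i1 i2; apply: (fmorph_inj iota).
rewrite rmorph_sum /= rmorphMn /= -ee.
transitivity (\sum_j \sum_l e i1 j * e i2 l * (\sum_i' e' i' j * (e' i' l / iota (a' i')))).
  transitivity (\sum_i' (\sum_j e i1 j * e' i' j) * (\sum_l e i2 l * e' i' l) / iota (a' i')).
    apply: eq_bigr => i' _; rewrite !ecc -!rmorphM -fmorphV -!rmorphM; congr (iota _).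
    by field.
  under eq_bigr do rewrite big_distrlr /= mulr_suml.
  rewrite exchange_big; apply: eq_bigr => j _.
  under eq_bigr do rewrite mulr_suml; rewrite exchange_big; apply: eq_bigr => l _.
  by rewrite mulr_sumr; apply: eq_bigr => i' _; field; exact: ia0.
apply: eq_bigr => j _; under eq_bigr do rewrite dual.
rewrite (bigD1 j) //= eqxx mulr1 big1 ?addr0 // => l lj.
by rewrite eq_sym (negbTE lj) mulr0.
Qed.

End Gram.

Section Clifford.

Variables (V F : fieldType) (T : V -> V -> F) (W : V -> Prop) (X Y : V -> V).
Variables (b c : F) (x : V).
Hypotheses (two : 2%:R != 0 :> F) (TC : forall u v, T u v = T v u).
Hypotheses (TN : forall u v, T u (- v) = - T u v).
Hypotheses (WX : forall u, W u -> W (X u)) (WY : forall u, W u -> W (Y u)).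
Hypotheses (Xskew : forall u v, W u -> W v -> T (X u) v = - T u (X v)).
Hypotheses (Yskew : forall u v, W u -> W v -> T (Y u) v = - T u (Y v)).
Hypotheses (XX : forall u v, W u -> W v -> T u (X (X v)) = - (b * T u v)).
Hypotheses (YY : forall u v, W u -> W v -> T u (Y (Y v)) = - (c * T u v)).
Hypothesis XY : forall u, W u -> X (Y u) = - Y (X u).
Hypothesis Wx : W x.

Definition clifford_basis (i : 'I_4) := [:: x; X x; Y x; X (Y x)]`_i.
Definition clifford_norm (i : 'I_4) := [:: T x x; b * T x x; c * T x x; b * c * T x x]`_i.

(* The operators X, Y are skew, anticommute and have scalar squares -b, -c, so
   x, Xx, Yx, XYx are orthogonal. *)
Lemma clifford_gram i j :
  T (clifford_basis i) (clifford_basis j) = clifford_norm i *+ (i == j).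
Proof.
have eq0 (u : F) : u = - u -> u = 0.
  move/eqP; rewrite -addr_eq0 -mulr2n -mulr_natl mulf_eq0 (negbTE two) /=.
  by move/eqP.
have sX u : W u -> T u (X u) = 0.
  by move=> Wu; apply: eq0; rewrite -Xskew // TC.
have sY u : W u -> T u (Y u) = 0.
  by move=> Wu; apply: eq0; rewrite -Yskew // TC.
have nX u v : W u -> W v -> T (X u) (X v) = b * T u v.
  by move=> Wu Wv; rewrite (Xskew Wu (WX Wv)) XX // opprK.
have nY u v : W u -> W v -> T (Y u) (Y v) = c * T u v.
  by move=> Wu Wv; rewrite (Yskew Wu (WY Wv)) YY // opprK.
have Wy := WY Wx; have Wxx := WX Wx.
have xxy : T x (X (Y x)) = 0.
  by apply: eq0; rewrite {1}XY // TN -(Yskew Wx Wxx) TC Xskew.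
have xy : T (X x) (Y x) = 0 by rewrite Xskew // xxy oppr0.
have H (m n : 'I_4) : (m < n)%N -> T (clifford_basis m) (clifford_basis n) = 0.
  case: m => [[|[|[|[|//]]]] ?]; case: n => [[|[|[|[|//]]]] ?] //= _; rewrite /clifford_basis /=.
  - exact: sX.
  - exact: sY.
  - by rewrite nX // sY ?mulr0.
  - exact: sX.
have [ij|ij] := eqVneq i j; last first.
  rewrite mulr0n; have [l|l|e] := ltngtP i j; [exact: H | by rewrite TC H |].
  by case/eqP: ij; apply: val_inj.
rewrite {}ij mulr1n; case: j => [[|[|[|[|//]]]] ?]; rewrite /clifford_basis /clifford_norm /= ?nX ?nY //.
by ring.
Qed.

End Clifford.

Section GaloisTrace.

Variables (K : fieldType) (E : splittingFieldType K).
Hypothesis two : 2%:R != 0 :> K.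
Local Notation gT := (gal_of {:E}).
Implicit Types (P J : {group gT}) (s t : gT) (x y : E).

Definition kf P : fieldExtType K := subvs_of (fixedField P).

(** The projection is total; [kin P x] is meaningful when P fixes x, see [kinK]. *)
Definition kin P x : kf P := vsproj (fixedField P) x.

Definition fixed P x := forall s, s \in P -> s x = x.

Lemma fixedE P x : fixed P x <-> x \in fixedField P.
Proof. by split=> [f|/fixedFieldP f]; [apply/fixedFieldP => // | apply: f]; rewrite memvf. Qed.

Lemma kinK P x : fixed P x -> val (kin P x) = x.
Proof. by move/fixedE/vsprojK. Qed.

Lemma val_fixed P (a : kf P) : fixed P (val a).
Proof. by apply/fixedE/subvsP. Qed.

Lemma gM s t x : (s * t)%g x = t (s x).
Proof. by rewrite galM ?memvf. Qed.

Lemma two_kf P : 2%:R != 0 :> kf P.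
Proof. by rewrite -(rmorph_nat (in_alg (kf P))) fmorph_eq0. Qed.

Lemma two_E : 2%:R != 0 :> E.
Proof. by rewrite -(rmorph_nat (in_alg E)) fmorph_eq0. Qed.

Definition vf P : {rmorphism kf P -> E} := vsval.

Lemma vfE P (a : kf P) : vf P a = val a. Proof. by []. Qed.

Lemma fixedD P x y : fixed P x -> fixed P y -> fixed P (x + y).
Proof. by move=> fx fy s sP; rewrite rmorphD /= fx ?fy. Qed.

Lemma fixedM P x y : fixed P x -> fixed P y -> fixed P (x * y).
Proof. by move=> fx fy s sP; rewrite rmorphM /= fx ?fy. Qed.

Lemma actD s x y : s (x + y) = s x + s y. Proof. exact: rmorphD. Qed.
Lemma actN s x : s (- x) = - s x. Proof. exact: rmorphN. Qed.
Lemma actM s x y : s (x * y) = s x * s y. Proof. exact: rmorphM. Qed.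
Lemma actV s x : s x^-1 = (s x)^-1. Proof. exact: fmorphV. Qed.
Lemma actX s x n : s (x ^+ n) = s x ^+ n. Proof. exact: rmorphXn. Qed.
Lemma act1 s : s 1 = 1. Proof. exact: rmorph1. Qed.
Lemma act_nat s n : s n%:R = n%:R. Proof. exact: rmorph_nat. Qed.
Lemma act_eq0 s x : (s x == 0) = (x == 0). Proof. exact: fmorph_eq0. Qed.

Lemma valN P (a : kf P) : val (- a) = - val a. Proof. exact: (rmorphN (vf P)). Qed.
Lemma valM P (a b : kf P) : val (a * b) = val a * val b. Proof. exact: (rmorphM (vf P)). Qed.
Lemma valX P (a : kf P) n : val (a ^+ n) = val a ^+ n. Proof. exact: (rmorphXn (vf P)). Qed.
Lemma val1 P : val (1 : kf P) = 1. Proof. exact: (rmorph1 (vf P)). Qed.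
Lemma val0 P : val (0 : kf P) = 0. Proof. exact: (rmorph0 (vf P)). Qed.
Lemma val_nat P n : val (n%:R : kf P) = n%:R. Proof. exact: (rmorph_nat (vf P)). Qed.
Lemma val_eq0 P (a : kf P) : (val a == 0) = (a == 0). Proof. exact: (fmorph_eq0 (vf P)). Qed.

Definition T P x := \sum_(s in P) s x.

Lemma T_fixed P x : fixed P (T P x).
Proof.
move=> t tP; rewrite /T rmorph_sum /= [RHS](reindex_inj (@mulIg _ t)) /=.
apply: eq_big => [s|s sP]; first by rewrite groupMr.
by rewrite gM.
Qed.

Lemma T_gal P x t : t \in P -> T P (t x) = T P x.
Proof.
move=> tP; rewrite /T [RHS](reindex_inj (@mulgI _ t)) /=.
by apply: eq_big => [s|s sP]; rewrite ?groupMl ?gM.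
Qed.

Lemma TD P x y : T P (x + y) = T P x + T P y.
Proof. by rewrite /T -big_split; apply: eq_bigr => s _; rewrite rmorphD. Qed.

Lemma TN P x : T P (- x) = - T P x.
Proof. by rewrite /T -sumrN; apply: eq_bigr => s _; rewrite rmorphN. Qed.

Lemma T0 P : T P 0 = 0.
Proof. by rewrite /T big1 // => s _; rewrite rmorph0. Qed.

Lemma T_scale P x y : fixed P x -> T P (x * y) = x * T P y.
Proof.
by move=> fx; rewrite /T mulr_sumr; apply: eq_bigr => s sP; rewrite rmorphM /= fx.
Qed.

Lemma T_skew P x t : t \in P -> t x = - x -> T P x = 0.
Proof.
move=> tP tx; have := T_gal x tP; rewrite tx TN => /eqP.
rewrite eq_sym -addr_eq0 -mulr2n -mulr_natl mulf_eq0 (negbTE two_E) /=.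
by move/eqP.
Qed.

(* [e] is an orthogonal basis of E over kf P for the form T P (x ^+ 2), with values
   [a]; [tclass c] says that c is the Witt class of that form. *)
Definition trf P (I : finType) (e : I -> E) (a : I -> kf P) :=
  [/\ #|I| = #|P|, forall i, a i != 0
    & forall i i', T P (e i * e i') = val (a i) *+ (i == i')].

Definition tclass P (c : witt (kf P)) :=
  exists (I : finType) (e : I -> E) (a : I -> kf P), trf e a /\ \sum_i w (a i) = c.

(** Equal Witt classes and equal ranks give an isometry, which carries the known orthogonal family
    to one with the prescribed diagonal values. *)
Lemma tclass_family P c (I' : finType) (a' : I' -> kf P) : tclass c ->
  #|I'| = #|P| -> (forall i, a' i != 0) -> \sum_i w (a' i) = c ->
  exists e', trf e' a'.
Proof.
move=> [I [e [a [[cI a0 ee] <-]]]] cI' a'0 sw.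
have [_ [C Cab]] : isoI a' a by apply: sum_w_iso => //; [exact: two_kf | rewrite cI' cI].
exists (fun i => \sum_j val (C i j) * e j); split=> // i i'.
rewrite big_distrlr /= (big_morph (T P) (TD P) (T0 P)).
transitivity (vf P (\sum_j C i j * C i' j * a j)); last by rewrite Cab rmorphMn.
rewrite rmorph_sum; apply: eq_bigr => j _.
rewrite (big_morph (T P) (TD P) (T0 P)) (bigD1 j) //= big1 => [|l lj].
  rewrite addr0 mulrACA T_scale; last exact/fixedM/val_fixed/val_fixed.
  by rewrite ee eqxx.
rewrite mulrACA T_scale; last exact/fixedM/val_fixed/val_fixed.
by rewrite ee eq_sym (negbTE lj) mulr0.
Qed.

Lemma tclass1 : tclass (1 : witt (kf 1%G)).
Proof.
exists unit, (fun=> 1), (fun=> 1); split; last by rewrite big_const card_unit /= addr0 w1.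
split=> [|u|u u']; [by rewrite card_unit cards1 | exact: oner_neq0 |].
case: u; case: u'; rewrite /T big_set1 gal_id mulr1 eqxx mulr1n.
by rewrite -[RHS]/(vf 1%G 1) rmorph1.
Qed.

End GaloisTrace.

(** * Transfer along a quadratic extension *)

Section Quadratic.

Variables (K : fieldType) (E : splittingFieldType K).
Hypothesis two : 2%:R != 0 :> K.
Local Notation gT := (gal_of {:E}).
Implicit Types (P J : {group gT}) (x y : E).

Lemma fixed_full P (M : {group gT}) : ~~ (P \subset M) -> exists2 x, fixed M x & ~ fixed P x.
Proof.
move=> nPM; have /subvPn[x xM xP] : ~~ (fixedField M <= fixedField P)%VS.
  by apply: contra nPM => /(galS {:E}%AS); rewrite !gal_fixedField.
by exists x; [apply/fixedE | move/fixedE; apply/negP].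
Qed.

Section Char.

Variables (P J : {group gT}) (l : gT -> bool) (s : gT).
Hypotheses (lP : char_on P l) (JE : forall p, (p \in J) = (p \in P) && ~~ l p).
Hypotheses (sP : s \in P) (ls : l s).

Lemma fixed_char x p : fixed J x -> p \in P -> p x = if l p then s x else x.
Proof.
move=> fx pP; case: ifP => lp; last by apply: fx; rewrite JE pP lp.
have : (p * s^-1)%g \in J by rewrite JE groupM ?groupV // lP ?groupV // (charV lP) // lp ls.
by move/fx => e; rewrite -[in LHS](mulgKV s p) gM e.
Qed.

Lemma fixed_charM x p : fixed J x -> p \in P -> p (s x) = if l p then x else s x.
Proof.
move=> fx pP; rewrite -gM fixed_char ?groupM // lP // ls.
by case: (l p).
Qed.

Lemma fixed_s x : fixed J x -> fixed J (s x).
Proof.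
by move=> fx p; rewrite JE => /andP[pP lp]; rewrite fixed_charM // (negbTE lp).
Qed.

Lemma ss x : fixed J x -> s (s x) = x.
Proof. by move=> fx; rewrite fixed_charM ?ls. Qed.

Lemma fixed_T2 x : fixed J x -> fixed P (x + s x).
Proof.
move=> fx p pP; rewrite rmorphD /= fixed_char // fixed_charM //.
by case: ifP; rewrite // addrC.
Qed.

Lemma fixed_N2 x : fixed J x -> fixed P (x * s x).
Proof.
move=> fx p pP; rewrite rmorphM /= fixed_char // fixed_charM //.
by case: ifP; rewrite // mulrC.
Qed.

Lemma T_index2 x : T P x = T J x + s (T J x).
Proof.
rewrite {1}/T (bigID (mem J)) /=; congr (_ + _).
  by rewrite /T; apply: eq_bigl => p; rewrite JE andb_idl // => /andP[].
rewrite /T rmorph_sum /= (reindex_inj (@mulIg _ s)) /=.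
apply: eq_big => [p|p _]; last by rewrite gM.
rewrite !JE groupMr //; case: (boolP (p \in P)) => //= pP.
by rewrite lP // ls addbT negbK.
Qed.

Lemma cardJ2 : #|P| = (2 * #|J|)%N.
Proof.
rewrite -(cardsID J P); have sJP : J \subset P by apply/subsetP => p; rewrite JE => /andP[].
rewrite (setIidPr sJP); have -> : P :\: J = (J :* s)%g.
  apply/setP => p; rewrite mem_rcoset in_setD !JE.
  have [pP|pP] := boolP (p \in P); last by rewrite andbF /= groupMr ?groupV // (negbTE pP).
  by rewrite groupM ?groupV // lP ?groupV // (charV lP) // ls andbT addbT.
by rewrite card_rcoset mul2n addnn.
Qed.

Variable beta : E.
Hypotheses (b0 : beta != 0) (bP : forall p, p \in P -> p beta = if l p then - beta else beta).

Lemma betaJ : fixed J beta.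
Proof. by move=> p; rewrite JE => /andP[pP lp]; rewrite bP // (negbTE lp). Qed.

Lemma sbeta : s beta = - beta. Proof. by rewrite bP // ls. Qed.

Lemma beta2_fixed : fixed P (beta ^+ 2).
Proof. by move=> p pP; rewrite rmorphXn /= bP //; case: ifP; rewrite ?sqrrN. Qed.

Definition tr2 (a : kf J) : kf P := kin P (val a + s (val a)).
Definition nm2 (a : kf J) : kf P := kin P (val a * s (val a)).
Definition sq2 : kf P := kin P (beta ^+ 2).

(* The transfer to kf P of the form <a> over kf J. *)
Definition trw (a : kf J) : witt (kf P) :=
  if tr2 a == 0 then 0 else w (tr2 a) * (1 + w (sq2 * nm2 a)).

Lemma val_tr2 a : val (tr2 a) = val a + s (val a).
Proof. by rewrite kinK //; apply/fixed_T2/val_fixed. Qed.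

Lemma val_nm2 a : val (nm2 a) = val a * s (val a).
Proof. by rewrite kinK //; apply/fixed_N2/val_fixed. Qed.

Lemma val_sq2 : val sq2 = beta ^+ 2.
Proof. by rewrite kinK //; apply: beta2_fixed. Qed.

Lemma nm2_neq0 a : a != 0 -> nm2 a != 0.
Proof. by move=> a0; rewrite -val_eq0 val_nm2 mulf_neq0 ?fmorph_eq0 ?val_eq0. Qed.

Lemma sq2_neq0 : sq2 != 0.
Proof. by rewrite -val_eq0 val_sq2 expf_neq0. Qed.

(** An orthogonal basis of kf J over kf P for the form tr (a x y). If tr a != 0, it consists of 1
    and beta s(a), of norms tr a and beta^2 N(a) tr a. If tr a = 0, then 1 and 1/a are isotropic,
    and 1 + 1/(4 a) and 1 - 1/(4 a) have norms 1 and -1. *)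
Definition tr_vec (a : kf J) (q : bool) : E :=
  if tr2 a == 0 then if q then 1 + (4%:R * val a)^-1 else 1 - (4%:R * val a)^-1
  else if q then 1 else beta * s (val a).

Definition tr_norm (a : kf J) (q : bool) : kf P :=
  if tr2 a == 0 then if q then 1 else -1
  else if q then tr2 a else tr2 a * (sq2 * nm2 a).

Lemma tr_norm_neq0 a q : a != 0 -> tr_norm a q != 0.
Proof.
move=> a0; rewrite /tr_norm; case: ifP => [_|/negbT t0].
  by case: q; rewrite ?oppr_eq0 oner_eq0.
by case: q => //; rewrite !mulf_neq0 ?nm2_neq0 ?sq2_neq0.
Qed.

Lemma tr_norm_sum a : \sum_q w (tr_norm a q) = trw a.
Proof.
rewrite big_bool /= /tr_norm /trw; case: ifP => _; last by rewrite wM mulrDr mulr1.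
by rewrite wN w1 subrr.
Qed.

Lemma tr_vec_fixed a q : fixed J (tr_vec a q).
Proof.
have f1 : fixed J 1 by move=> p _; rewrite rmorph1.
have fa := val_fixed a; have fv : fixed J (4%:R * val a)^-1.
  by move=> p pJ; rewrite fmorphV rmorphM /= rmorph_nat fa.
rewrite /tr_vec; case: ifP => _; case: q => //.
- exact: fixedD.
- by apply: fixedD => // p pJ; rewrite rmorphN /= fv.
- exact: fixedM betaJ (fixed_s fa).
Qed.

Lemma tr_vecP a q q' : a != 0 ->
  let x := val a * (tr_vec a q * tr_vec a q') in
  x + s x = val (tr_norm a q) *+ (q == q').
Proof.
move=> a0; have va0 : val a != 0 by rewrite val_eq0.
have sa := ss (val_fixed a); move=> x; rewrite {}/x /tr_vec /tr_norm; case: ifP => [/eqP t0|_].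
  have sa' : s (val a) = - val a.
    by apply/eqP; rewrite -addr_eq0 addrC -val_tr2 t0 val0.
  have two' := two_E E two; have four : 4%:R != 0 :> E by rewrite (natrM _ 2 2) mulf_neq0.
  move: (val a) va0 sa' => v v0 sv; case: q; case: q'; rewrite !(actD, actM, actN, act1, actV, act_nat) sv ?valN val1 ?mulr1n ?mulr0n;
    field; rewrite ?four ?oppr_eq0 ?v0 //.
case: q; case: q'; rewrite !(actM, act1) ?sbeta ?sa ?valM ?val_tr2 ?val_nm2 ?val_sq2 ?mulr1n ?mulr0n; ring.
Qed.

Lemma trf_tr (I : finType) (e : I -> E) a : trf (P := J) e a ->
  trf (fun iq : I * bool => e iq.1 * tr_vec (a iq.1) iq.2)
      (fun iq : I * bool => tr_norm (a iq.1) iq.2).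
Proof.
move=> [cI a0 ee]; split.
- by rewrite card_prod card_bool cI cardJ2 mulnC.
- by move=> [i q]; apply: tr_norm_neq0.
move=> [i q] [i' q']; rewrite /= xpair_eqE.
rewrite mulrACA [e i * _ * _]mulrC T_index2 T_scale; last exact/fixedM/tr_vec_fixed/tr_vec_fixed.
rewrite ee; have [<-|ii] := eqVneq i i' => /=; last by rewrite mulr0 rmorph0 addr0.
by rewrite mulr1n -tr_vecP // [val _ * _]mulrC.
Qed.

(** The list [r] may be shorter than the rank |J|. Planes <1, -1>, whose transfer vanishes, fill it
    up, which explains the parity condition. *)
Lemma tclass_tr (c : witt (kf J)) (r : seq (kf J)) : tclass c -> (size r <= #|J|)%N ->
  ~~ odd (#|J| - size r) -> all (fun u => u != 0) r -> \sum_(u <- r) w u = c ->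
  tclass (\sum_(u <- r) trw u).
Proof.
move=> tc sr od r0 rc; pose m := (#|J| - size r)./2.
pose r' := r ++ (nseq m 1 ++ nseq m (-1)).
have sr' : size r' = #|J|.
  rewrite !size_cat !size_nseq addnn -[in RHS](subnKC sr); congr (_ + _)%N.
  by rewrite -[RHS]odd_double_half (negbTE od).
have r'0 : all (fun u => u != 0) r'.
  rewrite !all_cat r0 /=; apply/andP; split; apply/allP => u; rewrite mem_nseq => /andP[_ /eqP ->].
    exact: oner_neq0.
  by rewrite oppr_eq0 oner_neq0.
have bign (R : nmodType) (F : kf J -> R) n u : \sum_(y <- nseq n u) F y = F u *+ n.
  by rewrite big_nseq -Monoid.iteropE.
have sw (R : zmodType) (F : kf J -> R) : F (-1) = - F 1 -> \sum_(u <- r') F u = \sum_(u <- r) F u.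
  by move=> FN; rewrite !big_cat /= !bign FN mulNrn subrr addr0.
have tN : trw (-1) = - trw 1.
  have e1 : tr2 (-1) = - tr2 1.
    by apply: val_inj; rewrite valN !val_tr2 valN actN opprD.
  have e2 : nm2 (-1) = nm2 1.
    by apply: val_inj; rewrite !val_nm2 valN actN mulrNN.
  by rewrite /trw e1 e2 oppr_eq0 wN; case: ifP; rewrite ?oppr0 ?mulNr.
have [e' tr'] : exists e', trf (P := J) e' (fun i : 'I_(size r') => r'`_i).
  apply: tclass_family tc _ _ _ => //; first by rewrite card_ord.
    by move=> i; apply: (allP r'0); apply: mem_nth.
  by rewrite -rc -(sw _ (@w _)) ?wN // (big_nth 0) big_mkord.
exists ('I_(size r') * bool)%type, (fun iq : 'I_(size r') * bool => e' iq.1 * tr_vec r'`_iq.1 iq.2),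
  (fun iq : 'I_(size r') * bool => tr_norm r'`_iq.1 iq.2); split; first exact: trf_tr tr'.
rewrite -(pair_bigA _ (fun (i : 'I_(size r')) q => w (tr_norm r'`_i q))) /= -(sw _ trw tN) (big_nth 0) big_mkord.
by apply: eq_bigr => i _; rewrite tr_norm_sum.
Qed.

Definition lift (u : kf P) : kf J := kin J (val u).

Lemma val_lift (u : kf P) : val (lift u) = val u.
Proof.
rewrite kinK // => p; rewrite JE => /andP[pP _]; exact: val_fixed.
Qed.

Lemma lift_neq0 (u : kf P) : (lift u == 0) = (u == 0).
Proof. by rewrite -!val_eq0 val_lift. Qed.

Lemma s_val (u : kf P) : s (val u) = val (u : kf P).
Proof. exact: val_fixed. Qed.

(** Frobenius reciprocity: the trace is multiplied by u and the norm by u^2. *)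
Lemma trw_liftM (u : kf P) a : u != 0 -> trw (lift u * a) = w u * trw a.
Proof.
move=> u0; have e1 : tr2 (lift u * a) = u * tr2 a.
  by apply: val_inj; rewrite valM !val_tr2 valM val_lift actM s_val mulrDr.
have e2 : nm2 (lift u * a) = u ^+ 2 * nm2 a.
  by apply: val_inj; rewrite valM valX !val_nm2 valM val_lift actM s_val; ring.
rewrite /trw e1 e2 mulf_eq0 (negbTE u0) /=; case: ifP => _; first by rewrite mulr0.
by rewrite [sq2 * _]mulrCA w_sqr // wM mulrA.
Qed.

Lemma trw1 : trw 1 = w 2%:R * (1 + w sq2).
Proof.
have e1 : tr2 1 = 2%:R.
  by apply: val_inj; rewrite val_tr2 val1 act1 val_nat.
have e2 : nm2 1 = 1.
  by apply: val_inj; rewrite val_nm2 !val1 act1 mulr1.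
by rewrite /trw e1 e2 mulr1 (negbTE (two_kf two P)).
Qed.

Lemma trw_lift (u : kf P) : u != 0 -> trw (lift u) = w 2%:R * w u * (1 + w sq2).
Proof. by move=> u0; have := trw_liftM 1 u0; rewrite mulr1 trw1 => ->; rewrite mulrA [w u * _]mulrC. Qed.

End Char.

(** For x fixed by the kernel of [l] but not by P, x - t x is nonzero and changes sign exactly
    outside that kernel. *)
Lemma quad_char P l : char_on P l -> (exists2 t, t \in P & l t) ->
  exists2 beta : E, beta != 0 & forall p, p \in P -> p beta = if l p then - beta else beta.
Proof.
move=> lP [t tP lt]; have [M [_ _ ME]] := char_ker lP (ex_intro2 _ _ t tP lt).
have [x fx nfx] : exists2 x, fixed M x & ~ fixed P x.
  by apply: fixed_full; apply/subsetPn; exists t => //; rewrite ME tP lt.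
exists (x - t x).
  rewrite subr_eq0; apply/eqP => e; apply: nfx => p pP.
  by rewrite (fixed_char lP ME tP lt) // -e; case: ifP.
move=> p pP; rewrite rmorphB /= (fixed_char lP ME tP lt fx pP) (fixed_charM lP ME tP lt fx pP).
by case: ifP => _; rewrite ?opprB.
Qed.

End Quadratic.

Lemma trw_pf_ring (R : comNzRingType) (t d c x : R) :
  t * (1 + c) + (- x + (- (t * d * (1 + c)) + (d * x + 0))) =
  (1 - d) * (t * (1 + c)) - (1 - d) * x.
Proof. ring. Qed.

Lemma pf_diff_ring (R : comNzRingType) (d c n : R) :
  (1 - d) * (1 - - c) - (1 - d) * (1 - - (c * n)) = (1 - d) * (1 - n) * c.
Proof. ring. Qed.

Section Transfer.

Variables (K : fieldType) (E : splittingFieldType K).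
Hypothesis two : 2%:R != 0 :> K.
Local Notation gT := (gal_of {:E}).
Implicit Types (P J M : {group gT}) (g h z p q s t : gT) (x y beta gamma : E).
Implicit Types (l : gT -> bool).
Hypothesis k5 : forall P, five_isotropic (kf P).
Hypothesis k2 : forall P, minus_one_two_squares (kf P).

(** The data of the quadratic extension kf J = kf P (beta): [l] is the character of P with kernel J,
    and [s] induces the conjugation. *)
Definition quad P J l s beta :=
  [/\ char_on P l, forall p, (p \in J) = (p \in P) && ~~ l p, s \in P /\ l s, beta != 0
    & forall p, p \in P -> p beta = if l p then - beta else beta].

Lemma quad_max P J : 2.-group%g P -> maximal J P ->
  exists s beta, quad P J (fun p => p \notin J) s beta.
Proof.
move=> tP mJ; have [sJ nJ iJ _] := maximal_2group tP mJ.
have lP : char_on P (fun p => p \notin J) := index2_char nJ iJ.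
have [t tP' tJ] : exists2 t, t \in P & t \notin J.
  by apply/subsetPn; have /maxgroupp/andP[] := mJ.
have [beta b0 bP] := quad_char lP (ex_intro2 _ _ t tP' tJ).
exists t, beta; split=> // p; rewrite negbK; case: (boolP (p \in J)) => pJ.
  by rewrite (subsetP sJ).
by rewrite andbF.
Qed.

Lemma quad_card P J l s beta : quad P J l s beta -> #|P| = (2 * #|J|)%N.
Proof. by case=> lP JE [sP ls] b0 bP; exact: cardJ2 lP JE sP ls. Qed.

Lemma quad_tr P J l s beta (c : witt (kf J)) (r : seq (kf J)) : quad P J l s beta ->
  tclass c -> (size r <= #|J|)%N -> ~~ odd (#|J| - size r) ->
  all (fun u => u != 0) r -> \sum_(u <- r) w u = c ->
  tclass (\sum_(u <- r) trw P s beta u).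
Proof. by case=> lP JE [sP ls] b0 bP; exact: (tclass_tr two lP JE sP ls b0 bP). Qed.

Lemma quad_sq2_neq0 P J l s beta : quad P J l s beta -> sq2 P beta != 0.
Proof. by case=> lP JE [sP ls] b0 bP; exact: sq2_neq0 b0 bP. Qed.

(** J is joined to P by steps of index two. The zero class is represented by the empty list, which
    transfers to the empty list; the intermediate groups have even order because J is nontrivial. *)
Lemma zero_up P J : 2.-group%g P -> J \subset P -> (1 < #|J|)%N ->
  tclass (P := J) 0 -> tclass (P := P) 0.
Proof.
have [n] := ubnP #|P|; elim: n P => // n IH P leP tP sJP J1 t0.
have [eJP|[M mM sJM]] := maximal_exists sJP.
  by have -> : P = J by apply: val_inj; rewrite /= eJP.
have [sMP _ _ cM] := maximal_2group tP mM.
have tM : 2.-group%g M := pgroupS sMP tP.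
have M1 : (1 < #|M|)%N := leq_trans J1 (subset_leq_card sJM).
have tM0 : tclass (P := M) 0.
  by apply: IH => //; move: leP; rewrite -cM; move: M1; lia.
have [s [beta q]] := quad_max tP mM.
have := quad_tr q tM0 (r := [::]); rewrite subn0 !big_nil => /(_ isT); apply => //.
exact: even_card_2group.
Qed.

Lemma pf2 P (u v : kf P) : u != 0 -> v != 0 -> pf u v + pf u v = 0.
Proof.
move=> u0 v0; rewrite -{1}(pf_univ (@k5 P) u0 v0 (_ : -1 != 0)) ?oppr_eq0 ?oner_eq0 //.
by rewrite wN w1 mulrN1 addNr.
Qed.

Lemma w_two P : 2%:R * w (2%:R : kf P) = 2%:R.
Proof.
by have := @w_add (kf P) 1 1; rewrite mulr1 !w1 mulrC => e; exact: esym e.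
Qed.

Lemma w_four P : w (2%:R : kf P) * w 2%:R = 1.
Proof. by rewrite wMM // two_kf. Qed.

Lemma trwN P J l s beta (u : kf J) : quad P J l s beta -> trw P s beta (- u) = - trw P s beta u.
Proof.
case=> lP JE [sP ls] b0 bP; have := trw_liftM lP JE sP ls beta u (_ : -1 != 0 :> kf P).
rewrite oppr_eq0 oner_eq0 wN w1 mulN1r => <- //; congr (trw _ _ _ _).
by apply: val_inj; rewrite valM (val_lift JE) !valN val1 mulN1r.
Qed.

(** The projection formula for quaternion algebras, on norm forms. By Frobenius reciprocity the
    transfer is 1 - <d> times the difference of the transfers of <1> and <u>; this is a difference
    of two Pfister forms with common slot d, which [pf_univ] turns into a single one. If u has trace
    zero, N(u) is a square times -beta^2. *)
Lemma trw_pf P J l s beta (u : kf J) (d : kf P) : quad P J l s beta -> u != 0 -> d != 0 ->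
  \sum_(a <- [:: 1; - u; - lift J d; u * lift J d]) trw P s beta a = pf (nm2 P s u) d.
Proof.
move=> q u0 d0; have [lP JE [sP ls] b0 bP] := q.
have c0 := quad_sq2_neq0 q; set c := sq2 P beta in c0.
have N0 := nm2_neq0 lP JE sP ls u0; set N := nm2 P s u in N0 *.
have vc : val c = beta ^+ 2 := val_sq2 bP.
rewrite !big_cons big_nil !(trwN _ q) [u * _]mulrC (trw_liftM lP JE sP ls) //.
rewrite (trw_lift two lP JE sP ls) // (trw1 two lP JE sP ls) -/c.
have two0 := two_kf two P.
have eD (x y : kf P) : x != 0 -> y != 0 -> (1 - w d) * (w x * (1 + w y)) = pf d (- y).
  move=> x0 y0; have e : (1 - w d) * (1 + w y) = pf d (- y) by rewrite /pf wN opprK.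
  by rewrite mulrCA e mulrC pf_univ ?oppr_eq0.
have -> : w 2%:R * (1 + w c) + (- trw P s beta u + (- (w 2%:R * w d * (1 + w c))
    + (w d * trw P s beta u + 0))) = pf d (- c) - (1 - w d) * trw P s beta u.
  rewrite -(eD 2%:R c) //; move: (w 2%:R) (w d) (w c) (trw _ _ _ _); exact: trw_pf_ring.
rewrite /trw -/c -/N; case: ifP => [/eqP t0|/negbT t0].
  rewrite mulr0 subr0 /pf wN opprK [RHS]mulrC; congr (_ * (1 + _)).
  pose v := kin P (val u / beta).
  have su : s (val u) = - val u.
    by apply/eqP; rewrite -addr_eq0 addrC -(val_tr2 lP JE sP ls) t0 val0.
  have vv : val v = val u / beta.
    rewrite kinK // => p pP; rewrite actM actV bP // (fixed_char lP JE sP ls (val_fixed u) pP).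
    by case: ifP => _; rewrite ?su // invrN mulrNN.
  rewrite (@w_sqr_eq _ N (- c) v) ?wN ?opprK //.
    by rewrite -val_eq0 vv mulf_neq0 ?invr_neq0 // val_eq0.
  apply: val_inj; rewrite valM valX valN vv vc (val_nm2 lP JE sP ls) su.
  by rewrite !mulrN expr_div_n divfK ?expf_neq0 // expr2.
have -> : (1 - w d) * (w (tr2 P s u) * (1 + w (c * N))) = pf d (- (c * N)).
  by rewrite eD // mulf_neq0.
have -> : pf d (- c) - pf d (- (c * N)) = pf d N * w c.
  by rewrite /pf !wN wM; move: (w d) (w c) (w N); exact: pf_diff_ring.
by rewrite pf_univ // /pf mulrC.
Qed.

Lemma T1_neq0 P : 2.-group%g P -> T P (1 : E) != 0.
Proof.
move=> tP; rewrite /T (eq_bigr (fun=> 1)) => [|s _]; last exact: act1.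
rewrite sumr_const; have [n ->] := p_natP tP.
by rewrite natrX expf_neq0 // two_E.
Qed.

(** If x and 1/x are both isotropic, then (x + 1/x)^2 = x^2 + 2 + 1/x^2 shows that x + 1/x has norm
    2 |P|. *)
Lemma anisotropic P z x : 2.-group%g P -> x != 0 -> z x = - x ->
  exists y, [/\ y != 0, z y = - y & T P (y ^+ 2) != 0].
Proof.
move=> tP x0 zx; have T1 := T1_neq0 tP.
have [xx|] := eqVneq (T P (x ^+ 2)) 0; last by exists x.
pose y := x^-1; have zy : z y = - y by rewrite actV zx invrN.
have y0 : y != 0 by rewrite invr_neq0.
have [yy|] := eqVneq (T P (y ^+ 2)) 0; last by exists y.
have e : T P ((x + y) ^+ 2) = 2%:R * T P 1.
  have -> : (x + y) ^+ 2 = x ^+ 2 + 2%:R * 1 + y ^+ 2 by rewrite /y; field.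
  rewrite !TD xx yy T_scale => [|s _]; last exact: act_nat.
  by rewrite add0r addr0.
have t2 : T P ((x + y) ^+ 2) != 0 by rewrite e mulf_neq0 ?two_E.
exists (x + y); split=> //; last by rewrite actD zx zy opprD.
by apply: contraNneq t2 => ->; rewrite expr0n T0.
Qed.

End Transfer.

(** * Classes of noncyclic 2-groups *)

Lemma order8_ring (R : comNzRingType) (n m b c : R) :
  n + (n * b + (n * c + (n * (b * c) + 0))) + (m + (b * m + (c * m + (b * c * m + 0))))
  = (1 - - b) * (1 - - c) * n + (1 - - b) * (1 - - c) * m.
Proof. ring. Qed.

Section NonCyclic.

Variables (K : fieldType) (E : splittingFieldType K).
Hypothesis two : 2%:R != 0 :> K.
Local Notation gT := (gal_of {:E}).
Implicit Types (P J M : {group gT}) (g h z p q s t : gT) (x y beta gamma : E).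
Implicit Types (l : gT -> bool).
Hypothesis k5 : forall P, five_isotropic (kf P).

Definition trB P x y : kf P := kin P (T P (x * y)).

Lemma val_trB P x y : val (trB P x y) = T P (x * y).
Proof. by rewrite kinK //; apply: T_fixed. Qed.

Lemma trBC P x y : trB P x y = trB P y x.
Proof. by rewrite /trB mulrC. Qed.

Lemma trBN P x y : trB P x (- y) = - trB P x y.
Proof. by apply: val_inj; rewrite valN !val_trB mulrN TN. Qed.

Lemma trB_scale P (a : kf P) x y : trB P x (val a * y) = a * trB P x y.
Proof.
apply: val_inj; rewrite valM !val_trB [x * _]mulrCA.
by apply: T_scale; apply: val_fixed.
Qed.

(* The fixed field of the center of P is k(beta, gamma); on the complementary
   eigenspace of the center, X = beta g and Y = gamma h generate a quaternion
   algebra of skew operators. *)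
Lemma order8_zero P : #|P| = 8%N -> ~~ abelian P -> tclass (0 : witt (kf P)).
Proof.
move=> P8 nab.
have tP : 2.-group%g P by rewrite /pgroup P8.
have ncP : ~~ cyclic P by apply: contra nab; apply: cyclic_abelian.
have [J1 [J2 [mJ1 mJ2 J12]]] := noncyclic_maximals tP ncP.
have [[g gJ1 gJ2] iZ sZP] := two_maximals tP mJ1 mJ2 J12.
have [[h hJ2 hJ1] _ _] : [/\ exists2 p, p \in J2 & p \notin J1, #|P : J2 :&: J1|%g = 4%N
    & J2 :&: J1 \subset P].
  by apply: two_maximals tP mJ2 mJ1 _; rewrite eq_sym.
have [sJ1 nJ1 iJ1 cJ1] := maximal_2group tP mJ1.
have [sJ2 nJ2 iJ2 cJ2] := maximal_2group tP mJ2.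
pose Z := (J1 :&: J2)%G.
have half8 (n : nat) : (2 * n = 8)%N -> n = 4%N.
  by move/eqP; rewrite -[8%N]/(2 * 4)%N eqn_pmul2l // => /eqP.
have cZ : #|Z| = 2%N.
  by apply/eqP; rewrite -(eqn_pmul2r (isT : (0 < 4)%N)) -{1}iZ Lagrange ?P8.
have ab4 J : (2 * #|J|)%N = #|P| -> abelian J.
  by move=> cJ; apply: (@card_p2group_abelian _ 2) => //; apply: half8; rewrite cJ.
have abJ1 := ab4 _ cJ1; have abJ2 := ab4 _ cJ2.
have comm1 p q : p \in J1 -> q \in J1 -> (p * q = q * p)%g.
  by move=> pJ qJ; apply: (centsP abJ1).
have comm2 p q : p \in J2 -> q \in J2 -> (p * q = q * p)%g.
  by move=> pJ qJ; apply: (centsP abJ2).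
have gP := subsetP sJ1 _ gJ1; have hP := subsetP sJ2 _ hJ2.
pose z := [~ g, h]%g.
have zZ : z \in Z.
  have zP' : z \in (P^`(1))%g by rewrite derg1 mem_commg.
  by rewrite inE (subsetP (der1_index2 nJ1 iJ1) _ zP') (subsetP (der1_index2 nJ2 iJ2) _ zP').
have /setIP[zJ1 zJ2] := zZ; have zP := subsetP sJ1 _ zJ1.
have z1 : z != 1%g.
  apply: contra nab => /commgP gh.
  have iZ1 : #|J1 : Z|%g = 2%N.
    by apply/eqP; rewrite -(eqn_pmul2l (cardG_gt0 Z)) Lagrange ?subsetIl // cZ (half8 _ (etrans cJ1 P8)).
  have lZ : char_on J1 (fun p => p \notin Z).
    by apply: index2_char => //; apply: index2_normal => //; apply: subsetIl.
  have hcent : <[h]>%g \subset 'C(J1)%g.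
    rewrite cycle_subG; apply/centP => p pJ1; apply/commute_sym.
    have [pZ|pZ] := boolP (p \in Z).
      by have /setIP[_ pJ2] := pZ; apply: comm2.
    have : (p * g^-1)%g \in Z.
      apply: contraT => npg; have := lZ p g^-1%g pJ1 (groupVr gJ1); rewrite npg pZ groupV.
      by rewrite inE gJ1 gJ2.
    case/setIP => _ ch; rewrite -[p](mulgKV g); apply/commute_sym/commuteM.
      exact: comm2.
    exact/commute_sym.
  have <- : (J1 * <[h]>)%g = P.
    by apply: (mulg_normal_maximal nJ1 mJ1); rewrite cycle_subG.
  by rewrite abelianM abJ1 cycle_abelian.
have zz : (z * z = 1)%g by have := expg_cardG zZ; rewrite cZ expgS expg1.
have ZE p : p \in Z -> p = 1%g \/ p = z.
  have -> : Z :=: [set 1%g; z].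
    by apply/esym/eqP; rewrite eqEcard cZ cards2 eq_sym z1 subUset !sub1set group1 zZ.
  by rewrite !inE => /orP[] /eqP ->; [left | right].
have gg : (g * g)%g \in Z.
  by rewrite inE groupM //= -[(g * g)%g]/(g ^+ 2)%g (sqr_in_index2 nJ2 iJ2).
have hh : (h * h)%g \in Z.
  by rewrite inE [_ \in J2]groupM //= andbT -[(h * h)%g]/(h ^+ 2)%g (sqr_in_index2 nJ1 iJ1).
have gh : (g * h = h * g * z)%g by exact: commgC.
(* [eg] and [eh] tell whether g and h have order 4. The character of beta is chosen so that g fixes
   beta exactly when g^2 = z, which makes X^2 = -b on W in either case; likewise for gamma and h.
   The two other values, of [lb] at h and of [lc] at g, are both [e], which gives X Y = - Y X and
   keeps the characters independent. *)
pose eg := (g * g == z)%g; pose eh := (h * h == z)%g; pose e := eg || eh.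
have l2P : char_on P (fun p => p \notin J2) := index2_char nJ2 iJ2.
have l1P : char_on P (fun p => p \notin J1) := index2_char nJ1 iJ1.
have lin (a b : bool) : char_on P (fun p => (a && (p \notin J2)) (+) (b && (p \notin J1))).
  move=> p q pP qP; rewrite l1P // l2P //; case: (a); case: (b) => //=;
  by case: (p \notin J2); case: (p \notin J1); case: (q \notin J2); case: (q \notin J1).
have lbP := lin (~~ eg) e; set lb := (fun p => _) in lbP.
have lcP := lin e (~~ eh); set lc := (fun p => _) in lcP.
have lbg : lb g = ~~ eg by rewrite /lb gJ1 gJ2 /= andbT andbF addbF.
have lbh : lb h = e by rewrite /lb hJ1 hJ2 /= andbT andbF.
have lcg : lc g = e by rewrite /lc gJ1 gJ2 /= andbT andbF addbF.
have lch : lc h = ~~ eh by rewrite /lc hJ1 hJ2 /= andbT andbF.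
have nlb : exists2 t, t \in P & lb t.
  by rewrite /e in lbh; case: (eg) lbg lbh => /= lg lh; [exists h | exists g].
have nlc : exists2 t, t \in P & lc t.
  by rewrite /e in lcg; case: (eh) lch lcg => /= lg lh; [exists g; rewrite ?lh ?orbT | exists h].
have nlbc : exists2 t, t \in P & lb t (+) lc t.
  case E1: eg lbg lbh lcg lch; case E2: eh; rewrite /e E1 E2 /= => a1 a2 a3 a4.
  - by exists g; rewrite // a1 a3.
  - by exists g; rewrite // a1 a3.
  - by exists h; rewrite // a2 a4.
  - by exists g; rewrite // a1 a3.
have [beta b0 bP] := quad_char lbP nlb.
have [gamma c0 cP] := quad_char lcP nlc.
pose b := sq2 P beta; pose c := sq2 P gamma.
have vb : val b = beta ^+ 2 := val_sq2 bP.
have vc : val c = gamma ^+ 2 := val_sq2 cP.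
have [theta [th0 zth mth]] : exists y, [/\ y != 0, z y = - y & T P (y ^+ 2) != 0].
  have [x _ nx] : exists2 x, fixed 1%G x & ~ fixed Z x.
    apply: fixed_full; apply: contra z1 => s1.
    by have := subsetP s1 _ zZ; rewrite inE.
  apply: (@anisotropic _ _ two P z (x - z x)) => //.
    rewrite subr_eq0; apply/eqP => xz; apply: nx => p /ZE[] -> //; exact: gal_id.
  by rewrite actD actN -gM zz gal_id opprB.
(* E is the orthogonal sum of the fixed field of z, with basis 1, beta, gamma, beta gamma, and of
   this eigenspace. *)
pose W x := z x = - x.
have ggW x : W x -> g (g x) = if eg then - x else x.
  move=> Wx; rewrite -gM; case: ifP => [/eqP -> //|].
  by case: (ZE _ gg) => [->|]; [rewrite gal_id | rewrite /eg => ->; rewrite eqxx].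
have hhW x : W x -> h (h x) = if eh then - x else x.
  move=> Wx; rewrite -gM; case: ifP => [/eqP -> //|].
  by case: (ZE _ hh) => [->|]; [rewrite gal_id | rewrite /eh => ->; rewrite eqxx].
have Wg x : W x -> W (g x) by rewrite /W -gM comm1 // gM => ->; rewrite actN.
have Wh x : W x -> W (h x) by rewrite /W -gM comm2 // gM => ->; rewrite actN.
have ghW x : W x -> h (g x) = - g (h x).
  by move=> Wx; rewrite -gM gh (gM _ z) (gM h g); exact: (Wg _ (Wh _ Wx)).
have zchar l : char_on P l -> l z = false.
  by move=> lP; rewrite /z /commg /conjg !lP ?groupM ?groupV // !(charV lP) //; case: (l g); case: (l h).
have zb : z beta = beta by rewrite bP // zchar.
have zc : z gamma = gamma by rewrite cP // zchar.
pose X x := beta * g x; pose Y x := gamma * h x.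
have WX x : W x -> W (X x) by rewrite /X /W actM zb => /Wg ->; rewrite mulrN.
have WY x : W x -> W (Y x) by rewrite /Y /W actM zc => /Wh ->; rewrite mulrN.
have gb : g beta = if eg then beta else - beta by rewrite bP // lbg; case: (eg).
have hc : h gamma = if eh then gamma else - gamma by rewrite cP // lch; case: (eh).
have Xskew x y : W x -> W y -> trB P (X x) y = - trB P x (X y).
  move=> Wx Wy; rewrite -trBN; apply: val_inj; rewrite !val_trB /X -[RHS](T_gal _ gP).
  by rewrite actM actN actM gb (ggW _ Wy); congr (T P _); case: (eg); ring.
have Yskew x y : W x -> W y -> trB P (Y x) y = - trB P x (Y y).
  move=> Wx Wy; rewrite -trBN; apply: val_inj; rewrite !val_trB /Y -[RHS](T_gal _ hP).
  by rewrite actM actN actM hc (hhW _ Wy); congr (T P _); case: (eh); ring.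
have XX x y : W x -> W y -> trB P x (X (X y)) = - (b * trB P x y).
  move=> _ Wy; rewrite -trB_scale -trBN vb; congr (trB P x _).
  by rewrite /X actM gb (ggW _ Wy); case: (eg); ring.
have YY x y : W x -> W y -> trB P x (Y (Y y)) = - (c * trB P x y).
  move=> _ Wy; rewrite -trB_scale -trBN vc; congr (trB P x _).
  by rewrite /Y actM hc (hhW _ Wy); case: (eh); ring.
have XY x : W x -> X (Y x) = - Y (X x).
  move=> Wx; rewrite /X /Y !actM (ghW _ Wx) cP // bP // lcg lbh; case: (e); ring.
pose e1 (i : 'I_4) := [:: 1; beta; gamma; beta * gamma]`_i.
pose n8 : kf P := 8%:R.
pose a1 (i : 'I_4) := [:: n8; n8 * b; n8 * c; n8 * (b * c)]`_i.
pose e2 := clifford_basis X Y theta.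
pose a2 := clifford_norm (trB P) b c theta.
have ze1 i : z (e1 i) = e1 i.
  case: i => [[|[|[|[|//]]]] ?]; rewrite /e1 /=; [exact: act1|exact: zb|exact: zc|].
  by rewrite actM zb zc.
have We2 i : W (e2 i).
  by case: i => [[|[|[|[|//]]]] ?]; rewrite /e2 /clifford_basis /=; auto.
have T1 : T P 1 = val n8.
  rewrite /T (eq_bigr (fun=> 1)) => [|p _]; last exact: act1.
  by rewrite sumr_const P8 val_nat.
have n0 : n8 != 0 by rewrite /n8 (natrX _ 2 3) expf_neq0 // two_kf.
clearbody n8.
have Tchar l x : (exists2 t, t \in P & l t) ->
    (forall p, p \in P -> p x = if l p then - x else x) -> T P x = 0.
  by case=> t tP' lt lx; apply: (T_skew two tP'); rewrite lx // lt.
have Tb : T P beta = 0 by apply: Tchar nlb bP.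
have Tc : T P gamma = 0 by apply: Tchar nlc cP.
have Tbc : T P (beta * gamma) = 0.
  apply: Tchar nlbc _ => p pP; rewrite actM bP // cP //.
  by case: (lb p); case: (lc p) => /=; ring.
have fb : fixed P (beta ^+ 2) by rewrite -vb; apply: val_fixed.
have fc : fixed P (gamma ^+ 2) by rewrite -vc; apply: val_fixed.
have ee1 i j : T P (e1 i * e1 j) = val (a1 i) *+ (i == j).
  have H (m n : 'I_4) : (m < n)%N -> T P (e1 m * e1 n) = 0.
    case: m => [[|[|[|[|//]]]] ?]; case: n => [[|[|[|[|//]]]] ?] //= _; rewrite /e1 /=.
    - by rewrite mul1r.
    - by rewrite mul1r.
    - by rewrite mul1r.
    - by rewrite mulrA -expr2 T_scale // Tc mulr0.
    - by rewrite mulrCA -expr2 mulrC T_scale // Tb mulr0.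
  have [<-|ij] := eqVneq i j; last first.
    rewrite mulr0n; have [l|l|eij] := ltngtP i j; [exact: H | by rewrite mulrC H |].
    by case/eqP: ij; apply: val_inj.
  rewrite mulr1n; case: i => [[|[|[|[|//]]]] ?]; rewrite /e1 /a1 /=.
  - by rewrite mulr1.
  - by rewrite -expr2 -[_ ^+ 2]mulr1 T_scale // T1 -vb mulrC.
  - by rewrite -expr2 -[_ ^+ 2]mulr1 T_scale // T1 -vc mulrC.
  - rewrite -expr2 exprMn -[_ * _]mulr1 T_scale; last exact: fixedM.
    by rewrite T1 -vb -vc mulrC.
have ee2 i j : T P (e2 i * e2 j) = val (a2 i) *+ (i == j).
  rewrite -val_trB -[RHS](rmorphMn (vf P)); congr (val _).
  exact: (clifford_gram (two_kf two P) (@trBC P) (@trBN P) WX WY Xskew Yskew XX YY XY zth).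
have b0' : b != 0 by rewrite -val_eq0 vb expf_neq0.
have c0' : c != 0 by rewrite -val_eq0 vc expf_neq0.
have m0 : trB P theta theta != 0 by rewrite -val_eq0 val_trB -expr2.
set m := trB P theta theta in m0.
exists ('I_4 + 'I_4)%type, (sumf e1 e2), (sumf a1 a2); split; last first.
  rewrite big_sumType /= !big_ord_recl !big_ord0 /a1 /a2 /clifford_norm /= -/m.
  (* Both eigenspaces of z contribute multiples of the same Pfister form; the multipliers are
     absorbed, and twice a Pfister class is zero. *)
  have e8 : pf (- b) (- c) * w n8 + pf (- b) (- c) * w m = 0.
    by rewrite !(pf_univ (@k5 P)) ?oppr_eq0 // (pf2 k5) // oppr_eq0.
  by rewrite -[RHS]e8 /pf !wN !wM; move: (w n8) (w m) (w b) (w c); exact: order8_ring.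
split.
- by rewrite card_sum !card_ord P8.
- case=> -[[|[|[|[|//]]]] ?] /=; rewrite /a1 /a2 /clifford_norm /= ?mulf_neq0 //.
case=> i [] j /=.
- by rewrite ee1.
- by rewrite (T_skew two zP) // actM ze1 We2 mulrN.
- by rewrite (T_skew two zP) // actM ze1 We2 mulNr.
- by rewrite ee2.
Qed.

End NonCyclic.

Lemma pf_expand_ring (R : comNzRingType) (u v : R) :
  1 + (- u + (- v + u * v)) = (1 - u) * (1 - v).
Proof. ring. Qed.

Lemma klein_ring (R : comNzRingType) (t b c : R) : t * t = 1 ->
  t * t * (1 + b) + (t * (t * c) * (1 + b) + 0) = (1 - - b) * (1 - - c).
Proof. by move=> tt; rewrite addr0 mulrA tt; ring. Qed.

Lemma pf_shift_ring (R : comNzRingType) (u v : R) : u * u = 1 ->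
  (1 - u) * (1 - v) = (1 - u) * (1 - - (u * v)).
Proof.
move=> uu; have -> : (1 - u) * (1 - - (u * v)) = 1 - u + u * v - u * u * v by ring.
by rewrite uu; ring.
Qed.

Section NonCyclic2.

Variables (K : fieldType) (E : splittingFieldType K).
Hypothesis two : 2%:R != 0 :> K.
Local Notation gT := (gal_of {:E}).
Implicit Types (P J M : {group gT}) (g h z p q s t : gT) (x y e beta gamma : E).
Implicit Types (l : gT -> bool).
Hypothesis k5 : forall P, five_isotropic (kf P).

(** The sign changes of e define a quadratic character of P; extending this character to a larger
    group makes the slot descend to a smaller field. *)
Definition sqE P (u : kf P) := exists e, val u = e ^+ 2 \/ val u = - e ^+ 2.

Lemma sqEM P (u v : kf P) : sqE u -> sqE v -> sqE (u * v).
Proof.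
move=> [e eu] [f fv]; exists (e * f); rewrite valM exprMn.
by case: eu => ->; case: fv => ->; [left|right|right|left]; ring.
Qed.

Lemma sqEN P (u : kf P) : sqE u -> sqE (- u).
Proof. by move=> [e eu]; exists e; rewrite valN; case: eu => ->; [right | left; ring]. Qed.

Lemma sqE_char J (u : kf J) e : u != 0 -> val u = e ^+ 2 \/ val u = - e ^+ 2 ->
  [/\ e != 0, char_on J (fun p => p e != e)
    & forall p, p \in J -> p e = if p e != e then - e else e].
Proof.
move=> u0 eu; have e0 : e != 0.
  apply: contra u0 => /eqP e0; rewrite -val_eq0; apply/eqP.
  by case: eu => ->; rewrite e0 expr0n ?oppr0.
have sgn p : p \in J -> p e = e \/ p e = - e.
  move=> pJ; have : p e ^+ 2 = e ^+ 2.
    have := val_fixed u pJ; rewrite -actX; case: eu => -> //.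
    by rewrite actN => /oppr_inj.
  by move/eqP; rewrite eqf_sqr => /orP[] /eqP; [left | right].
have Ne : - e != e.
  by rewrite -subr_eq0 -opprD oppr_eq0 -mulr2n -mulr_natl mulf_neq0 ?two_E.
split=> //; last by move=> p /sgn[] ->; rewrite ?eqxx ?Ne.
move=> p q pJ qJ; rewrite gM.
by case: (sgn p pJ) => ->; case: (sgn q qJ) => eq; rewrite ?actN eq ?opprK ?eqxx ?Ne.
Qed.

(** If f is an eigenvector of P for the extended character, e/f is fixed by J, so u is f^2 or -f^2
    up to a square of kf J. *)
Lemma sqE_descend P J l s beta (u : kf J) e l' : quad P J l s beta -> e != 0 ->
  val u = e ^+ 2 \/ val u = - e ^+ 2 ->
  (forall p, p \in J -> p e = if p e != e then - e else e) ->
  char_on P l' -> {in J, forall p, l' p = (p e != e)} ->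
  exists u' : kf P, [/\ u' != 0, sqE u' & w u = w (lift J u')].
Proof.
move=> [lP JE [sP ls] b0 bP] e0 eu eJ l'P l'J.
have [f f0 fP] : exists2 f : E, f != 0 & forall p, p \in P -> p f = if l' p then - f else f.
  have [/exists_inP[t tP lt]|] := boolP [exists t in P, l' t].
    exact: quad_char l'P (ex_intro2 _ _ t tP lt).
  rewrite negb_exists_in => /forall_inP l0; exists 1; first exact: oner_neq0.
  by move=> p pP; rewrite act1 (negbTE (l0 p pP)).
have vv : val (kin J (e / f)) = e / f.
  rewrite kinK // => p pJ; have pP : p \in P by move: pJ; rewrite JE => /andP[].
  rewrite actM actV fP // eJ // l'J //; case: ifP => _ //.
  by rewrite invrN mulrNN.
have vf2 : val (sq2 P f) = f ^+ 2 := val_sq2 fP.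
have v0 : kin J (e / f) != 0 by rewrite -val_eq0 vv mulf_neq0 ?invr_neq0.
have f20 : sq2 P f != 0 by rewrite -val_eq0 vf2 expf_neq0.
case: eu => vu; [exists (sq2 P f) | exists (- sq2 P f)]; split; rewrite ?oppr_eq0 //.
- by exists f; left.
- apply: (@w_sqr_eq _ _ _ (kin J (e / f))) => //; apply: val_inj.
  by rewrite valM valX vv (val_lift JE) vf2 vu expr_div_n divfK ?expf_neq0.
- by exists f; right; rewrite valN vf2.
- apply: (@w_sqr_eq _ _ _ (kin J (e / f))) => //; apply: val_inj.
  by rewrite valM valX vv (val_lift JE) valN vf2 vu expr_div_n mulrN divfK ?expf_neq0.
Qed.

(** Two quadratic steps from the trivial group: the class <2>(1 + <c>) over kf J1 comes from kf P,
    and its transfer is <2><2>(1 + <b>)(1 + <c>), the Pfister form with slots -b and -c. *)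
Lemma klein_class P : #|P| = 4%N -> ~~ cyclic P ->
  exists u v : kf P, [/\ u != 0, v != 0, sqE u, sqE v & tclass (pf u v)].
Proof.
move=> P4 ncP; have tP : 2.-group%g P by rewrite /pgroup P4.
have [J1 [J2 [mJ1 mJ2 J12]]] := noncyclic_maximals tP ncP.
have [s1 [b1 q1]] := quad_max tP mJ1; have [s2 [b2 q2]] := quad_max tP mJ2.
have [[g gJ1 gJ2] iZ sZP] := two_maximals tP mJ1 mJ2 J12.
have cJ1 : #|J1| = 2%N.
  by have := quad_card q1; rewrite P4 -[4%N]/(2 * 2)%N => /eqP; rewrite eqn_pmul2l // => /eqP.
have Z1 : J1 :&: J2 = 1%g.
  apply/eqP; rewrite trivg_card1; have := Lagrange sZP.
  by rewrite /= iZ P4 -[4%N in RHS]mul1n => /eqP; rewrite eqn_pmul2r.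
have [l2P J2E [s2P ls2] b20 b2P] := q2; have [l1P J1E [s1P ls1] b10 b1P] := q1.
have sJ1P : {subset J1 <= P} by move=> p; rewrite J1E => /andP[].
have q : quad J1 1%G (fun p => p \notin J2) g b2.
  split=> // [p p' pJ p'J|p|p pJ]; first by apply: l2P; apply: sJ1P.
    by rewrite negbK; apply/idP/andP => [|[a b]]; rewrite -[1%G : {set gT}]Z1 inE ?a //; case/andP.
  by rewrite b2P ?sJ1P.
have [l2J1 J1E' [gJ1' lg] _ b2J1] := q.
have := quad_tr two q (tclass1 E) (r := [:: 1]); rewrite cards1 !big_seq1 w1.
rewrite /= oner_eq0 => /(_ isT isT isT erefl).
rewrite (trw1 two l2J1 J1E' gJ1' lg) => t1.
pose b := sq2 P b1; pose c := sq2 P b2.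
have vb : val b = b1 ^+ 2 := val_sq2 b1P.
have vc : val c = b2 ^+ 2 := val_sq2 b2P.
have ec : sq2 J1 b2 = lift J1 c.
  by apply: val_inj; rewrite (val_lift J1E) vc (val_sq2 b2J1).
have b0 : b != 0 by rewrite -val_eq0 vb expf_neq0.
have c0 : c != 0 by rewrite -val_eq0 vc expf_neq0.
have l2 : lift J1 (2%:R : kf P) = 2%:R by apply: val_inj; rewrite (val_lift J1E) !val_nat.
have lM (u v : kf P) : lift J1 (u * v) = lift J1 u * lift J1 v.
  by apply: val_inj; rewrite valM !(val_lift J1E) valM.
have two0 := two_kf two P.
pose r := [:: lift J1 (2%:R : kf P); lift J1 (2%:R * c)].
have r0 : all (fun a => a != 0) r by rewrite /= !(lift_neq0 J1E) two0 mulf_neq0.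
have rw : \sum_(a <- r) w a = w 2%:R * (1 + w (sq2 J1 b2)).
  by rewrite !big_cons big_nil lM l2 -ec wM addr0 mulrDr mulr1.
have := quad_tr two q1 t1 (r := r); rewrite cJ1 => /(_ isT isT r0 rw).
rewrite /r !big_cons big_nil.
rewrite (trw_lift two l1P J1E s1P ls1) // (trw_lift two l1P J1E s1P ls1) ?mulf_neq0 //.
rewrite -/b wM klein_ring; last exact: w_four.
move=> t; exists (- b), (- c); split; rewrite ?oppr_eq0 //.
- by exists b1; right; rewrite valN vb.
- by exists b2; right; rewrite valN vc.
- by rewrite /pf !wN.
Qed.

(* For |P : Phi(P)| >= 8 the maximal subgroup J has the same Frattini subgroup,
   so every quadratic character of J extends to P. *)
Lemma reduced_class P : 2.-group%g P -> ~~ cyclic P ->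
  (exists u v : kf P, [/\ u != 0, v != 0, sqE u, sqE v & tclass (pf u v)])
  /\ ((8 <= #|P : 'Phi(P)|%g)%N -> tclass (0 : witt (kf P))).
Proof.
have [n] := ubnP #|P|; elim: n P => // n IH P leP tP ncP.
have pow2 (A : {group gT}) : A \subset P -> exists m, #|P : A|%g = (2 ^ m)%N.
  by move=> sA; have [m ->] := p_natP (pnat_dvd (dvdn_indexg P A) tP); exists m.
have IHJ J : maximal J P -> ~~ cyclic J ->
  (exists u v : kf J, [/\ u != 0, v != 0, sqE u, sqE v & tclass (pf u v)])
  /\ ((8 <= #|J : 'Phi(J)|%g)%N -> tclass (0 : witt (kf J))).
  move=> mJ; have [sJ _ _ cJ] := maximal_2group tP mJ; apply: IH; last exact: pgroupS sJ tP.
  rewrite -ltnS (leq_trans _ leP) // ltnS -cJ -[X in (X < _)%N]mul1n ltn_mul2r.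
  by rewrite cardG_gt0.
have Phi4 J : 2.-group%g J -> ~~ cyclic J -> (4 <= #|J : 'Phi(J)|%g)%N.
  move=> tJ ncJ; have [A [B [mA mB AB]]] := noncyclic_maximals tJ ncJ.
  have [_ <- sAB] := two_maximals tJ mA mB AB; apply: dvdn_leq; first exact: indexg_gt0.
  have sPhi : 'Phi(J)%g \subset A :&: B by rewrite subsetI !Phi_sub_max.
  by rewrite -(Lagrange_index sAB sPhi) dvdn_mulr.
have Phi48 J : 2.-group%g J -> ~~ cyclic J -> (#|J : 'Phi(J)|%g < 8)%N -> #|J : 'Phi(J)|%g = 4%N.
  move=> tJ ncJ; have := Phi4 J tJ ncJ.
  have [m ->] := p_natP (pnat_dvd (dvdn_indexg J 'Phi(J)%G) tJ).
  by case: m => [|[|[|m]]] //; rewrite !expnS; have := expn_gt0 2 m; lia.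
split.
  have [P8|P8] := ltnP #|P| 8.
    apply: klein_class => //; have := Phi4 P tP ncP; have := dvdn_leq (cardG_gt0 P) (dvdn_indexg P 'Phi(P)%G).
    have [m em] := p_natP tP; rewrite em in P8 *; case: m em P8 => [|[|[|m]]] em //=.
    - by move=> _ h1 h2; have := leq_trans h2 h1.
    - by move=> _ h1 h2; have := leq_trans h2 h1.
    - by rewrite !expnS; have := expn_gt0 2 m; lia.
  have [/existsP[J /andP[mJ ncJ]]|allc] := boolP [exists J : {group gT}, maximal J P && ~~ cyclic J];
    last first.
    have [|e8 nab] := all_maximal_cyclic tP P8 ncP.
      move=> J mJ; apply: contraT => ncJ; case/negP: allc; apply/existsP; exists J.
      by rewrite mJ.
    exists 1, 1; rewrite !oner_eq0; split=> //; try by exists 1; left; rewrite val1 expr1n.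
    by rewrite /pf w1 subrr mul0r; apply: order8_zero.
  have [sJ nJ iJ cJ] := maximal_2group tP mJ; have tJ := pgroupS sJ tP.
  have J1 : (1 < #|J|)%N by move: P8; rewrite -cJ; case: #|J| => [|[|]].
  have [[u [v [u0 v0 su sv tuv]]] z8] := IHJ J mJ ncJ.
  have [J8|/(Phi48 J tJ ncJ) J4] := leqP 8 #|J : 'Phi(J)|%g.
    exists 1, 1; rewrite !oner_eq0; split=> //; try by exists 1; left; rewrite val1 expr1n.
    by rewrite /pf w1 subrr mul0r; apply: (zero_up two tP sJ J1 (z8 J8)).
  have [M mM MJ] : exists2 M : {group gT}, maximal M P & J != M.
    have [A [B [mA mB AB]]] := noncyclic_maximals tP ncP.
    by have [->|?] := eqVneq J A; [exists B | exists A].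
  have [sM nM iM cM] := maximal_2group tP mM.
  have lMP : char_on P (fun p => p \notin M) := index2_char nM iM.
  have [[g gJ gM'] iD sD] := two_maximals tP mJ mM MJ.
  pose D := (J :&: M)%G; have sDJ : D \subset J := subsetIl J M.
  have iJD : #|J : D|%g = 2%N.
    have := Lagrange_index sJ sDJ; rewrite /= iJ iD => /eqP.
    by rewrite -[4%N]/(2 * 2)%N eqn_pmul2l // => /eqP.
  have lDJ : char_on J (fun p => p \notin D).
    exact: index2_char (index2_normal sDJ iJD) iJD.
  have sPhiD : 'Phi(J)%g \subset D.
    apply/subsetP => p pPhi; have := char_Phi lDJ pPhi.
    by move/negbFE.
  have iDPhi : #|D : 'Phi(J)|%g = 2%N.
    have := Lagrange_index sDJ sPhiD; rewrite iJD J4 => /eqP.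
    by rewrite -[4%N]/(2 * 2)%N eqn_pmul2l // => /eqP.
  have lPhiD : char_on D (fun p => p \notin 'Phi(J)%G).
    exact: index2_char (index2_normal sPhiD iDPhi) iDPhi.
  (* A character of J trivial on this j extends to P, so a slot descends as soon as j fixes its
     square root e. *)
  have [j jD jPhi] : exists2 j, j \in D & j \notin 'Phi(J)%g.
    by apply/subsetPn; apply/negP => sDPhi; have := indexgS D sDPhi; rewrite /= iDPhi indexgg.
  have jJ := subsetP sDJ _ jD.
  (* a character of J trivial on j is trivial or induced by M *)
  have extend (x : gT -> bool) : char_on J x -> x j = false ->
      exists2 l', char_on P l' & {in J, forall p, l' p = x p}.
    move=> xJ xj; have xD p : p \in D -> x p = false.
      move=> pD; have pJ := subsetP sDJ _ pD.
      have [pPhi|pPhi] := boolP (p \in 'Phi(J)%G); first exact: char_Phi xJ pPhi.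
      have : (p * j)%g \in 'Phi(J)%G.
        by have := lPhiD p j pD jD; rewrite pPhi jPhi => /negbFE.
      by move/(char_Phi xJ); rewrite xJ // xj addbF.
    have gD : g \notin D by rewrite inE gJ.
    exists (fun p => x g && (p \notin M)).
      by move=> p q pP qP; rewrite lMP //; case: (x g).
    move=> p pJ; have [pM|pM] := boolP (p \in M).
      by rewrite andbF xD // inE pJ.
    rewrite andbT; have : (p * g^-1)%g \in D.
      have pD : p \notin D by rewrite inE pJ (negbTE pM).
      by have := lDJ p g^-1%g pJ (groupVr gJ); rewrite groupV gD pD => /negbFE.
    by move/xD; rewrite xJ ?groupV // (charV xJ) //; case: (x p); case: (x g).
  have [s [beta q]] := quad_max tP mJ.
  have pfC (a b : kf J) : pf a b = pf b a by rewrite /pf mulrC.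
  have [u1 [d [u10 d0 su1 sd tud]]] : exists (u1 : kf J) (d : kf P),
      [/\ u1 != 0, d != 0, sqE u1, sqE d & tclass (pf u1 (lift J d))].
    have main (a b : kf J) : a != 0 -> b != 0 -> sqE a -> sqE b -> tclass (pf a b) ->
        (exists2 e, val b = e ^+ 2 \/ val b = - e ^+ 2 & j e = e) ->
        exists (u1 : kf J) (d : kf P),
          [/\ u1 != 0, d != 0, sqE u1, sqE d & tclass (pf u1 (lift J d))].
      move=> a0 b0 sa sb tab [e be je]; have [e0 eJ1 eJ2] := sqE_char b0 be.
      have [|l' l'P l'J] := extend _ eJ1; first by rewrite je eqxx.
      have [d [d0 sd wd]] := sqE_descend q e0 be eJ2 l'P l'J.
      by exists a, d; split=> //; rewrite /pf -wd.
    have [eu vu] := su; have [ev vv] := sv.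
    have [_ _ cu] := sqE_char u0 vu; have [_ _ cv] := sqE_char v0 vv.
    have [je|jv] := eqVneq (j ev) ev; first by apply: (main u v) => //; exists ev.
    have [je|ju] := eqVneq (j eu) eu.
      by apply: (main v u) => //; [rewrite pfC | exists eu].
    (* If j changes the sign of both roots, it fixes their product, and the slot - u v may replace
       v. *)
    have puv : pf u v = pf u (- (u * v)).
      by rewrite /pf wN wM; apply: pf_shift_ring; apply: wMM.
    apply: (main u (- (u * v))) => //.
    - by rewrite oppr_eq0 mulf_neq0.
    - exact/sqEN/sqEM.
    - by rewrite -puv.
    exists (eu * ev); last first.
      have := cu j jJ; have := cv j jJ; rewrite ju jv => jv' ju'.
      by rewrite actM jv' ju' mulrNN.
    rewrite valN valM exprMn; case: vu => ->; case: vv => ->.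
    - by right.
    - by left; rewrite mulrN opprK.
    - by left; rewrite mulNr opprK.
    - by right; rewrite mulrNN.
  have N0 : nm2 P s u1 != 0.
    by have [lP JE [sP ls] b0 bP] := q; apply: (nm2_neq0 lP JE sP ls).
  exists (nm2 P s u1), d; split=> //.
    have [lP JE [sP ls] b0 bP] := q; have [e eu] := su1.
    exists (e * s e); left; rewrite (val_nm2 lP JE sP ls).
    by case: eu => ->; rewrite ?actN actX; ring.
  rewrite -(trw_pf two k5 q) //.
  have sz : (4 <= #|J|)%N by move: P8; rewrite -cJ -[8%N]/(2 * 4)%N leq_pmul2l.
  apply: (quad_tr two q tud) => //.
  - rewrite oddB //= addbF; exact: even_card_2group.
  - by have [_ JE _ _ _] := q; rewrite /= !oppr_eq0 oner_eq0 u10 mulf_neq0 ?(lift_neq0 JE) ?d0.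
  - rewrite !big_cons big_nil w1 !wN wM addr0 /pf; move: (w u1) (w (lift J d)).
    exact: pf_expand_ring.
move=> P8; have [J [_ [mJ _ _]]] := noncyclic_maximals tP ncP.
have [sJ nJ iJ cJ] := maximal_2group tP mJ; have tJ := pgroupS sJ tP.
have sPhiP : 'Phi(P)%g \subset J := Phi_sub_max mJ.
have J4 : (4 <= #|J : 'Phi(P)|%g)%N.
  have := Lagrange_index sJ sPhiP; rewrite iJ => e; move: P8; rewrite -e.
  by rewrite -[8%N]/(2 * 4)%N leq_pmul2l.
have sPhi : 'Phi(J)%g \subset 'Phi(P)%g := PhiS tP sJ.
have J4' : (4 <= #|J : 'Phi(J)|%g)%N by rewrite (leq_trans J4) // dvdn_leq // indexgS.
have ncJ : ~~ cyclic J.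
  apply/negP => cyJ; have cyQ : cyclic (J / 'Phi(J)) by apply: quotient_cyclic.
  have := cyclic_abelem_prime (Phi_quotient_abelem tJ) cyQ.
  rewrite trivg_card1 card_quotient ?normal_norm ?Phi_normal //.
  by move: J4'; case: #|J : 'Phi(J)|%g => [|[|[|m]]] // _ /(_ isT).
have J1 : (1 < #|J|)%N.
  by rewrite (leq_trans _ (dvdn_leq (cardG_gt0 J) (dvdn_indexg J 'Phi(J)%G))) // (leq_trans _ J4').
have [[u [v [u0 v0 su sv tuv]]] z8] := IHJ J mJ ncJ.
have [J8|/(Phi48 J tJ ncJ) iPhiJ] := leqP 8 #|J : 'Phi(J)|%g.
  exact: (zero_up two tP sJ J1 (z8 J8)).
have ePhi : 'Phi(J)%g = 'Phi(P)%g.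
  apply/eqP; rewrite eqEcard sPhi -(leq_pmul2r (isT : (0 < 4)%N)) -[in X in (_ <= X)%N]iPhiJ.
  by rewrite Lagrange ?Phi_sub // -(Lagrange sPhiP) leq_pmul2l.
have [s [beta q]] := quad_max tP mJ.
have [lP JE [sP ls] b0 bP] := q.
(* P/Phi(P) is elementary abelian and x is trivial on Phi(P), so x is extended by the value 0 at
   s. *)
have extend (x : gT -> bool) : char_on J x ->
    exists2 l', char_on P l' & {in J, forall p, l' p = x p}.
  move=> xJ; have xPhi p : p \in 'Phi(P)%g -> x p = false.
    by rewrite -ePhi; apply: char_Phi xJ.
  have ssPhi : (s * s)%g \in 'Phi(P)%g.
    rewrite (Phi_joing tP); apply: (subsetP (joing_subr _ _)); rewrite -[(s * s)%g]/(s ^+ (2 ^ 1))%g.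
    exact: Mho_p_elt sP (mem_p_elt tP sP).
  have conj p : p \in J -> x (s * p * s^-1)%g = x p /\ (s * p * s^-1)%g \in J.
    move=> pJ; have pP := subsetP sJ _ pJ.
    have cPhi : [~ p, s^-1]%g \in 'Phi(P)%g.
      rewrite (subsetP _ _ (mem_commg pP (groupVr sP))) // -derg1 (Phi_joing tP).
      exact: joing_subl.
    have -> : (s * p * s^-1 = p * [~ p, s^-1])%g by rewrite commgEl conjgE invgK mulKVg mulgA.
    have cJ' := subsetP sPhiP _ cPhi.
    by rewrite xJ // (xPhi _ cPhi) addbF groupM.
  have sV p : p \in P -> p \notin J -> (p * s^-1)%g \in J.
    move=> pP pJ; have := lP p s^-1%g pP (groupVr sP); rewrite groupV pJ ls.
    by move/negbFE.
  exists (fun p => x (if p \in J then p else (p * s^-1)%g)); last by move=> p ->.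
  move=> p r pP rP; have := lP p r pP rP.
  case: (boolP (p \in J)) => pJ; case: (boolP (r \in J)) => rJ /=.
  - by move/negbFE => ->; rewrite xJ.
  - by move/negbTE => ->; rewrite -mulgA xJ // sV.
  - move/negbTE => ->; have [e1 e2] := conj r rJ.
    by rewrite -e1 -(xJ _ _ (sV _ pP pJ) e2) !mulgA mulgKV.
  - move/negbFE => ->; have [e1 e2] := conj _ (sV r rP rJ).
    rewrite -e1 -(xJ _ _ (sV _ pP pJ) e2).
    have -> : (p * r)%g = (p * s^-1 * (s * (r * s^-1) * s^-1) * (s * s))%g.
      by rewrite !mulgA !mulgKV.
    by rewrite (xJ _ _ (groupM (sV _ pP pJ) e2) (subsetP sPhiP _ ssPhi)) (xPhi _ ssPhi) addbF.
have desc (a : kf J) : a != 0 -> sqE a -> exists2 a' : kf P, a' != 0 & w a = w (lift J a').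
  move=> a0 [e ea]; have [e0 eJ1 eJ2] := sqE_char a0 ea; have [l' l'P l'J] := extend _ eJ1.
  by have [d [d0 sd wd]] := sqE_descend q e0 ea eJ2 l'P l'J; exists d.
have [u' u'0 wu] := desc u u0 su; have [v' v'0 wv] := desc v v0 sv.
have lu0 : lift J u' != 0 by rewrite (lift_neq0 JE).
have sz : (4 <= #|J|)%N by rewrite (leq_trans J4') // dvdn_leq ?dvdn_indexg.
have c0 := quad_sq2_neq0 q.
have := quad_tr two q tuv (r := [:: 1; - lift J u'; - lift J v'; lift J u' * lift J v']).
rewrite (trw_pf two k5 q lu0 v'0).
(* Both slots come from kf P, so the norm of the first one is a square. *)
have -> : pf (nm2 P s (lift J u')) v' = 0.
  have eN : nm2 P s (lift J u') = u' ^+ 2.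
    apply: val_inj; rewrite (val_nm2 lP JE sP ls) (val_lift JE) valX.
    by rewrite (val_fixed u') // expr2.
  by rewrite /pf eN w_sq // subrr mul0r.
apply => //.
- rewrite oddB //= addbF; exact: even_card_2group.
- by rewrite /= !oppr_eq0 oner_eq0 lu0 mulf_neq0 ?(lift_neq0 JE) ?v'0.
- rewrite !big_cons big_nil w1 !wN wM addr0 /pf wu wv; exact: pf_expand_ring.
Qed.

End NonCyclic2.

(** * Classes of cyclic 2-groups *)

Lemma cyclic8_ring (R : comNzRingType) (t b m : R) : 4%:R = 0 :> R ->
  2%:R * t = 2%:R -> 2%:R * b = 2%:R -> (1 + t) * (1 + b) = 2%:R + 2%:R * m ->
  t * (1 + b) + 2%:R * m + (1 + t) * (1 + b) = t * (1 + b) + 2%:R.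
Proof.
move=> e4 et eb ->; have -> : t * (1 + b) + 2%:R * m + (2%:R + 2%:R * m)
  = t * (1 + b) + 2%:R + 4%:R * m by ring.
by rewrite e4 mul0r addr0.
Qed.

Lemma cyclic16_ring (R : comNzRingType) (t b m : R) : 4%:R = 0 :> R ->
  t * t = 1 ->
  2%:R * t = 2%:R -> 2%:R * b = 2%:R -> (1 + t) * (1 + b) = 2%:R + 2%:R * m ->
  t * t * (1 + b) + (t * (m * (1 + 1)) + (t * (1 + b) + (t * (1 + b) + 0)))
    = t * (1 + b) + 2%:R.
Proof.
move=> e4 tt et eb e; have bb : t * (1 + b) + t * (1 + b) = 0.
  have -> : t * (1 + b) + t * (1 + b) = 2%:R * t * (1 + b) by ring.
  by rewrite et mulrDr eb mulr1 -natrD.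
rewrite addr0 bb addr0 tt mul1r.
have -> : t * (m * (1 + 1)) = 2%:R * t * m by ring.
rewrite et; have -> : 2%:R * m = (1 + t) * (1 + b) - 2%:R by rewrite e; ring.
have -> : 1 + b + ((1 + t) * (1 + b) - 2%:R) = 2%:R * b + t * (1 + b) by ring.
by rewrite eb addrC.
Qed.

Lemma layer_ring (R : comNzRingType) (m t b : R) :
  m + (t * m + (b * m + (t * b * m + 0))) = (1 - - t) * (1 - - b) * m.
Proof. ring. Qed.

Lemma layer_ring2 (R : comNzRingType) (t b m : R) :
  (1 - - (t * b * m)) * (1 - -1) = 2%:R + 2%:R * t * b * m.
Proof. ring. Qed.

Section Cyclic.

Variables (K : fieldType) (E : splittingFieldType K).
Hypothesis two : 2%:R != 0 :> K.
Local Notation gT := (gal_of {:E}).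
Implicit Types (P J M : {group gT}) (p q r s t : gT) (x y z beta gamma : E).
Hypothesis k5 : forall P, five_isotropic (kf P).
Hypothesis k2 : forall P, minus_one_two_squares (kf P).

Lemma fixed_cycle s z : s z = z -> fixed <[s]>%G z.
Proof.
move=> sz _ /cycleP[i ->]; elim: i => [|i IH]; first exact: gal_id.
by rewrite expgSr gM IH.
Qed.

Lemma cycle2 s : ~~ odd #[s]%g -> [/\ (<[s ^+ 2]> <| <[s]>)%g, #|<[s]> : <[s ^+ 2]>|%g = 2%N,
  char_on <[s]>%G (fun p => p \notin <[s ^+ 2]>%g) & s \notin <[s ^+ 2]>%g].
Proof.
rewrite -dvdn2 => d2; have sub : (<[s ^+ 2]> \subset <[s]>)%g by rewrite cycle_subG mem_cycle.
have i2 : #|<[s]> : <[s ^+ 2]>|%g = 2%N.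
  have c2 : #|<[s]>%g| = (#|<[s ^+ 2]>%g| * 2)%N.
    by rewrite -[#|<[s ^+ 2]>%g|]orderE orderXdiv // divnK.
  by have := Lagrange sub; rewrite c2 => /eqP; rewrite eqn_pmul2l ?cardG_gt0 // => /eqP.
have nM := @index2_normal _ <[s]>%G <[s ^+ 2]>%G sub i2.
split=> //; first exact: (@index2_char _ <[s]>%G <[s ^+ 2]>%G nM i2).
apply/negP => sJ; suff e : (<[s ^+ 2]> = <[s]>)%g by move: i2; rewrite e indexgg.
by apply/eqP; rewrite eqEsubset sub cycle_subG.
Qed.

Lemma quad_cycle s beta : ~~ odd #[s]%g -> beta != 0 -> s beta = - beta ->
  quad <[s]>%G <[s ^+ 2]>%G (fun p => p \notin <[s ^+ 2]>%g) s beta.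
Proof.
move=> os b0 sb; have [nJ iJ lP sJ] := cycle2 os; split=> //.
- by move=> p; rewrite negbK andb_idl // => /(subsetP (normal_sub nJ)).
- by rewrite cycle_id.
have b2 : (s ^+ 2)%g beta = beta by rewrite expgS expg1 gM sb actN sb opprK.
move=> p pP; case: ifP => [pJ|/negbFE pJ]; last by apply: (fixed_cycle b2).
have : (p * s^-1)%g \in <[s ^+ 2]>%g.
  have := lP p s^-1%g pP (groupVr (cycle_id s)); rewrite groupV pJ sJ.
  by move/negbFE.
by move/(fixed_cycle b2) => e; rewrite -(mulgKV s p) gM e.
Qed.

Lemma exists_skew s : ~~ odd #[s]%g -> exists2 x : E, x != 0 & s x = - x.
Proof.
move=> os; have [nJ iJ lP sJ] := cycle2 os.
have [x fx nx] : exists2 x : E, fixed <[s ^+ 2]>%G x & ~ fixed <[s]>%G x.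
  by apply: fixed_full; apply/subsetPn; exists s; rewrite ?cycle_id.
exists (x - s x); first by rewrite subr_eq0 eq_sym; apply/eqP => /fixed_cycle.
have := fx (s ^+ 2)%g (cycle_id _); rewrite expgS expg1 gM => ssx.
by rewrite actD actN ssx opprB.
Qed.

(** The vectors x, 1/x and x + 1/x are tried in turn; if the first two fail, the third one has value
    t 2. *)
Lemma aniso_skew (t : E -> E) r x : (forall x y, t (x + y) = t x + t y) -> t 2%:R != 0 ->
  x != 0 -> r x = - x -> exists y, [/\ y != 0, r y = - y & t (y ^+ 2) != 0].
Proof.
move=> tD t2 x0 rx; have [xx|] := eqVneq (t (x ^+ 2)) 0; last by exists x.
pose y := x^-1; have ry : r y = - y by rewrite actV rx invrN.
have y0 : y != 0 by rewrite invr_neq0.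
have [yy|] := eqVneq (t (y ^+ 2)) 0; last by exists y.
have e : t ((x + y) ^+ 2) = t 2%:R.
  have -> : (x + y) ^+ 2 = x ^+ 2 + 2%:R + y ^+ 2 by rewrite /y; field.
  by rewrite !tD xx yy add0r addr0.
have e' : t ((x + y) ^+ 2) != 0 by rewrite e.
have t0 : t 0 = 0 by have := tD 0 0; rewrite addr0 -[LHS]addr0 => /addrI.
exists (x + y); split=> //; last by rewrite actD rx ry opprD.
by apply: contraNneq e' => ->; rewrite expr0n t0.
Qed.

Lemma T_cycle2 s x : ~~ odd #[s]%g ->
  T <[s]>%G x = T <[s ^+ 2]>%G x + s (T <[s ^+ 2]>%G x).
Proof.
move=> os; have [nJ iJ lP sJ] := cycle2 os.
apply: (T_index2 lP _ (cycle_id s) sJ) => p.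
by rewrite negbK andb_idl // => /(subsetP (normal_sub nJ)).
Qed.

Section Layers.

Variables (s : gT) (beta gamma : E).
Hypotheses (sb : s beta = - beta) (b0 : beta != 0).
Hypotheses (ssg : s (s gamma) = - gamma) (g0 : gamma != 0).

Let P := <[s]>%G.
Let delta := s gamma.
Let b := sq2 P beta.
Let m := kin P (gamma ^+ 2 + delta ^+ 2).
Hypothesis m0 : gamma ^+ 2 + delta ^+ 2 != 0.

Let sg : s gamma = delta. Proof. by []. Qed.
Let sd : s delta = - gamma. Proof. exact: ssg. Qed.

Let vb : val b = beta ^+ 2.
Proof. by rewrite kinK //; apply: fixed_cycle; rewrite actX sb sqrrN. Qed.

Let vm : val m = gamma ^+ 2 + delta ^+ 2.
Proof. by rewrite kinK //; apply: fixed_cycle; rewrite actD !actX sd sqrrN addrC. Qed.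

Let b0' : b != 0. Proof. by rewrite -val_eq0 vb expf_neq0. Qed.
Let m0' : m != 0. Proof. by rewrite -val_eq0 vm. Qed.

(** On the eigenspace s^2 = -1, the families gamma, delta and beta gamma, - beta delta are
    orthogonal for the same form, with norms m, m and b m, b m, whence 2 <m> = 2 <b m>. This is the
    classical condition that b be a sum of two squares when its root lies in a cyclic quartic
    extension. *)
Lemma two_wb : 2%:R * w b = 2%:R.
Proof.
pose e (i : 'I_2) := [:: gamma; delta]`_i.
pose e' (i : 'I_2) := [:: beta * gamma; - (beta * delta)]`_i.
pose ee (i j : 'I_2) := if val j is 0 then e i else s (e i).
pose ee' (i j : 'I_2) := if val j is 0 then e' i else s (e' i).
have [_ iso] : isoI (fun _ : 'I_2 => m) (fun _ : 'I_2 => b * m).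
  apply: (@gram_iso _ _ (vf P) 'I_2 'I_2 'I_2 ee ee' _ _
    (fun i i' => kin P (e i * e' i' + s (e i) * s (e' i')))) => //.
  - by move=> _; rewrite mulf_neq0.
  - case=> [[|[|//]] ?] [[|[|//]] ?]; rewrite !big_ord_recl big_ord0 addr0 /ee /e /= -?val_eqE /= ?mulr1n ?mulr0n -/delta ?sd ?vfE ?vm; ring.
  - case=> [[|[|//]] ?] [[|[|//]] ?]; rewrite !big_ord_recl big_ord0 addr0 /ee' /e' /= -?val_eqE /= ?mulr1n ?mulr0n ?actN ?actM ?sb -/delta ?sd ?vfE ?valM ?vm ?vb; ring.
  - move=> i i'; rewrite !big_ord_recl big_ord0 addr0 /ee /ee' /= vfE kinK //.
    apply: fixed_cycle; rewrite !actD !actM addrC; congr (_ + _).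
    by case: i i' => [[|[|//]] ?] [[|[|//]] ?]; rewrite /e /e' /= ?actN ?actM ?actN ?sb -/delta ?sd ?actN ?sb -/delta ?sd; ring.
have := iso_sum_w (fun=> m0') (fun=> mulf_neq0 b0' m0') (conj erefl iso).
rewrite !big_ord_recl !big_ord0 !addr0 wM -mulr2n -mulrDl -!mulr2n => e1.
have e2 : w m *+ 2 * w m = 2%:R by rewrite mulrnAl wMM.
have e3 : w b *+ 2 * w m * w m = 2%:R * w b by rewrite -mulrA wMM // mulr1 mulr_natl.
by rewrite -e3 -e1 e2.
Qed.

(** The eigenspace s^4 = -1. Products of two of its elements are fixed by s^4, so the sum [t4] over
    1, s, s^2, s^3 takes them into kf P. *)
Let W x := s (s (s (s x))) = - x.
Let t4 z := z + s z + s (s z) + s (s (s z)).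
Let B x y := kin P (t4 (x * y)).
Variable theta : E.
Hypotheses (Wt : W theta) (t0 : t4 (theta ^+ 2) != 0).

Let BC x y : B x y = B y x. Proof. by rewrite /B mulrC. Qed.

Let W4 x y : W x -> W y -> s (s (s (s (x * y)))) = x * y.
Proof. by rewrite /W => Wx Wy; rewrite !actM Wx Wy mulrNN. Qed.

Let t4_fixed x y : W x -> W y -> fixed P (t4 (x * y)).
Proof.
by move=> Wx Wy; apply: fixed_cycle; rewrite /t4 !actD W4 //; ring.
Qed.

Let vB x y : W x -> W y -> val (B x y) = t4 (x * y).
Proof. by move=> Wx Wy; rewrite kinK //; apply: t4_fixed. Qed.

Let Bs x y : W x -> W y -> B (s x) (s y) = B x y.
Proof. by move=> Wx Wy; rewrite /B /t4 -!actM W4 //; congr (kin _ _); ring. Qed.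

Let BN x y : B x (- y) = - B x y.
Proof. by rewrite /B /t4 mulrN !actN -!opprD /kin linearN. Qed.

Let BD x y z : B x (y + z) = B x y + B x z.
Proof. by rewrite /B /kin -linearD; congr (vsproj _ _); rewrite /t4 mulrDr !actD; ring. Qed.

Let BZ (a : kf P) x y : W x -> W y -> B x (val a * y) = a * B x y.
Proof.
move=> Wx Wy; have sa : s (val a) = val a by apply: val_fixed; apply: cycle_id.
have Way : W (val a * y) by rewrite /W !actM !sa Wy mulrN.
by apply: val_inj; rewrite valM !vB // mulrCA /t4 !actM !sa; ring.
Qed.

Let Ws x : W x -> W (s x). Proof. by rewrite /W => ->; rewrite actN. Qed.
Let WN x : W x -> W (- x). Proof. by rewrite /W !actN => ->. Qed.
Let WD x y : W x -> W y -> W (x + y).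
Proof. by rewrite /W !actD => -> ->; rewrite opprD. Qed.
Let Wb x : W x -> W (beta * x).
Proof. by rewrite /W !actM sb !actN !sb !actN !sb !actN !sb !opprK => ->; rewrite mulrN. Qed.
Let Wg x : W x -> W (gamma * x).
Proof. by rewrite /W !actM -/delta sd !actN -/delta sd opprK => ->; rewrite mulrN. Qed.
Let Wd x : W x -> W (delta * x).
Proof. by rewrite /W !actM sd !actN -/delta sd actN opprK => ->; rewrite mulrN. Qed.

Let B1 x y : W x -> W y -> B (s x) y = - B x (s (s (s y))).
Proof.
move=> Wx Wy; have Wz : W (- s (s (s y))) by apply/WN/Ws/Ws/Ws.
have e : s (- s (s (s y))) = y by rewrite actN [s (s (s (s y)))]Wy opprK.
by rewrite -BN -[RHS](Bs Wx Wz) e.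
Qed.

Let B3 x y : W x -> W y -> B (s (s (s x))) y = - B x (s y).
Proof. by move=> Wx Wy; rewrite [LHS]BC [B x _]BC B1 // opprK. Qed.

Let B2 x y : W x -> W y -> B (s (s x)) y = - B x (s (s y)).
Proof.
move=> Wx Wy; have W3 : W (s (s (s y))) by apply/Ws/Ws/Ws.
have e : s (s (s (s (s (s y))))) = - s (s y) by apply: (Ws (Ws Wy)).
by rewrite (B1 (Ws Wx) Wy) (B1 Wx W3) opprK e BN.
Qed.

(** Two pairs of anticommuting skew operators on W, which give two orthogonal families for the same
    form: U^2 = -2 and V^2 = -b, X^2 = -2 b m and I^2 = -1. *)
Let U x := s x + s (s (s x)).
Let V x := beta * s (s x).
Let X x := beta * ((gamma - delta) * s (s (s x)) - (gamma + delta) * s x).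
Let I x := s (s x).

Let WU x : W x -> W (U x). Proof. by move=> Wx; apply: WD; do ?apply: Ws. Qed.
Let WV x : W x -> W (V x). Proof. by move=> Wx; apply: Wb; do ?apply: Ws. Qed.
Let WI x : W x -> W (I x). Proof. by move=> Wx; do ?apply: Ws. Qed.
Let WX x : W x -> W (X x).
Proof.
move=> Wx; rewrite /X mulrBl mulrDl; apply: Wb.
by do ![apply: WD || apply: WN || apply: Wg || apply: Wd || apply: Ws].
Qed.

Let s5 x : W x -> s (s (s (s x))) = - x. Proof. by []. Qed.

Let gram1 i j : B (clifford_basis U V theta i) (clifford_basis U V theta j)
  = clifford_norm B 2%:R b theta i *+ (i == j).
Proof.
apply: (clifford_gram (two_kf two P) BC BN WU WV) => //.
- move=> x y Wx Wy; rewrite BC /U BD [B y _]BC [B y (s (s (s x)))]BC B1 // B3 //.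
  by rewrite BD opprD addrC.
- move=> x y Wx Wy; rewrite /V -BN.
  have -> : B (beta * s (s x)) y = B (s (s x)) (beta * y) by rewrite /B; congr (kin _ (t4 _)); ring.
  by rewrite B2 ?BN ?actM ?sb ?actN ?sb ?opprK //; apply: Wb.
- move=> x y Wx Wy; rewrite -BZ // -BN; congr (B _ _); rewrite val_nat /U !actD.
  by rewrite !(s5 Wy) !actN; ring.
- move=> x y Wx Wy; rewrite -BZ // -BN vb; congr (B _ _).
  by rewrite /V !actM sb actN sb opprK (s5 Wy); ring.
- move=> x Wx; rewrite /U /V !actD !actM !sb !actN !sb !actN !sb (s5 Wx) ?actN; ring.
Qed.

Let gram2 i j : B (clifford_basis X I theta i) (clifford_basis X I theta j)
  = clifford_norm B (2%:R * b * m) 1 theta i *+ (i == j).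
Proof.
apply: (clifford_gram (two_kf two P) BC BN WX WI) => //.
- move=> x y Wx Wy.
  have -> : B (X x) y = B (s (s (s x))) (beta * (gamma - delta) * y)
      + B (s x) (- (beta * (gamma + delta) * y)).
    have := BD 1 (s (s (s x)) * (beta * (gamma - delta) * y)) (s x * - (beta * (gamma + delta) * y)).
    by rewrite /B !mul1r => <-; congr (kin _ (t4 _)); rewrite /X; ring.
  have Wa : W (beta * (gamma - delta) * y).
    rewrite -mulrA mulrBl; apply: Wb.
    by do ![apply: WD || apply: WN || apply: Wg || apply: Wd].
  have Wc : W (- (beta * (gamma + delta) * y)).
    rewrite -mulrA mulrDl; apply/WN/Wb.
    by do ![apply: WD || apply: WN || apply: Wg || apply: Wd].
  rewrite B3 // B1 // -!BN -BD; congr (B _ _).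
  by rewrite /X !(actM, actD, actN, sb, sg, sd); ring.
- move=> x y Wx Wy; rewrite -BZ // -BN; congr (B _ _); rewrite !valM val_nat vb vm /X.
  rewrite !(actM, actD, actN, sb, sg, sd) (s5 Wy) !actN; ring.
- by move=> x y Wx Wy; rewrite /I (s5 Wy) BN mul1r.
- move=> x Wx; rewrite /X /I !(actM, actD, actN, sb, sg, sd) (s5 Wx) !actN; ring.
Qed.

Let basisW (X' Y' : E -> E) i : (forall x, W x -> W (X' x)) -> (forall x, W x -> W (Y' x)) ->
  W (clifford_basis X' Y' theta i).
Proof.
by move=> WX' WY'; case: i => [[|[|[|[|//]]]] ?]; rewrite /clifford_basis /=; auto.
Qed.

Let mu := B theta theta.
Let mu0 : mu != 0.
Proof. by rewrite -val_eq0 vB // -expr2. Qed.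

(** The two orthogonal families diagonalize the same form, so the Pfister forms with slots -2, -b
    and -2 b m, -1 agree up to a common scalar, which [pf_univ] absorbs. The second one is 2 + 2 <2
    b m>, and 2 <2> = 2 <b> = 2. *)
Lemma layer_relation : (1 + w 2%:R) * (1 + w b) = 2%:R + 2%:R * w m.
Proof.
have two0 := two_kf two P.
pose conjs (X' Y' : E -> E) (i j : 'I_4) := (s ^+ j)%g (clifford_basis X' Y' theta i).
have sumB x y : W x -> W y -> \sum_(j < 4) (s ^+ j)%g x * (s ^+ j)%g y = vf P (B x y).
  move=> Wx Wy; rewrite vfE vB // /t4 !actM !big_ord_recr big_ord0 /= add0r.
  by rewrite !expgS !expg0 !mulg1 !gal_id !gM.
have n1 i : clifford_norm B 2%:R b theta i != 0.
  case: i => [[|[|[|[|//]]]] ?]; rewrite /clifford_norm /= -/mu ?mulf_neq0 //.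
have n2 i : clifford_norm B (2%:R * b * m) 1 theta i != 0.
  case: i => [[|[|[|[|//]]]] ?]; rewrite /clifford_norm /= -/mu ?mulf_neq0 ?oner_eq0 //.
have iso : isoI (clifford_norm B 2%:R b theta) (clifford_norm B (2%:R * b * m) 1 theta).
  apply: (@gram_iso _ _ (vf P) _ _ _ (conjs U V) (conjs X I) _ _
    (fun i i' => B (clifford_basis U V theta i) (clifford_basis X I theta i'))) => //.
  - by move=> i i2; rewrite sumB ?gram1 ?rmorphMn //; apply: basisW.
  - by move=> i i2; rewrite sumB ?gram2 ?rmorphMn //; apply: basisW.
  - by move=> i i'; rewrite sumB //; apply: basisW.
have := iso_sum_w n1 n2 iso; rewrite !big_ord_recl !big_ord0 /clifford_norm /= -/mu.
rewrite !wM w1 layer_ring [X in _ = X]layer_ring.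
have p1 : (1 - - w 2%:R) * (1 - - w b) * w mu = (1 + w 2%:R) * (1 + w b).
  have := pf_univ (@k5 P) (x := - 2%:R) (y := - b) (z := mu).
  by rewrite /pf !wN !oppr_eq0 => -> //; rewrite !opprK.
rewrite p1 => ->; have q0 : 2%:R * b * m != 0 by rewrite !mulf_neq0.
have -> : (1 - - (w 2%:R * w b * w m)) * (1 - -1) * w mu
    = (1 - - (w 2%:R * w b * w m)) * (1 - -1).
  have := pf_univ (@k5 P) (x := - (2%:R * b * m)) (y := -1) (z := mu).
  by rewrite /pf !wN !wM w1 !oppr_eq0 oner_eq0; apply.
by rewrite layer_ring2 w_two two_wb.
Qed.

(** For s of order 8 the trace is twice [t4] on products of elements of W, whence the factor 2 in
    the last sum; the Pfister form absorbs it. *)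
Lemma layer_family : exists (e : 'I_4 -> E) (a : 'I_4 -> kf P),
  [/\ forall i, s (s (s (s (e i)))) = - e i, forall i, a i != 0,
      forall i j, e i * e j + s (e i * e j) + s (s (e i * e j)) + s (s (s (e i * e j)))
        = val (a i) *+ (i == j)
    & \sum_i w (2%:R * a i) = (1 + w 2%:R) * (1 + w b)].
Proof.
have two0 := two_kf two P.
have We i : W (clifford_basis U V theta i) by apply: basisW.
exists (clifford_basis U V theta), (clifford_norm B 2%:R b theta); split=> //.
- case=> [[|[|[|[|//]]]] ?]; rewrite /clifford_norm /= -/mu ?mulf_neq0 //.
- by move=> i j; rewrite -[LHS]/(t4 _) -vB // gram1 -[LHS]/(vf P _) rmorphMn.
have p1 : (1 - - w 2%:R) * (1 - - w b) * w (2%:R * mu) = (1 + w 2%:R) * (1 + w b).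
  have := pf_univ (@k5 P) (x := - 2%:R) (y := - b) (z := 2%:R * mu).
  by rewrite /pf !wN !oppr_eq0 => -> //; rewrite ?mulf_neq0 // !opprK.
rewrite -p1 -layer_ring !big_ord_recl !big_ord0 /clifford_norm /= -/mu.
by rewrite !wM; move: (w 2%:R) (w mu) (w b) => t u v; congr (_ + (_ + (_ + (_ + _)))); rewrite mulrCA.
Qed.

End Layers.

End Cyclic.

Lemma class8_ring (R : comNzRingType) (t b m : R) : t * t = 1 -> 2%:R * t = 2%:R ->
  t * (1 + (1 * b + (t * m + (t * m + 0)))) = t * (1 + b) + 2%:R * m.
Proof.
move=> tt et; have -> : t * (1 + (1 * b + (t * m + (t * m + 0)))) =
  t * (1 + b) + 2%:R * (t * t) * m by ring.
by rewrite tt mulr1.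
Qed.

Lemma four_list_ring (R : comNzRingType) (t g : R) :
  t + (t * g + (1 + (1 + 0))) = t * (1 + g) + 2%:R.
Proof. ring. Qed.

Lemma class4_ring (R : comNzRingType) (t b m : R) : 4%:R = 0 :> R ->
  2%:R * t = 2%:R -> 2%:R * b = 2%:R ->
  1 + (1 * b + (t * m + (t * m + 0))) + (1 + (1 * b + (t * m + (t * m + 0)))) = 0.
Proof.
move=> e4 et eb; have -> : 1 + (1 * b + (t * m + (t * m + 0)))
  + (1 + (1 * b + (t * m + (t * m + 0)))) = 2%:R + 2%:R * b + 4%:R * t * m by ring.
by rewrite eb e4 !mul0r addr0 -natrD.
Qed.

Section CyclicClass.

Variables (K : fieldType) (E : splittingFieldType K).
Hypothesis two : 2%:R != 0 :> K.
Local Notation gT := (gal_of {:E}).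
Implicit Types (P J M : {group gT}) (p q r s t : gT) (x y z beta gamma : E).
Hypothesis k5 : forall P, five_isotropic (kf P).
Hypothesis k2 : forall P, minus_one_two_squares (kf P).

Lemma T_cycle1 s x : s = 1%g -> T <[s]>%G x = x.
Proof. by move=> ->; rewrite /T /= cycle1 big_set1 gal_id. Qed.

Lemma order_sqr s (n : nat) : #[s]%g = (2 * n)%N -> #[s ^+ 2]%g = n.
Proof. by move=> os; rewrite orderXdiv os ?dvdn_mulr // mulKn. Qed.

Lemma T_order2 s x : #[s]%g = 2%N -> T <[s]>%G x = x + s x.
Proof.
move=> os; rewrite T_cycle2 ?os // !T_cycle1 //; apply/eqP; rewrite -order_eq1.
by rewrite (@order_sqr s 1) ?os.
Qed.

Lemma act_sqr s x : (s ^+ 2)%g x = s (s x).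
Proof. by rewrite expgS expg1 gM. Qed.

Lemma T_order4 s x : #[s]%g = 4%N -> T <[s]>%G x = x + s x + s (s x) + s (s (s x)).
Proof.
move=> os; rewrite T_cycle2 ?os // !T_order2 ?(@order_sqr s 2) ?os //.
rewrite !act_sqr actD; ring.
Qed.

Lemma T_order8 s x : #[s]%g = 8%N -> s (s (s (s x))) = x ->
  T <[s]>%G x = 2%:R * (x + s x + s (s x) + s (s (s x))).
Proof.
move=> os s4; rewrite T_cycle2 ?os // !T_order4 ?(@order_sqr s 4) ?os //.
rewrite !act_sqr !actD !s4; ring.
Qed.

Lemma exist_gamma s : (4 %| #[s]%g)%N ->
  exists gamma, [/\ gamma != 0, s (s gamma) = - gamma & gamma ^+ 2 + s gamma ^+ 2 != 0].
Proof.
move=> d4; have [n en] := dvdnP d4.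
have os2 : #[s ^+ 2]%g = (n * 2)%N by rewrite (@order_sqr s (n * 2)) // en mulnCA.
have ev2 : ~~ odd #[s ^+ 2]%g by rewrite os2 oddM andbF.
have [x x0 sx] := exists_skew ev2.
have [||||y [y0 sy ny]] := @aniso_skew K E (fun z => z + s z) (s ^+ 2)%g x => //.
- by move=> a c; rewrite actD addrACA.
- have -> : 2%:R + s 2%:R = 2%:R * 2%:R :> E by rewrite act_nat; ring.
  by rewrite mulf_neq0 ?two_E.
by exists y; split; rewrite // -?act_sqr // -actX.
Qed.

Section Gram.

Variables (s : gT) (beta gamma : E).
Hypotheses (sb : s beta = - beta) (b0 : beta != 0).
Hypotheses (ssg : s (s gamma) = - gamma) (m0 : gamma ^+ 2 + s gamma ^+ 2 != 0).

Let P := <[s]>%G.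
Let b := sq2 P beta.
Let m := kin P (gamma ^+ 2 + s gamma ^+ 2).

Lemma val_b : val b = beta ^+ 2.
Proof. by rewrite kinK //; apply: fixed_cycle; rewrite actX sb sqrrN. Qed.

Lemma val_m : val m = gamma ^+ 2 + s gamma ^+ 2.
Proof. by rewrite kinK //; apply: fixed_cycle; rewrite actD !actX ssg sqrrN addrC. Qed.

(** An orthogonal basis of the fixed field of s^4 for the sum over 1, s, s^2, s^3, complementary to
    the eigenspace s^4 = -1. *)
Definition low_basis (i : 'I_4) : E := [:: 1; beta; gamma; s gamma]`_i.
Definition low_norm (i : 'I_4) : kf P := [:: 4%:R; 4%:R * b; 2%:R * m; 2%:R * m]`_i.

Lemma low_gram i j : let z := low_basis i * low_basis j in
  z + s z + s (s z) + s (s (s z)) = val (low_norm i) *+ (i == j).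
Proof.
rewrite /low_basis /low_norm; case: i => [[|[|[|[|//]]]] ?]; case: j => [[|[|[|[|//]]]] ?];
cbn [nth nat_of_ord];
do [rewrite (_ : (_ == _) = true) // mulr1n | rewrite (_ : (_ == _) = false) // mulr0n];
rewrite ?(valM, val_nat, val_b, val_m) !(actM, act1, actN, sb, ssg); ring.
Qed.

Lemma low_neq0 i : low_norm i != 0.
Proof.
have two0 := two_kf two P; have four0 : 4%:R != 0 :> kf P by rewrite (natrX _ 2 2) expf_neq0.
have b0' : b != 0 by rewrite -val_eq0 val_b expf_neq0.
have m0' : m != 0 by rewrite -val_eq0 val_m.
by case: i => [[|[|[|[|//]]]] ?]; rewrite /low_norm /= ?mulf_neq0.
Qed.

Lemma low4 i : s (s (s (s (low_basis i)))) = low_basis i.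
Proof.
case: i => [[|[|[|[|//]]]] ?]; rewrite /low_basis /=.
- by rewrite !act1.
- by do ![rewrite sb | rewrite actN]; rewrite !opprK.
- by do ![rewrite ssg | rewrite actN]; rewrite !opprK.
- by do ![rewrite ssg | rewrite actN]; rewrite !opprK.
Qed.

Lemma low_sum : \sum_i w (low_norm i) = w 4%:R + (w 4%:R * w b + (w 2%:R * w m + (w 2%:R * w m + 0))).
Proof.
rewrite -!wM; transitivity (w 4%:R + (w (4%:R * b) + (w (2%:R * m) + (w (2%:R * m) + 0)))) => //.
by rewrite !big_ord_recl big_ord0.
Qed.

End Gram.

Lemma exist_theta s : (8 %| #[s]%g)%N -> exists theta, s (s (s (s theta))) = - theta /\
  theta ^+ 2 + s (theta ^+ 2) + s (s (theta ^+ 2)) + s (s (s (theta ^+ 2))) != 0.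
Proof.
move=> /dvdnP[n en]; pose r := ((s ^+ 2) ^+ 2)%g.
have rE x : r x = s (s (s (s x))) by rewrite !act_sqr.
have os2 : #[s ^+ 2]%g = (2 * (n * 2))%N by apply: order_sqr; rewrite en -[8%N]/(2 * (2 * 2))%N mulnCA [(n * (2 * 2))%N]mulnCA.
have ev2 : ~~ odd #[r]%g by rewrite (order_sqr os2) oddM andbF.
have [x x0 sx] := exists_skew ev2.
have [||||y [y0 sy ny]] :=
  @aniso_skew K E (fun z => z + s z + s (s z) + s (s (s z))) r x => //.
- by move=> a c; rewrite !actD; ring.
- rewrite !act_nat (_ : _ + _ = (2 ^ 3)%:R); last by ring.
  by rewrite natrX expf_neq0 // two_E.
by exists y; rewrite -rE.
Qed.

Lemma class_order2 s beta : #[s]%g = 2%N -> beta != 0 -> s beta = - beta ->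
  tclass (w 2%:R * (1 + w (sq2 <[s]>%G beta))).
Proof.
move=> os b0 sb; have q := quad_cycle (_ : ~~ odd #[s]%g) b0 sb.
have {q} q := q (_ : ~~ odd #[s]%g); rewrite os in q; have {q} q := q isT.
have s2 : (s ^+ 2 = 1)%g by rewrite -os expg_order.
have t1 : tclass (1 : witt (kf <[s ^+ 2]>%G)).
  have -> : <[s ^+ 2]>%G = 1%G by apply/val_inj; rewrite /= s2 cycle1.
  exact: tclass1.
have c1 : #|<[s ^+ 2]>%G| = 1%N by rewrite /= s2 cycle1 cards1.
have := quad_tr two q t1 (r := [:: 1]); rewrite c1 !big_seq1 w1 [all _ _]/= oner_eq0.
move=> /(_ isT isT isT erefl); have [lP JE [sP ls] _ bP] := q.
by rewrite (trw1 two lP JE sP ls).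
Qed.

(** The low layer is all of E. Its class 1 + <b> + 2 <2 m> has double 2 + 2 <b> + 4 <2 m> = 0. *)
Lemma class_order4 s : #[s]%g = 4%N -> exists2 c, tclass (P := <[s]>%G) c & c + c = 0.
Proof.
move=> os; have e4 := four_eq0 (@k2 <[s]>%G).
have [beta b0 sb] : exists2 x : E, x != 0 & s x = - x by apply: exists_skew; rewrite os.
have [gamma [g0 ssg m0]] : exists gamma, [/\ gamma != 0, s (s gamma) = - gamma & gamma ^+ 2 + s gamma ^+ 2 != 0].
  by apply: exist_gamma; rewrite os.
exists (\sum_i w (low_norm s beta gamma i)).
  exists 'I_4, (low_basis s beta gamma), (low_norm s beta gamma); split=> //; split.
  - by rewrite card_ord -orderE os.
  - exact: low_neq0.
  - by move=> i j; rewrite T_order4 // low_gram.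
have eb := two_wb sb b0 ssg m0.
have e4' : w (4%:R : kf <[s]>%G) = 1 by rewrite (natrM _ 2 2) wM wMM // two_kf.
by rewrite low_sum e4'; apply: class4_ring e4 (w_two _) eb.
Qed.

(** The eigenspaces of s^4 are orthogonal. The fixed field contributes <2>(1 + <b>) + 2 <m>, the
    other one (1 + <2>)(1 + <b>) = 2 + 2 <m> by [layer_relation], and 4 <m> = 0. *)
Lemma class_order8 s beta : #[s]%g = 8%N -> beta != 0 -> s beta = - beta ->
  tclass (w 2%:R * (1 + w (sq2 <[s]>%G beta)) + 2%:R).
Proof.
move=> os b0 sb; have e4 := four_eq0 (@k2 <[s]>%G).
have [gamma [g0 ssg m0]] : exists gamma, [/\ gamma != 0, s (s gamma) = - gamma & gamma ^+ 2 + s gamma ^+ 2 != 0].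
  by apply: exist_gamma; rewrite os.
have [theta [s4t t0]] : exists theta, s (s (s (s theta))) = - theta /\
  theta ^+ 2 + s (theta ^+ 2) + s (s (theta ^+ 2)) + s (s (s (theta ^+ 2))) != 0.
  by apply: exist_theta; rewrite os.
have eb := two_wb sb b0 ssg m0; have two0 := two_kf two <[s]>%G.
have rel := layer_relation two k5 sb b0 ssg m0 s4t t0.
have [e [a [s4e a0 ee sa]]] := layer_family two k5 sb b0 s4t t0.
have P8 : (s ^+ 4)%g \in <[s]>%G by apply: mem_cycle.
have s4E x : (s ^+ 4)%g x = s (s (s (s x))) by rewrite (expgM s 2 2) !act_sqr.
exists ('I_4 + 'I_4)%type, (sumf (low_basis s beta gamma) e),
  (sumf (fun i => 2%:R * low_norm s beta gamma i) (fun i => 2%:R * a i)); split; last first.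
  set m := kin _ _ in rel.
  rewrite big_sumType /= sa -(@cyclic8_ring _ _ _ (w m) e4 (w_two _) eb rel).
  under eq_bigr do rewrite wM; rewrite -mulr_sumr low_sum.
  have -> : w (4%:R : kf <[s]>%G) = 1 by rewrite (natrM _ 2 2) wM wMM.
  congr (_ + _); exact: class8_ring (wMM two0) (w_two _).
split.
- by rewrite card_sum !card_ord -orderE os.
- by case=> i; rewrite mulf_neq0 // low_neq0.
have low4E := low4 sb ssg.
case=> i [] j; [set ij := (i == j) | by rewrite (T_skew two P8) // s4E !actM low4E s4e mulrN
  | by rewrite (T_skew two P8) // s4E !actM low4E s4e mulNr | set ij := (i == j)].
- rewrite T_order8 //; last by rewrite !actM !low4E.
  transitivity (2%:R * (val (low_norm s beta gamma i) *+ (i == j))).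
    by congr (_ * _); exact: low_gram.
  by rewrite -[RHS]/(val (2%:R * low_norm s beta gamma i) *+ (i == j)) valM val_nat mulrnAr.
- rewrite T_order8 //; last by rewrite !actM !s4e mulrNN.
  transitivity (2%:R * (val (a i) *+ (i == j))); first by congr (_ * _); exact: ee.
  by rewrite -[RHS]/(val (2%:R * a i) *+ (i == j)) valM val_nat mulrnAr.
Qed.

(** Transfer from <s^2>, whose class is <2>(1 + <g>) + 2 with g = gamma^2. The trace of g is m and
    its norm is b times a square, so <g> transfers to 2 <m>, which [layer_relation] expresses
    through b. *)
Lemma class_cyclic (j : nat) s beta : #[s]%g = (2 ^ j.+3)%N -> beta != 0 -> s beta = - beta ->
  tclass (w 2%:R * (1 + w (sq2 <[s]>%G beta)) + 2%:R).
Proof.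
elim: j s beta => [|j IH] s beta os b0 sb; first exact: class_order8.
have d8 : (8 %| #[s]%g)%N by rewrite os (dvdn_exp2l 2 (isT : 3 <= j.+4)%N).
have ev : ~~ odd #[s]%g by rewrite os oddX.
have e4 := four_eq0 (@k2 <[s]>%G).
have [gamma [g0 ssg m0]] := exist_gamma (dvdn_trans (isT : 4 %| 8)%N d8).
have [theta [s4t t0]] := exist_theta d8.
have eb := two_wb sb b0 ssg m0; have two0 := two_kf two <[s]>%G.
have rel := layer_relation two k5 sb b0 ssg m0 s4t t0.
have os2 : #[s ^+ 2]%g = (2 ^ j.+3)%N by apply: order_sqr; rewrite os expnS.
have := IH (s ^+ 2)%g gamma os2 g0; rewrite act_sqr => /(_ ssg) t2.
have q := quad_cycle ev b0 sb; have [lP JE [sP ls] _ bP] := q.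
set P := <[s]>%G in rel eb two0 q lP JE sP bP *; set J := <[s ^+ 2]>%G in t2 q JE *.
set b := sq2 P beta in rel eb *; set m := kin P _ in rel.
set g := sq2 J gamma in t2.
have fg : fixed J (gamma ^+ 2) by apply: fixed_cycle; rewrite actX act_sqr ssg sqrrN.
have vg : val g = gamma ^+ 2 by rewrite kinK.
have vm : val m = gamma ^+ 2 + s gamma ^+ 2 by apply: val_m.
have vb : val b = beta ^+ 2 by apply: val_b.
have b0' : b != 0 by rewrite -val_eq0 vb expf_neq0.
have g0' : g != 0 by rewrite -val_eq0 vg expf_neq0.
have l2 : lift J (2%:R : kf P) = 2%:R by apply: val_inj; rewrite (val_lift JE) !val_nat.
have tg : tr2 P s g = m by apply: val_inj; rewrite (val_tr2 lP JE sP ls) vg vm actX.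
(* gamma s(gamma) and beta both change sign under s, so their quotient lies in kf P. *)
pose v := kin P (gamma * s gamma / beta).
have vv : val v = gamma * s gamma / beta.
  by rewrite kinK //; apply: fixed_cycle; rewrite !actM actV sb ssg invrN !mulrN mulNr opprK [s gamma * _]mulrC.
have v0 : v != 0 by rewrite -val_eq0 vv !mulf_neq0 ?invr_neq0 // act_eq0.
have ng : nm2 P s g = v ^+ 2 * b.
  apply: val_inj; rewrite (val_nm2 lP JE sP ls) vg valM valX vv vb actX.
  by rewrite expr_div_n divfK ?expf_neq0 // exprMn.
have trg : trw P s beta g = w m * (1 + 1).
  rewrite /trw tg -val_eq0 vm (negbTE m0) ng -/b mulrCA w_sqr //.
  by rewrite -expr2 w_sq.
have J8 : (4 <= #|J|)%N by rewrite -orderE os2 -[4%N]/(2 ^ 2)%N leq_exp2l.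
have two0J := two_kf two J.
have := quad_tr two q t2 (r := [:: lift J (2%:R : kf P); lift J (2%:R : kf P) * g; 1; 1]).
rewrite !big_cons !big_nil (trw_liftM lP JE sP ls) // (trw_lift two lP JE sP ls) //.
rewrite (trw1 two lP JE sP ls) trg -/b cyclic16_ring //; first last.
- exact: w_two.
- exact: wMM.
apply=> //.
- by rewrite -orderE os2 oddB ?oddX // -os2.
- by rewrite /= l2 two0J oner_eq0 mulf_neq0.
- by rewrite l2 wM w1; exact: four_list_ring.
Qed.

End CyclicClass.

(** * The field component of a Galois algebra *)

(** Independence of characters, by induction on the support of a relation: multiplying it by
    chi_i(x0) and subtracting the result from the relation at x0 x removes i and keeps j. *)
Lemma dedekind (I : finType) (L : nzRingType) (F : fieldType) (chi : I -> L -> F) :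
  (forall i x y, chi i (x * y) = chi i x * chi i y) -> (forall i, chi i 1 = 1) ->
  (forall i j, i != j -> exists x, chi i x != chi j x) ->
  forall u : I -> F, (forall x, \sum_i u i * chi i x = 0) -> forall i, u i = 0.
Proof.
move=> chiM chi1 chiD u; have [n] := ubnP #|[set i | u i != 0]|.
elim: n u => // n IH u un su i; apply/eqP/negPn/negP => ui.
have [j /andP[uj ji]|no] := pickP (fun j => (u j != 0) && (j != i)); last first.
  have := su 1; rewrite (bigD1 i) //= big1 ?addr0 ?chi1 ?mulr1 => [/eqP|k ki].
    by rewrite (negbTE ui).
  by have := no k; rewrite ki andbT => /negbFE/eqP ->; rewrite mul0r.
have [x0 xij] := chiD j i ji.
pose v k := u k * (chi k x0 - chi i x0).
have sv x : \sum_k v k * chi k x = 0.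
  have -> : \sum_k v k * chi k x = \sum_k u k * chi k (x0 * x) - chi i x0 * \sum_k u k * chi k x.
    rewrite mulr_sumr -sumrB; apply: eq_bigr => k _; rewrite /v chiM; ring.
  by rewrite !su mulr0 subr0.
have vn : (#|[set k | v k != 0%R]| < n)%N.
  rewrite -ltnS (leq_trans _ un) // ltnS; apply: proper_card; apply/properP; split.
    by apply/subsetP => k; rewrite !inE /v mulf_eq0 negb_or => /andP[].
  by exists i; rewrite !inE // /v subrr mulr0 eqxx.
have := IH v vn sv j; rewrite /v => /eqP; rewrite mulf_eq0 (negbTE uj) subr_eq0.
by rewrite (negbTE xij).
Qed.

Section Component.

Variables (K Ks : fieldType) (iota : {rmorphism K -> Ks}).
Variables (G : finGroupType) (L : falgType K) (act : G -> {lrmorphism L -> L}).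
Hypothesis galL : is_galois_algebra iota act.

(** The component is one whose idempotent is not killed by [f0]; the kernel of its projection lies
    in the kernel of [f0]. Two elements of G giving the same composite with the projection would act
    alike on [f0], against simple transitivity. *)
Lemma galois_field_component : exists (E : fieldExtType K) (phi : {lrmorphism L -> E}),
  [/\ separable 1 {:E}, forall y, exists x, phi x = y
    & forall g h, g != h -> exists x, phi (act g x) != phi (act h x)].
Proof.
have [[m [E [phi [sep inj surj]]]] _ [act1 actM] [f0] uniq_g] := galL.
have idem i : exists e : L, forall j, phi j e = (j == i)%:R.
  by have [e he] := surj (fun j => (j == i)%:R); exists e.
have [e eP] := fin_all_exists idem.
have e1 : \sum_i e i = 1.
  apply: inj => j; rewrite rmorph_sum rmorph1 (bigD1 j) //= eP eqxx big1 ?addr0 // => i ij.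
  by rewrite eP eq_sym (negbTE ij).
have [i fi] : exists i, f0 (e i) != 0.
  apply/existsP; apply: contraT; rewrite negb_exists => /forallP f00.
  have := oner_neq0 Ks; rewrite -(rmorph1 f0) -e1 rmorph_sum big1 ?eqxx // => i _.
  by have := f00 i; rewrite negbK => /eqP.
have ker x : phi i x = 0 -> f0 x = 0.
  move=> px; have : x * e i = 0.
    apply: inj => j; rewrite rmorphM /= eP rmorph0; case: eqP => [->|_]; last by rewrite mulr0.
    by rewrite px mul0r.
  by move/(congr1 f0)/eqP; rewrite rmorphM rmorph0 mulf_eq0 (negbTE fi) orbF => /eqP.
exists (E i), (phi i); split.
- exact: sep.
- move=> y; have [x hx] := surj (dfwith (fun j => 0 : E j) y).
  by exists x; rewrite hx dfwith_in.
move=> g h gh; apply: boolp.contrapT => /boolp.forallNP no.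
have same x : f0 (act g x) = f0 (act h x).
  have : f0 (act g x - act h x) = 0.
    apply: ker; apply/eqP; rewrite rmorphB subr_eq0.
    by have := no x => /negP; rewrite negbK.
  by move/eqP; rewrite rmorphB subr_eq0 => /eqP.
have [k [_ uk]] := uniq_g f0 f0.
case/eqP: gh; apply/eqP; rewrite eq_mulgV1 -eq_invg1 invMg invgK; apply/eqP.
rewrite -(uk 1%g); last by move=> x /=; rewrite invg1 act1.
apply/esym/uk => x /=; rewrite invMg invgK actM same -actM mulgV; exact/esym/congr1/act1.
Qed.

End Component.

Section Normal.

Variables (K : fieldType) (G : finGroupType) (L : falgType K).
Variables (act : G -> {lrmorphism L -> L}) (E : fieldExtType K) (phi : {lrmorphism L -> E}).
Hypotheses (dimL : \dim {:L} = #|G|) (act1 : forall x, act 1%g x = x).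
Hypothesis actM : forall g h x, act (g * h)%g x = act g (act h x).
Hypotheses (sepE : separable 1 {:E}) (phiS : forall y, exists x, phi x = y).
Hypothesis phiD : forall g h, g != h -> exists x, phi (act g x) != phi (act h x).

Let n := \dim {:L}.
Let e (i : 'I_n) : L := (vbasis {:L})`_i.

Lemma basis_expand x : x = \sum_i coord (vbasis {:L}) i x *: e i.
Proof. exact: coord_vbasis (memvf x). Qed.

(** The matrix of the conjugates of a basis is square, since |G| is the dimension of L, and
    invertible by [dedekind]; [B] is its inverse. *)
Lemma conj_dual : exists B : G -> 'I_n -> E,
  (forall i j, \sum_g phi (act g (e i)) * B g j = (i == j)%:R) /\
  (forall g h, \sum_i B g i * phi (act h (e i)) = (g == h)%:R).
Proof.
have GI : #|G| = #|'I_n| by rewrite card_ord.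
pose r (j : 'I_n) : G := enum_val (cast_ord dimL j).
have rK g : r (cast_ord (esym dimL) (enum_rank g)) = g by rewrite /r cast_ordKV enum_rankK.
have Kr j : cast_ord (esym dimL) (enum_rank (r j)) = j by rewrite /r enum_valK cast_ordK.
pose A : 'M[E]_n := \matrix_(j, i) phi (act (r j) (e i)).
have uA : A \in unitmx.
  rewrite -row_free_unit; apply: inj_row_free => v vA; apply/rowP => j; rewrite mxE.
  have := @dedekind G L E (fun g x => phi (act g x)) _ _ phiD
    (fun g => v 0 (cast_ord (esym dimL) (enum_rank g))) _ (r j).
  rewrite Kr; apply.
  - by move=> g x y; rewrite !rmorphM.
  - by move=> g; rewrite !rmorph1.
  move=> x; rewrite (basis_expand x).
  under eq_bigr do rewrite !linear_sum mulr_sumr.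
  rewrite exchange_big big1 // => i _ /=.
  have := congr1 (fun M : 'rV_n => M 0 i) vA; rewrite !mxE => vi.
  transitivity ((coord (vbasis {:L}) i x)%:A * \sum_j v 0 j * A j i); last by rewrite vi mulr0.
  rewrite mulr_sumr (reindex r) /=; last by exists (fun g => cast_ord (esym dimL) (enum_rank g)) => ? _.
  by apply: eq_bigr => k _; rewrite Kr mxE !linearZ /= -scalerAl mul1r scalerAr.
pose B g (j : 'I_n) := invmx A j (cast_ord (esym dimL) (enum_rank g)).
have e1 i j : \sum_g phi (act g (e i)) * B g j = (i == j)%:R.
  have := congr1 (fun M : 'M_n => M j i) (mulVmx uA); rewrite !mxE eq_sym => <-.
  rewrite (reindex r) /=; last by exists (fun g => cast_ord (esym dimL) (enum_rank g)) => ? _.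
  by apply: eq_bigr => k _; rewrite /B Kr mxE mulrC.
exists B; split=> //.
exact: (@mul_funs1C E 'I_n G (fun i g => phi (act g (e i))) B (esym GI)).
Qed.

(** In the coordinates given by the conjugates, multiplication by x is diagonal with entries phi (g
    x). *)
Lemma trace_sum x : (alg_trace x)%:A = \sum_g phi (act g x).
Proof.
have [B [AB BA]] := conj_dual.
pose M i j := coord (vbasis {:L}) j (x * e i).
have -> : alg_trace x = \sum_i M i i.
  rewrite /alg_trace /mxtrace; apply: eq_bigr => i _; rewrite /passmx.mxof mxE /=.
  rewrite -(passmx.rVofE (vbasisP {:L})) passmx.rVofK ?vbasisP // mxE lfunE.
  by [].
have xe i : x * e i = \sum_j M i j *: e j := basis_expand _.
have AD i g : phi (act g x) * phi (act g (e i)) = \sum_j (M i j)%:A * phi (act g (e j)).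
  have -> : phi (act g x) * phi (act g (e i)) = phi (act g (x * e i)) by rewrite !rmorphM.
  rewrite xe !linear_sum; apply: eq_bigr => j _.
  by rewrite !linearZ /= -scalerAl mul1r.
transitivity (\sum_i \sum_g phi (act g x) * phi (act g (e i)) * B g i).
  rewrite -in_algE rmorph_sum; apply: eq_bigr => i _.
  under eq_bigr do rewrite AD mulr_suml.
  rewrite exchange_big (bigD1 i) //= [X in _ + X]big1 ?addr0 => [|j ji].
    under eq_bigr do rewrite -mulrA.
    by rewrite -mulr_sumr AB eqxx mulr1.
  under eq_bigr do rewrite -mulrA.
  by rewrite -mulr_sumr AB (negbTE ji) mulr0.
rewrite exchange_big; apply: eq_bigr => g _ /=.
under eq_bigr do rewrite -mulrA [phi _ * B _ _]mulrC.
by rewrite -mulr_sumr BA eqxx mulr1.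
Qed.

Lemma trace_neq0 : exists x : L, alg_trace x != 0.
Proof.
have [x nx] : exists x, \sum_g phi (act g x) != 0.
  apply: boolp.contrapT => /boolp.forallNP no.
  have M1 g x y : phi (act g (x * y)) = phi (act g x) * phi (act g y) by rewrite !rmorphM.
  have M2 g : phi (act g 1) = 1 by rewrite !rmorph1.
  have M3 x : \sum_g 1 * phi (act g x) = 0.
    under eq_bigr do rewrite mul1r.
    by have := no x => /negP; rewrite negbK => /eqP.
  have /eqP := @dedekind _ L E (fun g x => phi (act g x)) M1 M2 phiD (fun=> 1) M3 1%g.
  by rewrite oner_eq0.
exists x; apply: contra nx => /eqP t0.
by rewrite -trace_sum t0 scale0r.
Qed.

Lemma trace_nondegenerate (x : L) : x != 0 -> exists y, alg_trace (x * y) != 0.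
Proof.
move=> x0; apply: boolp.contrapT => /boolp.forallNP no; case/eqP: x0.
have tr0 y : \sum_g phi (act g x) * phi (act g y) = 0.
  transitivity ((alg_trace (x * y))%:A : E).
    by rewrite trace_sum; apply: eq_bigr => g _; rewrite !rmorphM.
  by have := no y => /negP; rewrite negbK => /eqP ->; rewrite scale0r.
have [B [AB BA]] := conj_dual.
have x0 g : phi (act g x) = 0.
  transitivity (\sum_i B g i * \sum_h phi (act h x) * phi (act h (e i))); last first.
    by rewrite big1 // => i _; rewrite tr0 mulr0.
  under [RHS]eq_bigr do rewrite mulr_sumr; rewrite exchange_big (bigD1 g) //= [X in _ + X]big1 ?addr0.
    under eq_bigr do rewrite mulrCA.
    by rewrite -mulr_sumr BA eqxx mulr1.
  move=> h hg; under eq_bigr do rewrite mulrCA.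
  by rewrite -mulr_sumr BA eq_sym (negbTE hg) mulr0.
rewrite [LHS]basis_expand big1 // => j _.
suff -> : coord (vbasis {:L}) j x = 0 by rewrite scale0r.
apply: (fmorph_inj (in_alg E)); rewrite rmorph0; transitivity (\sum_g phi (act g x) * B g j); last first.
  by rewrite big1 // => g _; rewrite x0 mul0r.
transitivity (\sum_i in_alg E (coord (vbasis {:L}) i x) * \sum_g phi (act g (e i)) * B g j).
  rewrite (bigD1 j) //= AB eqxx mulr1 big1 ?addr0 // => i ij.
  by rewrite AB (negbTE ij) mulr0.
under eq_bigr do rewrite mulr_sumr; rewrite exchange_big; apply: eq_bigr => g _ /=.
rewrite [in RHS](basis_expand x) !linear_sum mulr_suml; apply: eq_bigr => i _.
by rewrite !linearZ /= mulrA -[_%:A * _]scalerAl mul1r.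
Qed.

(** The trace of c x is y times that of x, so y is a quotient of two elements of K. *)
Lemma conj_const (c : L) y : (forall g, phi (act g c) = y) -> y \in 1%VS.
Proof.
move=> cy; have [x tx] := trace_neq0.
have e1 : (alg_trace (c * x))%:A = y * (alg_trace x)%:A.
  by rewrite !trace_sum mulr_sumr; apply: eq_bigr => g _; rewrite !rmorphM /= cy.
have tx' : (alg_trace x)%:A != 0 :> E by rewrite scaler_eq0 oner_eq0 orbF.
have -> : y = (alg_trace (c * x) / alg_trace x)%:A.
  by rewrite -[y](mulfK tx') -e1 -!in_algE fmorph_div.
by rewrite rpredZ ?mem1v.
Qed.

(** The expression of a coefficient in terms of the roots is computed once in L, uniformly in h. *)
Lemma conj_poly_coef (s : seq L) k : exists c : L, forall h,
  (\prod_(x <- s) ('X - (phi (act h x))%:P))`_k = phi (act h c).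
Proof.
elim: s k => [|x s IH] k.
  exists (k == 0%N)%:R => h; rewrite big_nil coef1 !rmorph_nat //.
have [c1 h1] := IH k.-1; have [c0 h0] := IH k.
exists ((if k == 0%N then 0 else c1) - x * c0) => h.
rewrite big_cons mulrBl coefB coefXM coefCM h0 !rmorphB !rmorphM.
by congr (_ - _); case: k h1 {IH c0 h0} => [|k] h1 /=; rewrite ?rmorph0 ?h1.
Qed.

Definition conj_poly (x : L) : {poly E} := \prod_g ('X - (phi (act g x))%:P).

Lemma conj_poly_over x : conj_poly x \is a polyOver 1%VS.
Proof.
apply/polyOverP => k; have [c hc] := conj_poly_coef [seq act g x | g <- enum G] k.
apply: (@conj_const c) => h; rewrite -hc; congr (polyseq _)`_k.
rewrite big_map big_enum /= /conj_poly [RHS](reindex_inj (mulgI h)) /=.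
by apply: eq_bigr => g _; rewrite actM.
Qed.

(** E is generated by the conjugates of a basis of L. These are the roots of the polynomials
    [conj_poly], whose coefficients take the same value under all conjugates and hence lie in K. *)
Lemma splitting_axiom : splitting_field_axiom E.
Proof.
pose rs := [seq phi (act g (e i)) | i <- enum 'I_n, g <- enum G].
exists (\prod_i conj_poly (e i)).
  by apply: rpred_prod => i _; apply: conj_poly_over.
exists rs.
  rewrite /rs big_allpairs_dep big_enum /=; apply/eqpP.
  exists (1, 1); rewrite ?oner_eq0 //=; congr (_ *: _); apply: eq_bigr => i _.
  by rewrite big_enum.
apply/eqP; rewrite eqEsubv subvf /=; apply/subvP => y _.
have [x <-] := phiS y; rewrite (basis_expand x) linear_sum; apply: memv_suml => i _.
rewrite linearZ; apply: memvZ; apply: seqv_sub_adjoin.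
apply/allpairsP; exists (i, 1%g); rewrite !mem_enum act1; split=> //.
Qed.

(** By [conj_dual] the morphism is a linear combination of the conjugates; were it different from
    all of them, [dedekind] would be contradicted. *)
Lemma morphism_conj (psi : {lrmorphism L -> E}) : exists g, forall x, psi x = phi (act g x).
Proof.
apply: boolp.contrapT => /boolp.forallNP no.
have [B [AB BA]] := conj_dual.
pose chi (o : option G) x : E := if o is Some g then phi (act g x) else psi x.
have D1 g : exists x, phi (act g x) != psi x.
  apply: boolp.contrapT => /boolp.forallNP ng; apply: (no g) => x.
  by apply/esym/eqP; have := ng x => /negP; rewrite negbK.
pose u (o : option G) : E := if o is Some g then \sum_i psi (e i) * B g i else -1.
have uz x : \sum_o u o * chi o x = 0.
  rewrite (bigD1 None) //= (reindex_omap Some id) /=; last by case.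
  have -> : \sum_(g | (Some g != None) && (Some g == Some g)) (\sum_i psi (e i) * B g i) * phi (act g x) = psi x.
    transitivity (\sum_g (\sum_i psi (e i) * B g i) * phi (act g x)).
      by apply: eq_bigl => g; rewrite eqxx.
    rewrite [in RHS](basis_expand x) linear_sum.
    transitivity (\sum_i (coord (vbasis {:L}) i x)%:A * \sum_g (\sum_j psi (e j) * B g j) * phi (act g (e i))).
      under [RHS]eq_bigr do rewrite mulr_sumr; rewrite exchange_big; apply: eq_bigr => g _ /=.
      rewrite [in LHS](basis_expand x) !linear_sum mulr_sumr; apply: eq_bigr => i _.
      by rewrite !linearZ /= -[_%:A * _]scalerAl mul1r scalerAr.
    apply: eq_bigr => i _; rewrite linearZ /= -scalerAl mul1r; congr (_ *: _).
    under eq_bigr do rewrite mulr_suml; rewrite exchange_big (bigD1 i) //= [X in _ + X]big1 ?addr0.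
      under eq_bigr do rewrite -mulrA [B _ _ * _]mulrC.
      by rewrite -mulr_sumr AB eqxx mulr1.
    move=> j ji; under eq_bigr do rewrite -mulrA [B _ _ * _]mulrC.
    by rewrite -mulr_sumr AB eq_sym (negbTE ji) mulr0.
  by rewrite mulN1r addNr.
have M1 o x y : chi o (x * y) = chi o x * chi o y by case: o => [g|] /=; rewrite !rmorphM.
have M2 o : chi o 1 = 1 by case: o => [g|] /=; rewrite !rmorph1.
have M3 o o' : o != o' -> exists x, chi o x != chi o' x.
  case: o o' => [g|] [h|] //= gh; first by apply: phiD; apply: contra gh => /eqP ->.
  by have [x hx] := D1 h; exists x; rewrite eq_sym.
have /eqP := @dedekind _ L E chi M1 M2 M3 u uz None.
by rewrite oppr_eq0 oner_eq0.
Qed.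

End Normal.

Section Package.

Variables (K Ks : fieldType) (iota : {rmorphism K -> Ks}).
Variables (G : finGroupType) (L : falgType K) (act : G -> {lrmorphism L -> L}).
Hypothesis galL : is_galois_algebra iota act.

(** An automorphism t of E composed with phi is a conjugate of phi, which defines rho t. In the
    Galois group s t means s first, whereas in G the right factor acts first, so rho reverses
    products. *)
Theorem galois_component : exists (E : splittingFieldType K) (phi : {lrmorphism L -> E})
    (rho : gal_of {:E} -> G),
  [/\ galois 1 {:E}, forall x, (alg_trace x)%:A = \sum_g phi (act g x),
      forall (t : gal_of {:E}) x, t (phi x) = phi (act (rho t) x), injective rho
    & forall s t : gal_of {:E}, rho (s * t)%g = (rho t * rho s)%g] /\
  forall x : L, x != 0 -> exists y, alg_trace (x * y) != 0.
Proof.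
have [E0 [phi0 [sep phiS phiD]]] := galois_field_component galL.
have [_ dimL [act1 actM] _ _] := galL.
have split := splitting_axiom dimL act1 actM phiS phiD.
pose mE := FieldExt_isSplittingField.Build K E0 split.
pose E : splittingFieldType K := HB.pack (FieldExt.sort E0) mE.
pose phi : {lrmorphism L -> E} := phi0.
have phiSE : forall y : E, exists x, phi x = y := phiS.
have phiDE : forall g h, g != h -> exists x, phi (act g x) != phi (act h x) := phiD.
have conj (t : gal_of {:E}) : exists g, forall x, t (phi x) = phi (act g x).
  pose psi : {lrmorphism L -> E} := (t \o phi : L -> E).
  have [g hg] := morphism_conj dimL phiDE psi.
  by exists g => x; rewrite -hg.
have [rho rhoP] := fin_all_exists conj.
have rho_uniq g h : (forall x, phi (act g x) = phi (act h x)) -> g = h.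
  move=> gh; apply/eqP; apply: contraT => /phiDE[x].
  by rewrite gh eqxx.
exists E, phi, rho; split; last exact: (trace_nondegenerate dimL phiDE); split.
- apply/and3P; split; [exact: sub1v | exact: sep | exact: normalFieldf].
- exact: (trace_sum dimL).
- exact: rhoP.
- move=> s t st; apply/eqP/gal_eqP => y _; have [x <-] := phiSE y.
  by rewrite !rhoP st.
- move=> s t; apply: rho_uniq => x.
  by rewrite -rhoP actM galM ?memvf // rhoP rhoP.
Qed.

End Package.

Lemma torsion_ring (R : comNzRingType) (t b : R) : 4%:R = 0 :> R ->
  2%:R * t = 2%:R -> 2%:R * b = 2%:R ->
  t * (1 + b) + 2%:R + (t * (1 + b) + 2%:R) = 0.
Proof.
move=> e4 et eb; have -> : t * (1 + b) + 2%:R + (t * (1 + b) + 2%:R)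
  = 2%:R * t * (1 + b) + 4%:R by ring.
by rewrite et mulrDr eb e4 mulr1 -natrD addr0.
Qed.

(** * The trace form of the algebra over a fixed field *)

Section Link.

Variables (K : fieldType) (G : finGroupType) (L : falgType K).
Variables (act : G -> {lrmorphism L -> L}) (E : splittingFieldType K).
Variables (phi : {lrmorphism L -> E}) (rho : gal_of {:E} -> G).
Hypothesis dimL : \dim {:L} = #|G|.
Hypothesis actM : forall g h x, act (g * h)%g x = act g (act h x).
Hypothesis traceE : forall x, (alg_trace x)%:A = \sum_g phi (act g x).
Hypothesis rhoP : forall (t : gal_of {:E}) x, t (phi x) = phi (act (rho t) x).
Hypothesis rho_inj : injective rho.
Hypothesis rhoM : forall s t : gal_of {:E}, rho (s * t)%g = (rho t * rho s)%g.
Implicit Types (Q : {group gal_of {:E}}).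

(** Inversion compensates the reversal of products by [rho]. *)
Definition gal_emb (t : gal_of {:E}) : G := (rho t)^-1%g.

Lemma gal_embM : {in [set: gal_of {:E}] &, {morph gal_emb : s t / (s * t)%g}}.
Proof. by move=> s t _ _; rewrite /gal_emb rhoM invMg. Qed.

Canonical gal_emb_morphism := Morphism gal_embM.

Lemma gal_emb_injm : ('injm gal_emb)%g.
Proof. by apply/injmP => s t _ _ /invg_inj/rho_inj. Qed.

Lemma rho_emb Q t : t \in Q -> rho t \in (gal_emb @* Q)%g.
Proof.
move=> tQ; rewrite -groupV -[(rho t)^-1%g]/(gal_emb t).
by rewrite mem_morphim ?inE.
Qed.

Lemma card_emb Q : #|(gal_emb @* Q)%g| = #|Q|.
Proof. by rewrite card_injm ?gal_emb_injm ?subsetT. Qed.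

(** The conjugates phi (g x) are grouped by the right cosets of the image H of Q. On each coset they
    are the Q-conjugates of one morphism, which accounts for one copy of the trace form of E over kf
    Q; [gram_iso] compares the two diagonalizations as families of vectors indexed by G. *)
Lemma trace_class_copies Q (e : 'I_(\dim {:L}) -> L) (c : 'I_(\dim {:L}) -> K) (t : witt (kf Q)) :
  (forall i, c i != 0) -> (forall i j, alg_trace (e i * e j) = c i *+ (i == j)) ->
  tclass t -> \sum_i w (in_alg (kf Q) (c i)) = t *+ (#|G| %/ #|Q|).
Proof.
move=> c0 ee [J [f [a [[cJ a0 ff] <-]]]].
pose H := (gal_emb @* Q)%G; pose R := rcosets H [set: G].
pose rep (k : 'I_#|R|) := fingroup.repr (enum_val k).
have cR : #|R| = (#|G| %/ #|Q|)%N.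
  have := Lagrange (subsetT H); rewrite cardsT card_emb => <-.
  by rewrite mulKn ?cardG_gt0.
have repE k : enum_val k = (H :* rep k)%g.
  have : enum_val k \in R := enum_valP k.
  by case/rcosetsP => g _ e0; rewrite /rep e0 rcoset_repr.
(* The vector f j placed on the k-th coset: its value at [rho s * rep k] is s (f j), and it is zero
   on the other cosets. *)
pose e' (kj : 'I_#|R| * J) g : E := \sum_(s in Q | (rho s * rep kj.1)%g == g) s (f kj.2).
have sum_e' kj X : \sum_g e' kj g * X g = \sum_(s in Q) s (f kj.2) * X (rho s * rep kj.1)%g.
  under eq_bigr do rewrite mulr_suml; rewrite (exchange_big_dep (mem Q)) /=; last by move=> ? ? _ /andP[].
  apply: eq_bigr => s sQ; rewrite sQ /= (bigD1 (rho s * rep kj.1)%g) //= big1 ?addr0 // => g.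
  by case/andP=> /eqP ->; rewrite eqxx.
have e'E kj k s : s \in Q -> e' kj (rho s * rep k)%g = (if k == kj.1 then s (f kj.2) else 0).
  move=> sQ; case: eqP => [->|nk].
    rewrite /e' (bigD1 s) ?sQ ?eqxx //= big1 ?addr0 // => s' /andP[/andP[_ /eqP/mulIg/rho_inj ->]].
    by rewrite eqxx.
  rewrite /e' big1 // => s' /andP[s'Q /eqP er]; case: nk; apply: enum_val_inj.
  rewrite !repE; have -> : rep k = ((rho s)^-1 * rho s' * rep kj.1)%g by rewrite -mulgA er mulKg.
  by rewrite rcosetM rcoset_id // groupM ?groupV ?rho_emb.
have vc x : vf Q (in_alg (kf Q) x) = x%:A by rewrite vfE -[LHS]/(x *: val (1 : kf Q)) val1.
have iso : isoI (fun i => in_alg (kf Q) (c i)) (fun kj : 'I_#|R| * J => a kj.2).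
  apply: (@gram_iso _ _ (vf Q) _ _ G (fun i g => phi (act g (e i))) e' _ _
    (fun i kj => kin Q (T Q (f kj.2 * phi (act (rep kj.1) (e i)))))).
  - by rewrite card_ord dimL.
  - by rewrite card_prod card_ord cR cJ divnK // -card_emb -cardsT cardSg ?subsetT.
  - by move=> kj; apply: a0.
  - move=> i i2; rewrite vc scalerMnl -ee traceE; apply: eq_bigr => g _.
    by rewrite !rmorphM.
  - move=> [k j] [k2 j2]; rewrite sum_e' /= vfE xpair_eqE.
    have [->|nk] := eqVneq k k2 => /=.
      rewrite -ff /T; apply: eq_bigr => s sQ; rewrite e'E //= eqxx; exact/esym/rmorphM.
    by rewrite mulr0n big1 // => s sQ; rewrite e'E //= (negbTE nk) mulr0.
  - move=> i [k j]; rewrite vfE kinK; last exact: T_fixed.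
    under eq_bigr do rewrite mulrC; rewrite sum_e' /T; apply: eq_bigr => s sQ.
    by rewrite /= actM -rhoP rmorphM.
have := iso_sum_w _ _ iso; rewrite -(pair_bigA _ (fun (_ : 'I_#|R|) j => w (a j))) /=.
rewrite sumr_const card_ord cR; apply=> [i|kj]; [by rewrite scaler_eq0 oner_eq0 orbF | exact: a0].
Qed.

End Link.

Section Local.

Variables (K : fieldType) (E : splittingFieldType K).
Hypothesis two : 2%:R != 0 :> K.
Hypothesis k5 : forall P : {group gal_of {:E}}, five_isotropic (kf P).
Hypothesis k2 : forall P : {group gal_of {:E}}, minus_one_two_squares (kf P).
Implicit Types (Q : {group gal_of {:E}}).

Lemma tclass_exists Q : 2.-group%g Q -> exists t, tclass (P := Q) t.
Proof.
have [n] := ubnP #|Q|; elim: n Q => // n IH Q leQ tQ.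
have [e|[M mM _]] := maximal_exists (sub1G Q).
  have <- : 1%G = Q by apply: val_inj.
  by exists 1; apply: tclass1.
have [sM _ _ cM] := maximal_2group tQ mM.
have [||t [I [e [a [tr _]]]]] := IH M; last 1 first.
- have [s [beta [lP JE [sP ls] b0 bP]]] := quad_max tQ mM.
  have tr' := trf_tr two lP JE sP ls b0 bP tr.
  exact: (ex_intro _ _ (ex_intro _ _ (ex_intro _ _ (ex_intro _ _ (conj tr' erefl))))).
- rewrite -ltnS (leq_trans _ leQ) // ltnS -cM -[X in (X < _)%N]mul1n ltn_mul2r.
  by rewrite cardG_gt0.
- exact: pgroupS sM tQ.
Qed.

Lemma cycle_2group (s : gal_of {:E}) : 2.-group%g <[s]>%G ->
  (1 < #[s]%g)%N -> exists j, #[s]%g = (2 ^ j.+1)%N.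
Proof. by move=> /p_natP[[|j] /= ej]; rewrite /order /= ej // => _; exists j. Qed.

Lemma cyclic_class Q : 2.-group%g Q -> cyclic Q -> (8 <= #|Q|)%N ->
  exists2 b : kf Q, b != 0 & tclass (w 2%:R * (1 + w b) + 2%:R) /\ 2%:R * w b = 2%:R.
Proof.
move=> tQ /cyclicP[s defQ]; have eQ : Q = <[s]>%G by apply: val_inj.
move: tQ; rewrite {}eQ => tQ Q8; rewrite /= -orderE in Q8.
have [j ej] := cycle_2group tQ (leq_trans (isT : 1 < 8)%N Q8).
have [i ei] : exists i, j = i.+2.
  by move: Q8; rewrite ej; case: j {ej} => [|[|i]] // _; exists i.
rewrite {}ei in ej.
have [beta b0 sb] : exists2 x : E, x != 0 & s x = - x by apply: exists_skew; rewrite ej oddX.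
have [gamma [g0 ssg m0]] : exists gamma, [/\ gamma != 0, s (s gamma) = - gamma & gamma ^+ 2 + s gamma ^+ 2 != 0].
  by apply: (exist_gamma two); rewrite ej (dvdn_exp2l 2 (isT : 2 <= i.+3)%N).
exists (sq2 <[s]>%G beta); first by rewrite -val_eq0 val_b // expf_neq0.
by split; [apply: (class_cyclic two k5 k2 ej b0 sb) | apply: two_wb sb b0 ssg m0].
Qed.

Lemma class_two_torsion Q : 2.-group%g Q -> (4 <= #|Q|)%N -> exists2 t, tclass (P := Q) t & t + t = 0.
Proof.
move=> tQ Q4; have [cQ|ncQ] := boolP (cyclic Q); last first.
  have [[u [v [u0 v0 _ _ tuv]]] _] := reduced_class two k5 tQ ncQ.
  by exists (pf u v) => //; apply: (pf2 k5).
have [Q8|Q8] := leqP 8 #|Q|.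
  have [b b0 [tb eb]] := cyclic_class tQ cQ Q8; eexists; first exact: tb.
  apply: torsion_ring (four_eq0 (@k2 Q)) (w_two Q) eb.
have /cyclicP[s defQ] := cQ; have eQ : Q = <[s]>%G by apply: val_inj.
move: tQ Q4 Q8; rewrite {}eQ /= -orderE => tQ Q4 Q8.
apply: (class_order4 two k2).
have [j ej] := cycle_2group tQ (leq_trans (isT : 1 < 4)%N Q4).
by move: Q4 Q8; rewrite ej; case: j {ej} => [|[|j]] // _; rewrite -[8%N]/(2 ^ 3)%N ltn_exp2l.
Qed.

Lemma class_order2_group Q : #|Q| = 2%N -> exists2 b : kf Q, b != 0 & tclass (w 2%:R * (1 + w b)).
Proof.
move=> Q2; have /cyclicP[s defQ] : cyclic Q by apply: prime_cyclic; rewrite Q2.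
have eQ : Q = <[s]>%G by apply: val_inj.
move: Q2; rewrite {}eQ /= -orderE => os.
have [beta b0 sb] : exists2 x : E, x != 0 & s x = - x by apply: exists_skew; rewrite os.
exists (sq2 <[s]>%G beta); first by rewrite -val_eq0 val_b // expf_neq0.
exact: class_order2.
Qed.

End Local.

(** * Determinants, isometries and base change *)

Section Forms.

Variable k : fieldType.

Lemma isoI_det (m m' : nat) (a : 'I_m -> k) (b : 'I_m' -> k) : isoI a b ->
  exists c, \prod_i a i = c ^+ 2 * \prod_j b j.
Proof.
case; rewrite !card_ord => mm'; subst m'; case=> C Cab.
pose M : 'M[k]_m := \matrix_(i, j) C i j.
exists (\det M); have e : M *m diag_mx (\row_j b j) *m M^T = diag_mx (\row_i a i).
  apply/matrixP => i i'; rewrite !mxE -Cab; apply: eq_bigr => j _.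
  rewrite mul_mx_diag !mxE; ring.
have dE (f : 'I_m -> k) : \det (diag_mx (\row_i f i)) = \prod_i f i.
  by rewrite det_diag; apply: eq_bigr => i _; rewrite mxE.
by rewrite -!dE -e !det_mulmx det_tr; ring.
Qed.

(** Base change of an equality of classes goes through an isometry, whose matrix is mapped to the
    larger field. *)
Lemma sum_w_map (k' : fieldType) (h : {rmorphism k -> k'}) (I J : finType) (a : I -> k) (b : J -> k) :
  2%:R != 0 :> k -> (forall i, a i != 0) -> (forall j, b j != 0) -> #|I| = #|J| ->
  \sum_i w (a i) = \sum_j w (b j) -> \sum_i w (h (a i)) = \sum_j w (h (b j)).
Proof.
move=> two a0 b0 IJ /(sum_w_iso two a0 b0 IJ)[_ [C Cab]].
apply: iso_sum_w => [i|j|]; rewrite ?fmorph_eq0 //; split=> //.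
exists (fun i j => h (C i j)) => i i'; rewrite -rmorphMn -Cab rmorph_sum.
by apply: eq_bigr => j _; rewrite !rmorphM.
Qed.

Lemma sum_w_map_seq (k' : fieldType) (h : {rmorphism k -> k'}) (s s' : seq k) :
  2%:R != 0 :> k -> all (fun x => x != 0) s -> all (fun x => x != 0) s' -> size s = size s' ->
  \sum_(x <- s) w x = \sum_(x <- s') w x -> \sum_(x <- s) w (h x) = \sum_(x <- s') w (h x).
Proof.
move=> two s0 s'0 ss; have E (R : nmodType) (r : seq k) (f : k -> R) :
  \sum_(x <- r) f x = \sum_(i < size r) f r`_i by rewrite (big_nth 0) big_mkord.
rewrite !E => e.
apply: (sum_w_map h two) e; rewrite ?card_ord // => i.
  by apply: (allP s0); apply: mem_nth.
by apply: (allP s'0); apply: mem_nth.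
Qed.

End Forms.

Section Trace.

Variables (K : fieldType) (L : falgType K).
Hypothesis two : 2%:R != 0 :> K.
Hypothesis traceC : forall x y : L, alg_trace (x * y) = alg_trace (y * x).

Lemma alg_trace_linear a (x y : L) : alg_trace (a *: x + y) = a * alg_trace x + alg_trace y.
Proof.
have e1 : amull (a *: x + y) = a *: amull x + amull y by exact: amull_is_linear.
by rewrite /alg_trace e1 passmx.mxof_linear mxtraceD mxtraceZ.
Qed.

Lemma alg_traceD (x y : L) : alg_trace (x + y) = alg_trace x + alg_trace y.
Proof. by rewrite -{1}[x]scale1r alg_trace_linear mul1r. Qed.

Lemma alg_traceZ a (x : L) : alg_trace (a *: x) = a * alg_trace x.
Proof.
have t0 : alg_trace (0 : L) = 0 by apply: (addIr (alg_trace (0 : L))); rewrite -alg_traceD addr0 add0r.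
by rewrite -[a *: x]addr0 alg_trace_linear t0 addr0.
Qed.

Let B (x y : L) := alg_trace (x * y).
Let BD x y z : B (x + y) z = B x z + B y z. Proof. by rewrite /B mulrDl alg_traceD. Qed.
Let BZ a x z : B (a *: x) z = a * B x z. Proof. by rewrite /B -scalerAl alg_traceZ. Qed.

Variables (e : 'I_(\dim {:L}) -> L) (c : 'I_(\dim {:L}) -> K).
Hypotheses (ee : forall i j, B (e i) (e j) = c i *+ (i == j)) (c0 : forall i, c i != 0).

Let expand x : x = \sum_i (B x (e i) / c i) *: e i.
Proof. exact: (orth_expand BD BZ x (conj ee c0)). Qed.

Lemma disc_orth (d : K) : is_discriminant L d ->
  exists2 u, u != 0 & \prod_i c i = d * u ^+ 2.
Proof.
case=> b bB dE; pose A : 'M[K]_(\dim {:L}) := \matrix_(i, j) coord b j (e i).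
pose Gm : 'M[K]_(\dim {:L}) := \matrix_(i, j) alg_trace (tnth b i * tnth b j).
have eA i : e i = \sum_j A i j *: tnth b j.
  rewrite [LHS](coord_basis bB (memvf _)); apply: eq_bigr => j _.
  by rewrite mxE (tnth_nth 0).
have BS (f : 'I_(\dim {:L}) -> K) g z : B (\sum_j f j *: g j) z = \sum_j f j * B (g j) z.
  have B0 : B 0 z = 0 by rewrite -(scale0r 0) BZ mul0r.
  rewrite (big_morph (B^~ z) (fun x y => BD x y z) B0).
  by apply: eq_bigr => j _; rewrite BZ.
have e1 : A *m Gm *m A^T = diag_mx (\row_i c i).
  apply/matrixP => i j; rewrite !mxE -ee [in RHS](eA j) /B traceC -/(B _ _) BS.
  apply: eq_bigr => l _; rewrite !mxE mulrC; congr (_ * _).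
  rewrite /B traceC -/(B _ _) (eA i) BS; apply: eq_bigr => l' _.
  by rewrite !mxE.
have e2 : \prod_i c i = \det A ^+ 2 * d.
  transitivity (\det (diag_mx (\row_i c i))).
    by rewrite det_diag; apply: eq_bigr => i _; rewrite mxE.
  by rewrite -e1 !det_mulmx det_tr dE -/Gm mulrAC -expr2.
exists (\det A); last by rewrite mulrC.
have : \prod_i c i != 0 by apply/prodf_neq0 => i _.
by rewrite e2 mulf_eq0 expf_eq0 /= negb_or => /andP[].
Qed.

Lemma trace_form_isometric (a : seq K) :
  isoI c (fun i : 'I_(size a) => a`_i) -> (forall i : 'I_(size a), a`_i != 0) ->
  isometric (@trace_form K L) (diag_form a).
Proof.
case=> cIJ [C Cca] a0.
pose f (x : L) : 'rV[K]_(size a) := \row_j \sum_i B x (e i) / c i * C i j.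
have lf : linear f.
  move=> t x y; apply/rowP => j; rewrite !mxE mulr_sumr -big_split /=.
  by apply: eq_bigr => i _; rewrite BD BZ; field; exact: c0.
pose phi : {linear L -> 'rV[K]_(size a)} := HB.pack f (GRing.isLinear.Build K L 'rV[K]_(size a) *:%R f lf).
have BS (g : 'I_(\dim {:L}) -> K) i : B (\sum_j g j *: e j) (e i) = g i * c i.
  have B0 : B 0 (e i) = 0 by rewrite -(scale0r 0) BZ mul0r.
  rewrite (big_morph (B^~ (e i)) (fun x y => BD x y (e i)) B0) (bigD1 i) //= BZ ee eqxx big1 ?addr0 //.
  by move=> j ji; rewrite BZ ee (negbTE ji) mulr0.
have CD : forall j j' : 'I_(size a), \sum_i (a`_j * C i j / c i) * C i j' = (j == j')%:R.
  apply: (@mul_funs1C K _ _ C (fun j i => a`_j * C i j / c i)) => // i i'.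
  transitivity ((\sum_j C i j * C i' j * a`_j) / c i').
    by rewrite mulr_suml; apply: eq_bigr => j _; ring.
  by rewrite Cca; case: eqP => [->|_]; rewrite ?mulr1n ?divff // mulr0n mul0r.
have DC i i' : \sum_j C i j * (a`_j * C i' j / c i') = (i == i')%:R.
  transitivity ((\sum_j C i j * C i' j * a`_j) / c i').
    by rewrite mulr_suml; apply: eq_bigr => j _; ring.
  by rewrite Cca; case: eqP => [->|_]; rewrite ?mulr1n ?divff // mulr0n mul0r.
exists phi.
  exists (fun v : 'rV[K]_(size a) => \sum_i (\sum_j v 0 j * (a`_j * C i j / c i)) *: e i).
  - move=> x; rewrite [RHS]expand; apply: eq_bigr => i _; congr (_ *: _).
    transitivity (\sum_i' (B x (e i') / c i') * \sum_j C i' j * (a`_j * C i j / c i)).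
      under [RHS]eq_bigr do rewrite mulr_sumr; rewrite exchange_big; apply: eq_bigr => j _.
      rewrite [phi x]/(f x) mxE mulr_suml; apply: eq_bigr => i' _; ring.
    under eq_bigr do rewrite DC; rewrite (bigD1 i) //= eqxx mulr1 big1 ?addr0 // => i' ii.
    by rewrite (negbTE ii) mulr0.
  - move=> v; apply/rowP => j; rewrite [phi _]/(f _) mxE.
    under eq_bigr do rewrite BS mulfK // mulr_suml; rewrite exchange_big /=.
    transitivity (\sum_j' v 0 j' * \sum_i (a`_j' * C i j' / c i) * C i j).
      by apply: eq_bigr => j' _; rewrite mulr_sumr; apply: eq_bigr => i _; rewrite -mulrA.
    under eq_bigr do rewrite CD; rewrite (bigD1 j) //= eqxx mulr1 big1 ?addr0 // => j' jj.
    by rewrite (negbTE jj) mulr0.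
move=> x; rewrite /diag_form /trace_form.
pose g i := B x (e i) / c i.
transitivity (\sum_i \sum_i' g i * g i' * \sum_j C i j * C i' j * a`_j).
  under [RHS]eq_bigr => i _ do under eq_bigr do rewrite mulr_sumr.
  under [RHS]eq_bigr => i _ do rewrite exchange_big.
  rewrite [RHS]exchange_big; apply: eq_bigr => j _ /=.
  rewrite /f mxE expr2 big_distrlr /= mulr_sumr; apply: eq_bigr => i _.
  rewrite mulr_sumr; apply: eq_bigr => i' _; rewrite /g; ring.
have gx : \sum_i g i *: e i = x by symmetry; exact: expand.
transitivity (B (\sum_i g i *: e i) x); last by rewrite gx expr2.
have B0 : B 0 x = 0 by rewrite -(scale0r 0) BZ mul0r.
rewrite (big_morph (B^~ x) (fun u v => BD u v x) B0); apply: eq_bigr => i _.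
rewrite BZ -/(g i) (bigD1 i) //= Cca eqxx big1 ?addr0 => [|i' ii].
  by rewrite mulr1n /g /B (traceC (e i)); field; exact: c0.
by rewrite Cca eq_sym (negbTE ii) mulr0.
Qed.

End Trace.

(** * The class of the trace form over the fixed field of a 2-subgroup *)

Section Mod4.

Variable R : pzRingType.
Hypothesis four : 4%:R = 0 :> R.

Lemma mulrn_mod4 (x : R) m : x *+ m = x *+ (m %% 4).
Proof.
rewrite {1}(divn_eq m 4) mulrnDr mulrnA -[_ *+ _ *+ 4]mulr_natr four mulr0 add0r //.
Qed.

End Mod4.

Lemma sub2_mod4 m : (0 < m -> m %% 8 = 0 -> (m - 2) %% 4 = 2 %% 4)%N.
Proof. lia. Qed.

Lemma sub2_mod4' m : (m %% 8 = 2 %% 8 -> (m - 2) %% 4 = 0)%N.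
Proof. lia. Qed.

Lemma two_le_mod8 m : (0 < m -> m %% 8 = 0 \/ m %% 8 = 2 -> 2 <= m)%N.
Proof. lia. Qed.

Lemma mod8_mod4 m : (m %% 4 = m %% 8 %% 4)%N.
Proof. lia. Qed.

Lemma four_le_pow2 l N : ((2 ^ l * N) %% 8 = 0 -> ~~ odd N -> ~~ (4 %| N) -> 4 <= 2 ^ l)%N.
Proof. by case: l => [|[|l]]; rewrite ?expn0 ?expn1 ?expnS; lia. Qed.

Lemma pow2_le1 l N : ((2 ^ l * N) %% 8 = 2 %% 8 -> l <= 1)%N.
Proof. by case: l => [|[|l]] //; rewrite !expnS; lia. Qed.

Lemma odd_mod8 N : ((2 ^ 1 * N) %% 8 = 2 %% 8 -> odd N /\ N %% 4 = 1)%N.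
Proof. by rewrite expn1; split; lia. Qed.

Lemma two_part l N : odd N -> ((2 ^ l * N)`_2 = 2 ^ l)%N.
Proof.
move=> oN; have N0 : (0 < N)%N by case: N oN.
have N2 : (N`_2 = 1)%N by apply: part_p'nat; rewrite p'natE // dvdn2 oN.
rewrite partnM ?expn_gt0 // N2 muln1 part_pnat_id // pnatX; exact: orTb.
Qed.

Section Local.

Variables (K : fieldType) (G : finGroupType) (E : splittingFieldType K).
Variable rho : gal_of {:E} -> G.
Hypothesis rho_inj : injective rho.
Hypothesis rhoM : forall s t : gal_of {:E}, rho (s * t)%g = (rho t * rho s)%g.
Hypothesis two : 2%:R != 0 :> K.
Hypothesis k5 : forall P : {group gal_of {:E}}, five_isotropic (kf P).
Hypothesis k2 : forall P : {group gal_of {:E}}, minus_one_two_squares (kf P).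
Hypothesis reduced : two_reduced G.

Let f := gal_emb_morphism rhoM.

Lemma class_full_sylow (Q : {group gal_of {:E}}) : (2.-group Q)%g ->
  (f @* Q)%G \in 'Syl_2([set: G])%g -> ~~ cyclic (f @* Q)%g -> (8 %| #|Q|)%N ->
  tclass (0 : witt (kf Q)).
Proof.
have fI : ('injm f)%g := gal_emb_injm rho_inj rhoM.
have sT (A : {set gal_of {:E}}) : A \subset [set: gal_of {:E}] := subsetT A.
move=> tQ sylQ ncQ Q8.
have [|J0 J0Q hJ0] := order8_subquotient reduced sylQ ncQ; first by rewrite card_injm.
pose J := (f @*^-1 J0)%G.
have fJ : (f @* J)%g = J0 :> {set G} by rewrite morphpreK // (subset_trans J0Q) ?morphimS.
have JQ : J \subset Q by rewrite -(injmSK fI) // fJ.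
have tJ : (2.-group J)%g := pgroupS JQ tQ.
case: hJ0; last first.
  rewrite -fJ card_injm // injm_abelian // => -[J8 nJ].
  by apply: (zero_up two tQ JQ); [rewrite J8 | apply: order8_zero].
rewrite -fJ -injm_Phi // index_injm ?Phi_sub // => J8.
have ncJ : ~~ cyclic J.
  apply: contraL J8 => cJ; rewrite -ltnNge ltnS -card_quotient ?gFnorm //.
  have eJ := Phi_quotient_abelem tJ; rewrite (card_pgroup (abelem_pgroup eJ)).
  have := abelem_cyclic eJ; rewrite quotient_cyclic // => /esym l1.
  by rewrite (leq_trans (leq_pexp2l _ l1)).
have J1 : (1 < #|J|)%N.
  by apply: leq_trans (dvdn_leq (cardG_gt0 J) (dvdn_indexg J 'Phi(J)%G)); apply: leq_trans J8.
apply: (zero_up two tQ JQ) => //.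
by have [_ rJ] := reduced_class two k5 tJ ncJ; exact: rJ.
Qed.

(** As 4 = 0, multiplicities count modulo 4. For n = 0 mod 8 the right side with b = 1 is 2 + 2 = 0,
    and the copies add up to 0 unless Q is a full cyclic Sylow subgroup, where [cyclic_class]
    provides b. For n = 2 mod 8 the term n - 2 vanishes and Q has order 1 or 2; the number of copies
    is 2 modulo 4 in the first case and 1 in the second. *)
Lemma local_class (Q : {group gal_of {:E}}) : (2.-group Q)%g ->
  (#|G| = 0 %[mod 8] \/ #|G| = 2 %[mod 8])%N ->
  exists (t : witt (kf Q)) (b : kf Q), [/\ b != 0, tclass t,
    t *+ (#|G| %/ #|Q|) = w 2%:R * (1 + w b) + (#|G| - 2)%:R &
    [forall (P : {group G} | P \in 'Syl_2([set: G])%g), ~~ cyclic P] -> b = 1].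
Proof.
have fI : ('injm f)%g := gal_emb_injm rho_inj rhoM.
have sT (A : {set gal_of {:E}}) : A \subset [set: gal_of {:E}] := subsetT A.
move=> tQ n8; have e4 : 4%:R = 0 :> witt (kf Q) := four_eq0 (k2 Q).
have [P sylP QP] : exists2 P : {group G}, P \in 'Syl_2([set: G])%g & (f @* Q)%g \subset P.
  have [P sP] := Sylow_superset (subsetT (f @* Q)%g) (morphim_pgroup f tQ).
  by exists P; rewrite ?inE.
have cP : #|P| = (#|G|`_2)%N by move: sylP; rewrite inE => /card_Hall ->; rewrite cardsT.
have cQ : #|f @* Q|%g = #|Q| by rewrite card_injm.
have QdP : (#|Q| %| #|P|)%N by rewrite -cQ cardSg.
have PG : (#|P| %| #|G|)%N by rewrite cP dvdn_part.
have QG : #|G| = (#|Q| * (#|G| %/ #|Q|))%N by rewrite mulnC divnK // (dvdn_trans QdP PG).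
have b1 : 1 != 0 :> kf Q := oner_neq0 _.
have w2two : w (2%:R : kf Q) * (1 + w 1) = 2%:R by rewrite w1 mulrC -(w_two Q).
have [l cQ2] : exists l, #|Q| = (2 ^ l)%N by exists (logn 2 #|Q|); rewrite -(card_pgroup tQ).
move: (#|G| %/ #|Q|)%N QG => N; rewrite cQ2 => QG.
have noncycP : cyclic P -> [forall (P : {group G} | P \in 'Syl_2([set: G])%g), ~~ cyclic P] -> False.
  by move=> cycP /forall_inP/(_ P sylP); rewrite cycP.
(* An odd number of copies means that Q has the order of a Sylow subgroup of G. *)
have fullP : odd N -> P = (f @* Q)%G.
  move=> oN; apply/val_inj/esym/eqP; rewrite eqEcard QP /= cP cQ cQ2 QG.
  by rewrite two_part.
case: n8 => n8.
  have n2 : (#|G| - 2)%:R = 2%:R :> witt (kf Q).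
    rewrite [LHS](mulrn_mod4 e4) [RHS](mulrn_mod4 e4); congr (_ *+ _).
    by apply: sub2_mod4; [rewrite -cardsT cardG_gt0 | rewrite n8].
  have ok (t : witt (kf Q)) : tclass t -> t *+ N = 0 -> exists (t : witt (kf Q)) (b : kf Q), [/\ b != 0, tclass t,
    t *+ N = w 2%:R * (1 + w b) + (#|G| - 2)%:R &
    [forall (P : {group G} | P \in 'Syl_2([set: G])%g), ~~ cyclic P] -> b = 1].
    by move=> tt t0; exists t, 1; split=> //; rewrite t0 w2two n2 -natrD.
  have [oN|eN] := boolP (odd N); last first.
    have [N4|N4] := boolP (4 %| N)%N.
      have [t tt] := tclass_exists two tQ; apply: (ok t tt).
      by rewrite (mulrn_mod4 e4) (eqP N4).
    have [|t tt t0] := class_two_torsion two k5 k2 tQ.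
      by rewrite cQ2 (four_le_pow2 _ eN N4) // -QG n8.
    apply: (ok t tt); rewrite -(odd_double_half N) (negbTE eN) add0n -mul2n mulrnA.
    by rewrite mulr2n t0 mul0rn.
  have Q8 : (8 %| #|Q|)%N.
    have : (8 %| #|G|)%N by rewrite /dvdn n8.
    by rewrite QG cQ2 Gauss_dvdl // (@coprimeXl 3 2) // coprime2n.
  have [cycP|ncP] := boolP (cyclic P); last first.
    apply: (ok 0); last by rewrite mul0rn.
    by apply: class_full_sylow => //; move: sylP ncP; rewrite fullP.
  have cycQ : cyclic Q by rewrite -(injm_cyclic fI (sT _)); move: cycP; rewrite fullP.
  have [|b b0 [tb eb]] := cyclic_class two k5 k2 tQ cycQ; first by apply: dvdn_leq; rewrite ?cardG_gt0.
  exists (w 2%:R * (1 + w b) + 2%:R), b; split=> // [|/(noncycP cycP)//].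
  rewrite n2 -[N]odd_double_half oN mulrnDr -mul2n mulrnA mulr2n.
  have -> := torsion_ring e4 (w_two Q) eb; by rewrite mul0rn addr0.
have n0 : (#|G| - 2)%:R = 0 :> witt (kf Q).
  rewrite [LHS](mulrn_mod4 e4) -[RHS](mulr0n 1); congr (_ *+ _).
  by apply: sub2_mod4'.
have l1 : (l <= 1)%N.
  by apply: (pow2_le1 (N := N)); rewrite -QG n8.
case: l l1 cQ2 QG => [|[|//]] _ cQ2 QG.
  have Q1 : Q = 1%G by apply/val_inj/eqP; rewrite trivg_card1 cQ2.
  exists 1, 1; split=> //; first by rewrite Q1; exact: tclass1.
  rewrite w2two n0 addr0 (mulrn_mod4 e4); move: QG; rewrite mul1n => <-.
  by rewrite mod8_mod4 n8.
have [b b0 tb] := class_order2_group two cQ2.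
have [oN N4] : odd N /\ (N %% 4 = 1)%N by apply: odd_mod8; rewrite -QG.
exists (w 2%:R * (1 + w b)), b; split=> //; first by rewrite (mulrn_mod4 e4) N4 n0 addr0.
move/noncycP => []; apply: prime_cyclic.
by rewrite fullP //= cQ cQ2.
Qed.

End Local.

(** * Descent to the ground field *)

Section Descent.

Variables (k : fieldType) (M : fieldExtType k).
Hypotheses (two : 2%:R != 0 :> k) (oddM : odd (\dim {:M})).
Hypotheses (k5 : five_isotropic k) (k2 : minus_one_two_squares k).

(** Two even ranks are made equal by adding planes <1, -1>, which stay hyperbolic after base
    change. *)
Lemma sum_w_map_even (k' : fieldType) (h : {rmorphism k -> k'}) (m m' : nat) (s s' : seq k) :
  size s = (2 * m)%N -> size s' = (2 * m')%N ->
  all (fun x => x != 0) s -> all (fun x => x != 0) s' ->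
  \sum_(x <- s) w x = \sum_(x <- s') w x -> \sum_(x <- s) w (h x) = \sum_(x <- s') w (h x).
Proof.
move=> sm sm' s0 s'0 ss; pose pad j := flatten (nseq j [:: 1; -1 : k]).
have size_pad j : size (pad j) = (2 * j)%N by elim: j => //= j ->; rewrite mulnS.
have pad0 j : all (fun x => x != 0) (pad j).
  by elim: j => //= j ->; rewrite oppr_eq0 oner_neq0.
have sum_pad (R : nmodType) (F : k -> R) j : F 1 + F (-1) = 0 -> \sum_(x <- pad j) F x = 0.
  by move=> F0; elim: j => [|j IH]; rewrite ?big_nil //= !big_cons IH addr0.
have p1 j : \sum_(x <- pad j) w x = 0 by apply: sum_pad; rewrite wN subrr.
have p2 j : \sum_(x <- pad j) w (h x) = 0 by apply: sum_pad; rewrite rmorphN wN subrr.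
have := @sum_w_map_seq k k' h (s ++ pad m') (s' ++ pad m) two.
rewrite !all_cat s0 s'0 !pad0 !size_cat !size_pad sm sm' addnC !big_cat /= !p1 !p2 !addr0.
by apply.
Qed.

Lemma sum_descent (s s' : seq k) u :
  size s = size s' -> all (fun x => x != 0) s -> all (fun x => x != 0) s' ->
  u != 0 -> \prod_(x <- s) x = \prod_(x <- s') x * u ^+ 2 ->
  \sum_(x <- s) w (in_alg M x) = \sum_(x <- s') w (in_alg M x) ->
  \sum_(x <- s) w x = \sum_(x <- s') w x.
Proof.
move=> ss s0 s'0 u0 dd sM; pose l := s ++ map -%R s'.
have sl : size l = (2 * size s)%N by rewrite size_cat size_map -ss mul2n addnn.
have l0 : all (fun x => x != 0) l.
  rewrite all_cat s0 all_map; apply: sub_all s'0 => x /=; by rewrite oppr_eq0.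
have prodN (r : seq k) : \prod_(x <- map -%R r) x = (-1) ^+ size r * \prod_(x <- r) x.
  by elim: r => [|x r IH]; rewrite ?big_nil ?mulr1 //= !big_cons IH exprS; ring.
have p0 : \prod_(x <- s') x != 0.
  by rewrite prodf_seq_neq0.
have [|x [y [x0 y0 lxy]]] := even_disc_pf k5 sl l0.
  exists (\prod_(x <- s') x * u); first by rewrite mulf_neq0.
  rewrite big_cat /= prodN dd -ss.
  transitivity (((-1) ^+ size s * (-1) ^+ size s) * (\prod_(x <- s') x * u) ^+ 2); first by ring.
  by rewrite -expr2 sqrr_sign mul1r.
have lF (k' : fieldType) (h : {rmorphism k -> k'}) :
    \sum_(z <- l) w (h z) = \sum_(z <- s) w (h z) - \sum_(z <- s') w (h z).
  rewrite big_cat big_map -sumrN; congr (_ + _); apply: eq_bigr => z _.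
  by rewrite rmorphN wN.
have pfE (k' : fieldType) (h : {rmorphism k -> k'}) :
    \sum_(z <- [:: 1; - x; - y; x * y]) w (h z) = pf (h x) (h y).
  rewrite !big_cons big_nil !rmorphN rmorphM rmorph1 !wN wM w1 /pf; ring.
have t0 : all (fun z => z != 0) [:: 1; - x; - y; x * y].
  by rewrite /= !oppr_eq0 mulf_eq0 (negbTE x0) (negbTE y0) oner_neq0.
have xy0 : pf x y = 0.
  apply: (springer_pf two oddM k5 k2 x0 y0).
  rewrite -(pfE M (in_alg M)) -(@sum_w_map_even M (in_alg M) (size s) 2 l) //.
    by rewrite lF sM subrr.
  by rewrite lxy -(pfE k idfun).
apply/eqP; rewrite -subr_eq0; apply/eqP.
by have := lF k idfun; rewrite /= lxy xy0 => <-.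
Qed.

End Descent.

Section TraceSum.

Variables (K : fieldType) (L : falgType K).
Hypothesis two : 2%:R != 0 :> K.
Hypothesis traceC : forall x y : L, alg_trace (x * y) = alg_trace (y * x).
Variables (e : 'I_(\dim {:L}) -> L) (c : 'I_(\dim {:L}) -> K).
Hypotheses (ee : forall i j, alg_trace (e i * e j) = c i *+ (i == j)) (c0 : forall i, c i != 0).

Lemma trace_form_of_sum (a : seq K) : all (fun x => x != 0) a -> size a = \dim {:L} ->
  \sum_i w (c i) = \sum_(x <- a) w x -> isometric (@trace_form K L) (diag_form a).
Proof.
move=> a0 sa ca; have a0i (i : 'I_(size a)) : a`_i != 0 by apply: (allP a0); apply: mem_nth.
apply: (trace_form_isometric traceC ee c0) => //.
apply: (sum_w_iso two c0 a0i); first by rewrite !card_ord.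
by rewrite ca (big_nth 0) big_mkord.
Qed.

Variables (M : fieldExtType K) (d u : K) (b : M).
Hypotheses (oddM : odd (\dim {:M})) (k5 : five_isotropic K) (k2 : minus_one_two_squares K).
Hypotheses (dim2 : (2 <= \dim {:L})%N) (u0 : u != 0) (du : \prod_i c i = d * u ^+ 2) (b0 : b != 0).
Hypothesis cM : \sum_i w (in_alg M (c i)) = w 2%:R * (1 + w b) + (\dim {:L} - 2)%:R.

Let ones (k : fieldType) (R : nmodType) (F : k -> R) m : \sum_(x <- nseq m 1) F x = F 1 *+ m.
Proof. by elim: m => [|m IH]; rewrite ?big_nil // big_cons IH mulrS. Qed.

Let sum_ones (k : fieldType) m : \sum_(x <- nseq m (1 : k)) w x = m%:R.
Proof. by rewrite ones w1. Qed.

Let prod_ones (k : fieldType) m : \prod_(x <- nseq m (1 : k)) x = 1.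
Proof. by rewrite big1_seq // => x /andP[_ /nseqP[->]]. Qed.

Let d0 : d != 0.
Proof.
have : \prod_i c i != 0 by apply/prodf_neq0 => i _.
by rewrite du mulf_eq0 negb_or => /andP[].
Qed.

(** Determinants of the two diagonalizations over M: d u^2 equals 4 b up to a square. *)
Lemma disc_local : exists2 v, v != 0 & d%:A = v ^+ 2 * b.
Proof.
have twoM : 2%:R != 0 :> M by rewrite -(rmorph_nat (in_alg M)) fmorph_eq0.
pose a : seq M := [:: 2%:R, 2%:R * b & nseq (\dim {:L} - 2) 1].
have a0 : all (fun x => x != 0) a.
  by rewrite /= twoM mulf_neq0 //= all_nseq oner_neq0 orbT.
have a0i (i : 'I_(size a)) : a`_i != 0 by apply: (allP a0); apply: mem_nth.
have hc0 i : in_alg M (c i) != 0 by rewrite fmorph_eq0.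
have sa : size a = \dim {:L} by rewrite /= size_nseq -addn2 subnK.
have iso : isoI (fun i => in_alg M (c i)) (fun i : 'I_(size a) => a`_i).
  apply: (sum_w_iso twoM hc0 a0i); first by rewrite !card_ord.
  transitivity (\sum_(x <- a) w x); last by rewrite (big_nth 0) big_mkord.
  by rewrite cM !big_cons sum_ones wM; ring.
have [t] := isoI_det iso.
have -> : \prod_(i < size a) a`_i = 4%:R * b.
  transitivity (\prod_(x <- a) x); first by rewrite [RHS](big_nth 0) big_mkord.
  by rewrite !big_cons prod_ones; ring.
rewrite -rmorph_prod du rmorphM rmorphXn => h.
have hu0 : in_alg M u != 0 by rewrite fmorph_eq0.
exists (2%:R * t / in_alg M u).
  rewrite !mulf_neq0 ?invr_eq0 //; apply: contraTneq (d0) => t0.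
  move/eqP: h; rewrite t0 expr0n mul0r mulf_eq0 expf_eq0 /= (negbTE hu0) orbF => hd.
  by rewrite negbK -(fmorph_eq0 (in_alg M)).
have -> : d%:A = in_alg M d * in_alg M u ^+ 2 / in_alg M u ^+ 2 by rewrite mulfK // expf_neq0.
by rewrite h; field.
Qed.

Lemma trace_form_two_disc :
  isometric (@trace_form K L) (diag_form [:: 2%:R, 2%:R * d & nseq (\dim {:L} - 2) 1]) /\
  (b = 1 -> isometric (@trace_form K L) (diag_form (nseq (\dim {:L}) 1))).
Proof.
have [v v0 dv] := disc_local; set a := [:: _, _ & _].
have a0 : all (fun x => x != 0) a.
  by rewrite /= two mulf_neq0 //= all_nseq oner_neq0 orbT.
have sa : size a = \dim {:L} by rewrite /= size_nseq -addn2 subnK.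
have codomE (R : nmodType) (F : K -> R) : \sum_(x <- codom c) F x = \sum_i F (c i).
  by rewrite /codom big_map big_enum.
have ca : \sum_i w (c i) = \sum_(x <- a) w x.
  rewrite -codomE; apply: (@sum_descent K M two oddM k5 k2 _ _ (u / 2%:R)).
  - by rewrite size_codom card_ord sa.
  - by apply/allP => x /codomP[i ->].
  - by [].
  - by rewrite mulf_neq0 ?invr_eq0.
  - rewrite /codom big_map big_enum /= du !big_cons prod_ones mulr1.
    by field.
  rewrite codomE cM !big_cons (ones (fun x => w (in_alg M x))) rmorph1 w1.
  by rewrite rmorphM !rmorph_nat wM (w_sqr_eq v0 dv); ring.
split; first exact: trace_form_of_sum.
(* With b = 1, d is a square in M, hence in K because the degree is odd, and <2, 2> = <1, 1> in
   W. *)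
move=> b1; have [|r dr _] := @odd_ext_sqr _ _ oddM d v; first by rewrite dv b1 mulr1.
have r0 : r != 0 by apply: contraNneq (d0) => r0; rewrite dr r0 expr0n.
apply: trace_form_of_sum; rewrite ?all_nseq ?oner_neq0 ?orbT ?size_nseq //.
rewrite ca sum_ones !big_cons sum_ones wM.
have -> : w d = 1 by rewrite (w_sqr_eq (y := 1) r0) ?mulr1 ?w1.
have := w_add (1 : K) 1; rewrite mulr1 w1 => e2.
have e3 : w 2%:R + w 2%:R = 2%:R :> witt K.
  transitivity (w (1 + 1 : K) * (1 + 1)); first by rewrite mulrDr mulr1.
  exact: esym.
by rewrite mulr1 addrA e3 -natrD addnC subnK.
Qed.

End TraceSum.

(** * The theorem over global function fields *)

Lemma odd_dim_kf (K : fieldType) (E : splittingFieldType K) (Q : {group gal_of {:E}}) :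
  galois 1 {:E} -> Q \in 'Syl_2('Gal({:E} / 1))%g -> odd (\dim {:kf Q}).
Proof.
move=> galE; rewrite inE => /and3P[QG _ hQ].
have := dim_fixed_galois galE QG; rewrite dimv1 divn1 => dQ.
have -> : \dim {:kf Q} = #|'Gal({:E} / 1) : Q|%g by rewrite -dQ dimvf.
by rewrite -[odd _]negbK -dvdn2 -p'natE.
Qed.

Theorem corollary1p6
  (* K is a global function field: a finite extension of F(t), F finite *)
  (F : finFieldType) (K : fieldExtType {fraction {poly F}})
  (charK : 2%N \notin [pchar K])
  (Ks : fieldType) (iota : {rmorphism K -> Ks})
  (Ks_closure : separable_closure iota)
  (G : finGroupType) (n : nat)
  (G_reduced : two_reduced G) (G_order : #|G| = n)
  (n_mod8 : (n = 0 %[mod 8] \/ n = 2 %[mod 8])%N)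
  (L : falgType K) (act : G -> {lrmorphism L -> L})
  (L_galois : is_galois_algebra iota act)
  (d : K) (d_disc : is_discriminant L d) :
  let noncyclic_sylow2 :=
    [forall (P : {group G} | P \in 'Syl_2([set: G])%g), ~~ cyclic P] in
  (noncyclic_sylow2 ->
     isometric (@trace_form K L) (diag_form (nseq n (1 : K)))) /\
  (~~ noncyclic_sylow2 ->
     isometric (@trace_form K L)
       (diag_form [:: 2%:R, 2%:R * d & nseq (n - 2)%N (1 : K)])).
Proof.
move=> noncyclic.
have two : 2%:R != 0 :> K by apply: contra charK => two0; rewrite inE.
(* The property C_2 goes up from F(t) to K and to every fixed field [kf P], giving isotropy in rank
   five; the zero of <1, 1, 1> comes from the finite field F. *)
have C2K : C2sys K := C2sys_ext (@C2sys_ratfrac F).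
have k2K : minus_one_two_squares K.
  pose h1 : {rmorphism F -> {fraction {poly F}}} := @tofrac {poly F} \o polyC.
  exact: (minus_one_two_squares_rmorph (in_alg K \o h1) (@minus_one_two_squares_fin F)).
have [_ dimL [_ actM] _ _] := L_galois.
have [E [phi [rho [[galE traceE rhoP rho_inj rhoM] nondeg]]]] := galois_component L_galois.
have traceC (x y : L) : alg_trace (x * y) = alg_trace (y * x).
  apply: (fmorph_inj (in_alg E)); rewrite /= !traceE; apply: eq_bigr => g _.
  by rewrite !rmorphM mulrC.
have k5 (P : {group gal_of {:E}}) : five_isotropic (kf P) := C2sys_five (C2sys_ext C2K).
have k2 (P : {group gal_of {:E}}) : minus_one_two_squares (kf P).
  exact: minus_one_two_squares_rmorph (in_alg (kf P)) k2K.
have [e [c [ee c0]]] := orth_family two traceC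
  (fun x y z => etrans (congr1 _ (mulrDl x y z)) (alg_traceD _ _))
  (fun a x z => etrans (congr1 _ (esym (scalerAl a x z))) (alg_traceZ _ _)) nondeg.
have [u u0 du] := disc_orth traceC ee c0 d_disc.
have [Q sylQ] := Sylow_exists 2 'Gal({:E} / 1)%G.
have tQ : (2.-group Q)%g := pHall_pgroup sylQ.
have oddQ : odd (\dim {:kf Q}) by apply: odd_dim_kf; rewrite ?inE.
rewrite -{1 2}G_order in n_mod8.
have [t [b [b0 tt tb b1]]] := local_class rho_inj rhoM two k5 k2 G_reduced tQ n_mod8.
have dim2 : (2 <= \dim {:L})%N by rewrite dimL; apply: two_le_mod8; rewrite -?cardsT ?cardG_gt0 ?cardsT.
have cQ := trace_class_copies dimL actM traceE rhoP rho_inj rhoM c0 ee tt.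
rewrite tb -dimL in cQ.
have [iso iso1] := trace_form_two_disc two traceC ee c0 oddQ (C2sys_five C2K) k2K dim2 u0 du b0 cQ.
by rewrite -G_order -dimL; split=> [/b1/iso1|_].
Qed.
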